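(* Let $\Bbbk$ be an algebraically closed field (of arbitrary characteristic), let $H$ be an affine Hopf algebra over $\Bbbk$ and let $C$ be a central Hopf subalgebra of $H$ such that $H$ is a finitely generated $C$-module. Then for any $\mathfrak{m}\in\mathrm{maxSpec}\,C$, the category $H/\mathfrak{m}H\text{-mod}$ is a finite indecomposable exact module category over the finite tensor category $H/\mathfrak{m}_{\overline{\varepsilon}}H\text{-mod}$.
   Context: Affine means finitely generated as an algebra. For an algebra $A$, $A\text{-mod}$ is the category of finite-dimensional left $A$-modules. Let $\varepsilon$ be the counit of $H$, $\overline{\varepsilon}=\varepsilon|_C$, $\mathfrak{m}_{\overline{\varepsilon}}=\mathrm{Ker}\,\overline{\varepsilon}$. The coproduct of $H$ makes $H/\mathfrak{m}_{\overline{\varepsilon}}H$ a finite-dimensional Hopf algebra, so $H/\mathfrak{m}_{\overline{\varepsilon}}H\text{-mod}$ is a finite tensor category, and induces an algebra map $\overline{\Delta}:H/\mathfrak{m}H\to H/\mathfrak{m}_{\overline{\varepsilon}}H\otimes H/\mathfrak{m}H$ making $H/\mathfrak{m}H$ a left comodule algebra over $H/\mathfrak{m}_{\overline{\varepsilon}}H$. Hence $H/\mathfrak{m}H\text{-mod}$ is a left module category over $H/\mathfrak{m}_{\overline{\varepsilon}}H\text{-mod}$: $V\otimes W$ (tensor product over $\Bbbk$, for $V$ in $H/\mathfrak{m}_{\overline{\varepsilon}}H\text{-mod}$ and $W$ in $H/\mathfrak{m}H\text{-mod}$) is an $H/\mathfrak{m}H$-module via $\overline{\Delta}$. Module categories are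 left module categories. A finite module category $\mathcal{M}$ over a finite tensor category $\mathcal{C}$ (finite meaning that the underlying $\Bbbk$-linear abelian category is finite, i.e. equivalent to the finite-dimensional modules over a finite-dimensional algebra) is exact if $P\otimes M$ is projective in $\mathcal{M}$ for every projective object $P$ of $\mathcal{C}$ and every object $M$ of $\mathcal{M}$; it is indecomposable if it is not equivalent, as a module category, to a direct sum of two nonzero $\mathcal{C}$-module categories. *)

(* Defs.v *)
From HB Require Import structures.
From mathcomp Require Import all_boot all_algebra.
From mathcomp Require Import boolp classical_sets functions.

Set Implicit Arguments.
Unset Strict Implicit.
Unset Printing Implicit Defensive.

Import GRing.Theory.
Local Open Scope ring_scope.
Local Open Scope quotient_scope.

Definition bilin (k : fieldType) (U V W : lmodType k) (f : U -> V -> W) : Prop :=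
  (forall v, linear (f^~ v)) /\ (forall u, linear (f u)).

Section LinearProp.
Variables (k : fieldType) (U V : lmodType k) (f : U -> V).
Hypothesis lf : linear f.

Lemma lin0 : f 0 = 0.
Proof. by move: (lf (-1) 0 0); rewrite scaler0 add0r scaleN1r addNr. Qed.

Lemma linZ a u : f (a *: u) = a *: f u.
Proof. by rewrite -[a *: u]addr0 lf lin0 addr0. Qed.

Lemma linD u v : f (u + v) = f u + f v.
Proof. by rewrite -{1}[u]scale1r lf scale1r. Qed.

Lemma lin_sum I (r : seq I) (F : I -> U) :
  f (\sum_(i <- r) F i) = \sum_(i <- r) f (F i).
Proof. by apply: (big_morph f linD lin0). Qed.

End LinearProp.

(* [seq (V * W)] is seen as the type of formal sums of pairs [v (x) w].  Two
   formal sums define the same element of the tensor product iff they have the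
   same image under every bilinear map; the universal property [tlift] then
   holds by construction. *)
Section Tensor.
Variables (k : fieldType) (V W : lmodType k).

Definition fsum_eval (U : lmodType k) (f : V -> W -> U) (s : seq (V * W)) : U :=
  \sum_(p <- s) f p.1 p.2.

Definition fsum_eq (s t : seq (V * W)) : bool :=
  `[< forall (U : lmodType k) (f : V -> W -> U),
        bilin f -> fsum_eval f s = fsum_eval f t >].

Lemma fsum_eq_equiv : equiv_class_of fsum_eq.
Proof.
split.
- by move=> s; apply/asboolP.
- by move=> s t; apply/asboolP/asboolP => h U f bf; rewrite h.
- move=> t s u /asboolP h1 /asboolP h2; apply/asboolP => U f bf.
  by rewrite h1 // h2.
Qed.

Canonical fsum_eq_equiv_rel := EquivRelPack fsum_eq_equiv.
Canonical fsum_eq_encModRel := defaultEncModRel fsum_eq.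

Definition tensor := {eq_quot fsum_eq}.
HB.instance Definition _ : EqQuotient _ fsum_eq tensor := EqQuotient.on tensor.
HB.instance Definition _ := Choice.on tensor.

Definition fsum_pi (s : seq (V * W)) : tensor := \pi_tensor s.

(* The map out of the tensor product induced by [f]; meaningful when [f] is
   bilinear (see [tliftE] and [tlift_linear]). *)
Definition tlift (U : lmodType k) (f : V -> W -> U) (x : tensor) : U :=
  fsum_eval f (repr x).

Lemma tlift_pi (U : lmodType k) (f : V -> W -> U) s :
  bilin f -> tlift f (fsum_pi s) = fsum_eval f s.
Proof.
move=> bf; rewrite /tlift.
have /eqmodP/asboolP h : repr (fsum_pi s) = s %[mod tensor] by rewrite reprK.
exact: h.
Qed.

Lemma tensor_eqP (x y : tensor) :
  (forall (U : lmodType k) (f : V -> W -> U), bilin f -> tlift f x = tlift f y)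
  -> x = y.
Proof.
move=> h; rewrite -[x]reprK -[y]reprK.
by apply/eqmodP/asboolP => U f bf; exact: h.
Qed.

Definition tens_zero : tensor := fsum_pi [::].
Definition tens_add (x y : tensor) : tensor := fsum_pi (repr x ++ repr y).
Definition tens_scale (a : k) (x : tensor) : tensor :=
  fsum_pi [seq (a *: p.1, p.2) | p <- repr x].
Definition tens_opp (x : tensor) : tensor := tens_scale (-1) x.

Section Eval.
Variables (U : lmodType k) (f : V -> W -> U).
Hypothesis bf : bilin f.

Lemma tlift_zero : tlift f tens_zero = 0.
Proof. by rewrite tlift_pi // /fsum_eval big_nil. Qed.

Lemma tlift_add x y : tlift f (tens_add x y) = tlift f x + tlift f y.
Proof. by rewrite tlift_pi // /fsum_eval big_cat. Qed.

Lemma tlift_scale a x : tlift f (tens_scale a x) = a *: tlift f x.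
Proof.
rewrite tlift_pi // /fsum_eval big_map scaler_sumr; apply: eq_bigr => p _ /=.
exact: (linZ ((proj1 bf) p.2)).
Qed.

Lemma tlift_opp x : tlift f (tens_opp x) = - tlift f x.
Proof. by rewrite tlift_scale scaleN1r. Qed.

End Eval.

Let E := (tlift_zero, tlift_add, tlift_scale, tlift_opp).

Lemma tens_addA : associative tens_add.
Proof. by move=> x y z; apply: tensor_eqP => U f bf; rewrite !E // addrA. Qed.
Lemma tens_addC : commutative tens_add.
Proof. by move=> x y; apply: tensor_eqP => U f bf; rewrite !E // addrC. Qed.
Lemma tens_add0 : left_id tens_zero tens_add.
Proof. by move=> x; apply: tensor_eqP => U f bf; rewrite !E // add0r. Qed.
Lemma tens_addN : left_inverse tens_zero tens_opp tens_add.
Proof. by move=> x; apply: tensor_eqP => U f bf; rewrite !E // addNr. Qed.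

HB.instance Definition _ :=
  GRing.isZmodule.Build tensor tens_addA tens_addC tens_add0 tens_addN.

Lemma tens_scaleA a b x : tens_scale a (tens_scale b x) = tens_scale (a * b) x.
Proof. by apply: tensor_eqP => U f bf; rewrite !E // scalerA. Qed.
Lemma tens_scale1 : left_id 1 tens_scale.
Proof. by move=> x; apply: tensor_eqP => U f bf; rewrite !E // scale1r. Qed.
Lemma tens_scaleDr : right_distributive tens_scale +%R.
Proof. by move=> a x y; apply: tensor_eqP => U f bf; rewrite !E // scalerDr. Qed.
Lemma tens_scaleDl x : {morph tens_scale^~ x : a b / a + b}.
Proof. by move=> a b; apply: tensor_eqP => U f bf; rewrite !E // scalerDl. Qed.

HB.instance Definition _ := GRing.Zmodule_isLmodule.Build k tensor
  tens_scaleA tens_scale1 tens_scaleDr tens_scaleDl.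

Lemma tlift_linear (U : lmodType k) (f : V -> W -> U) :
  bilin f -> linear (tlift f).
Proof. by move=> bf a x y; rewrite -(tlift_scale bf) -tlift_add. Qed.

Definition tens (v : V) (w : W) : tensor := fsum_pi [:: (v, w)].

Lemma tliftE (U : lmodType k) (f : V -> W -> U) v w :
  bilin f -> tlift f (tens v w) = f v w.
Proof. by move=> bf; rewrite tlift_pi // /fsum_eval big_seq1. Qed.

Lemma tens_bilin : bilin tens.
Proof.
split=> [w | v] a x y; apply: tensor_eqP => U f bf;
  rewrite (tlift_linear bf) !tliftE //; [exact: (proj1 bf) | exact: (proj2 bf)].
Qed.

Lemma tensDl v v' w : tens (v + v') w = tens v w + tens v' w.
Proof. exact: (linD ((proj1 tens_bilin) w)). Qed.
Lemma tensDr v w w' : tens v (w + w') = tens v w + tens v w'.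
Proof. exact: (linD ((proj2 tens_bilin) v)). Qed.
Lemma tensZl a v w : tens (a *: v) w = a *: tens v w.
Proof. exact: (linZ ((proj1 tens_bilin) w)). Qed.
Lemma tensZr a v w : tens v (a *: w) = a *: tens v w.
Proof. exact: (linZ ((proj2 tens_bilin) v)). Qed.

Lemma tens_sumE (x : tensor) : x = \sum_(p <- repr x) tens p.1 p.2.
Proof.
apply: tensor_eqP => U f bf; rewrite (lin_sum (tlift_linear bf)).
by apply: eq_bigr => p _; rewrite tliftE.
Qed.

Lemma tens_ext (U : lmodType k) (f g : tensor -> U) :
  linear f -> linear g -> (forall v w, f (tens v w) = g (tens v w)) -> f =1 g.
Proof.
move=> lf lg h x; rewrite [x]tens_sumE (lin_sum lf) (lin_sum lg).
by apply: eq_bigr => p _.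
Qed.

End Tensor.

Arguments tensor {k} V W.
Arguments tens {k V W} v w.
Arguments tlift {k V W U} f x.

Notation "v ⊗ w" := (tens v w) (at level 40, left associativity).

Section LinearCombinators.
Variable k : fieldType.

Lemma lin_id (U : lmodType k) : linear (@id U).
Proof. by []. Qed.

Lemma lin_comp (U V W : lmodType k) (f : V -> W) (g : U -> V) :
  linear f -> linear g -> linear (fun x => f (g x)).
Proof. by move=> lf lg a x y; rewrite lg lf. Qed.

Lemma tlift_param (V W T U : lmodType k) (F : T -> V -> W -> U) x :
  (forall v w, linear (fun t => F t v w)) -> linear (fun t => tlift (F t) x).
Proof.
move=> lF a s t; rewrite /tlift /fsum_eval scaler_sumr -big_split /=.
by apply: eq_bigr => p _; rewrite lF.
Qed.

Lemma tens_linl (T V W : lmodType k) (f : T -> V) (w : W) :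
  linear f -> linear (fun t => f t ⊗ w).
Proof. exact: (lin_comp ((proj1 (tens_bilin V W)) w)). Qed.

Lemma tens_linr (T V W : lmodType k) (f : T -> W) (v : V) :
  linear f -> linear (fun t => v ⊗ f t).
Proof. exact: (lin_comp ((proj2 (tens_bilin V W)) v)). Qed.

End LinearCombinators.

Section TensorMaps.
Variable k : fieldType.

Section Map.
Variables (V V' W W' : lmodType k) (f : V -> V') (g : W -> W').

Definition tmap : tensor V W -> tensor V' W' := tlift (fun v w => f v ⊗ g w).

Hypotheses (lf : linear f) (lg : linear g).

Lemma tmap_bilin : bilin (fun v w => f v ⊗ g w).
Proof. by split=> ?; [exact: tens_linl | exact: tens_linr]. Qed.

Lemma tmapE v w : tmap (v ⊗ w) = f v ⊗ g w.
Proof. exact: tliftE tmap_bilin. Qed.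

Lemma tmap_linear : linear tmap.
Proof. exact: tlift_linear tmap_bilin. Qed.

End Map.

Section Assoc.
Variables V W U : lmodType k.

Definition tassoc : tensor (tensor V W) U -> tensor V (tensor W U) :=
  tlift (fun x (u : U) => tlift (fun (v : V) (w : W) => v ⊗ (w ⊗ u)) x).

Definition tassoc_inv : tensor V (tensor W U) -> tensor (tensor V W) U :=
  tlift (fun (v : V) y => tlift (fun (w : W) (u : U) => v ⊗ w ⊗ u) y).

Let b1 (u : U) : bilin (fun (v : V) (w : W) => v ⊗ (w ⊗ u)).
Proof.
split=> ?; first by apply: tens_linl; exact: lin_id.
by apply: tens_linr; apply: tens_linl; exact: lin_id.
Qed.

Let b2 : bilin (fun x (u : U) => tlift (fun (v : V) (w : W) => v ⊗ (w ⊗ u)) x).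
Proof.
split=> ?; first exact: tlift_linear.
by apply: tlift_param => v w; do 2 apply: tens_linr; exact: lin_id.
Qed.

Lemma tassocE (v : V) (w : W) (u : U) : tassoc (v ⊗ w ⊗ u) = v ⊗ (w ⊗ u).
Proof. by rewrite /tassoc tliftE // tliftE. Qed.

Lemma tassoc_linear : linear tassoc.
Proof. exact: tlift_linear. Qed.

Let c1 (v : V) : bilin (fun (w : W) (u : U) => (v ⊗ w) ⊗ u).
Proof.
split=> ?; last by apply: tens_linr; exact: lin_id.
by apply: tens_linl; apply: tens_linr; exact: lin_id.
Qed.

Let c2 : bilin (fun (v : V) y => tlift (fun (w : W) (u : U) => (v ⊗ w) ⊗ u) y).
Proof.
split=> ?; last exact: tlift_linear.
by apply: tlift_param => w u; do 2 apply: tens_linl; exact: lin_id.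
Qed.

Lemma tassoc_invE (v : V) (w : W) (u : U) : tassoc_inv (v ⊗ (w ⊗ u)) = v ⊗ w ⊗ u.
Proof. by rewrite /tassoc_inv tliftE // tliftE. Qed.

Lemma tassoc_inv_linear : linear tassoc_inv.
Proof. exact: tlift_linear. Qed.

Lemma tens_ext3 (T : lmodType k) (f g : tensor (tensor V W) U -> T) :
  linear f -> linear g ->
  (forall v w u, f (v ⊗ w ⊗ u) = g (v ⊗ w ⊗ u)) -> f =1 g.
Proof.
move=> lf lg h; apply: tens_ext => // x u.
apply: (tens_ext (f := fun x => f (x ⊗ u)) (g := fun x => g (x ⊗ u))) => //.
- by apply: lin_comp => //; apply: tens_linl; exact: lin_id.
- by apply: lin_comp => //; apply: tens_linl; exact: lin_id.
Qed.

Lemma tens_ext3' (T : lmodType k) (f g : tensor V (tensor W U) -> T) :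
  linear f -> linear g ->
  (forall v w u, f (v ⊗ (w ⊗ u)) = g (v ⊗ (w ⊗ u))) -> f =1 g.
Proof.
move=> lf lg h; apply: tens_ext => // v.
apply: (tens_ext (f := fun x => f (v ⊗ x)) (g := fun x => g (v ⊗ x))) => //.
- by apply: lin_comp => //; apply: tens_linr; exact: lin_id.
- by apply: lin_comp => //; apply: tens_linr; exact: lin_id.
Qed.

Lemma tassocK : cancel tassoc tassoc_inv.
Proof.
apply: tens_ext3; last by move=> v w u; rewrite tassocE tassoc_invE.
- exact: lin_comp tassoc_inv_linear tassoc_linear.
- exact: lin_id.
Qed.

Lemma tassoc_invK : cancel tassoc_inv tassoc.
Proof.
apply: tens_ext3'; last by move=> v w u; rewrite tassoc_invE tassocE.
- exact: lin_comp tassoc_linear tassoc_inv_linear.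
- exact: lin_id.
Qed.

End Assoc.

Definition tscal (V : lmodType k) : tensor k^o V -> V :=
  tlift (fun (a : k^o) v => (a : k) *: v).

Definition tscal' (V : lmodType k) : tensor V k^o -> V :=
  tlift (fun v (a : k^o) => (a : k) *: v).

Lemma tscal_bilin (V : lmodType k) : bilin (fun (a : k^o) (v : V) => (a : k) *: v).
Proof.
split=> [v a x y | b a x y] /=; first by rewrite scalerDl scalerA.
by rewrite scalerDr !scalerA mulrC.
Qed.

Lemma tscal'_bilin (V : lmodType k) : bilin (fun (v : V) (a : k^o) => (a : k) *: v).
Proof. by split=> u; [exact: (proj2 (tscal_bilin V)) | exact: (proj1 (tscal_bilin V))]. Qed.

Lemma tscalE (V : lmodType k) (a : k^o) (v : V) : @tscal V (a ⊗ v) = (a : k) *: v.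
Proof. exact: tliftE (tscal_bilin V). Qed.

Lemma tscal'E (V : lmodType k) (a : k^o) (v : V) : @tscal' V (v ⊗ a) = (a : k) *: v.
Proof. exact: tliftE (tscal'_bilin V). Qed.

Lemma tscal_linear (V : lmodType k) : linear (@tscal V).
Proof. exact: tlift_linear (tscal_bilin V). Qed.

Lemma tscal'_linear (V : lmodType k) : linear (@tscal' V).
Proof. exact: tlift_linear (tscal'_bilin V). Qed.

Lemma tscalK (V : lmodType k) : cancel (@tscal V) (fun v => (1 : k^o) ⊗ v).
Proof.
apply: tens_ext => [||a v]; last by rewrite tscalE tensZr -tensZl [_ *: 1]mulr1.
- by apply: tens_linr; exact: tscal_linear.
- exact: lin_id.
Qed.

Lemma tscal'K (V : lmodType k) : cancel (@tscal' V) (fun v => v ⊗ (1 : k^o)).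
Proof.
apply: tens_ext => [||v a]; last by rewrite tscal'E tensZl -tensZr [_ *: 1]mulr1.
- by apply: tens_linl; exact: tscal'_linear.
- exact: lin_id.
Qed.

End TensorMaps.

Arguments tassoc {k V W U}.
Arguments tassoc_inv {k V W U}.
Arguments tscal {k V}.
Arguments tscal' {k V}.

Section FiniteDim.
Variable k : fieldType.

(* The library's [vectType] is not used because it does not cover [tensor],
   nor the infinite-dimensional spaces that occur here. *)
Definition finite_dim (V : lmodType k) : Prop :=
  exists (n : nat) (e : 'I_n -> V),
    forall v, exists c : 'I_n -> k, v = \sum_(i < n) c i *: e i.

Lemma finite_dim_regular : finite_dim k^o.
Proof.
by exists 1%N, (fun _ => 1 : k^o) => v; exists (fun=> v); rewrite big_ord1 [_ *: _]mulr1.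
Qed.

Lemma finite_dim_tensor (V W : lmodType k) :
  finite_dim V -> finite_dim W -> finite_dim (tensor V W).
Proof.
move=> [n [e he]] [m [f hf]].
pose P (p : 'I_n * 'I_m) := e p.1 ⊗ f p.2.
exists #|{: 'I_n * 'I_m}|, (fun i => P (enum_val i)).
suff h (x : tensor V W) : exists c : 'I_n * 'I_m -> k, x = \sum_p c p *: P p.
  move=> x; have [c ->] := h x; exists (fun i => c (enum_val i)).
  by rewrite -(big_enum_val (fun p => c p *: P p)).
rewrite [x]tens_sumE; elim: (repr x) => [|p s [c ih]].
  exists (fun=> 0); rewrite big_nil big1 // => p _; exact: scale0r.
have [a ha] := he p.1; have [b hb] := hf p.2.
exists (fun q => a q.1 * b q.2 + c q); rewrite big_cons ih.
under [RHS]eq_bigr do rewrite scalerDl.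
rewrite big_split /=; congr (_ + _).
rewrite {1}ha (lin_sum (proj1 (tens_bilin V W) _)) {1}hb.
rewrite -(pair_bigA _ (fun i j => (a i * b j) *: (e i ⊗ f j))) /=.
apply: eq_bigr => i _; rewrite tensZl (lin_sum (proj2 (tens_bilin V W) _)).
by rewrite scaler_sumr; apply: eq_bigr => j _; rewrite /= tensZr scalerA.
Qed.

End FiniteDim.

Lemma mul_bilin (k : fieldType) (A : algType k) : bilin (fun x y : A => x * y).
Proof.
split=> z a x y /=; first by rewrite mulrDl scalerAl.
by rewrite mulrDr scalerAr.
Qed.

Section TensorAlgebra.
Variables (k : fieldType) (A B : algType k).

Let mull (y : A) : linear (fun x : A => x * y). Proof. exact: (proj1 (mul_bilin A)). Qed.
Let mulr' (y : A) : linear (fun x : A => y * x). Proof. exact: (proj2 (mul_bilin A)). Qed.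
Let mullB (y : B) : linear (fun x : B => x * y). Proof. exact: (proj1 (mul_bilin B)). Qed.
Let mulrB (y : B) : linear (fun x : B => y * x). Proof. exact: (proj2 (mul_bilin B)). Qed.

Definition tens_mul (x y : tensor A B) : tensor A B :=
  tlift (fun (a : A) (b : B) =>
    tlift (fun (a' : A) (b' : B) => (a * a') ⊗ (b * b')) y) x.

Let b1 (a : A) (b : B) : bilin (fun (a' : A) (b' : B) => (a * a') ⊗ (b * b')).
Proof. by split=> ?; [exact: tens_linl | exact: tens_linr]. Qed.

Let b2 y : bilin (fun (a : A) (b : B) => tlift (fun (a' : A) (b' : B) => (a * a') ⊗ (b * b')) y).
Proof. by split=> ?; apply: tlift_param => ? ?; [exact: tens_linl | exact: tens_linr]. Qed.

Lemma tens_mulE a b a' b' : tens_mul (a ⊗ b) (a' ⊗ b') = (a * a') ⊗ (b * b').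
Proof. by rewrite /tens_mul tliftE // tliftE. Qed.

Lemma tens_mul_linl y : linear (tens_mul^~ y).
Proof. exact: tlift_linear. Qed.

Lemma tens_mul_linr x : linear (tens_mul x).
Proof. by apply: tlift_param => a b; exact: tlift_linear. Qed.

Lemma tens_mulA : associative tens_mul.
Proof.
move=> x y z; move: x; apply: tens_ext => [||a b].
- exact: tens_mul_linl.
- exact: lin_comp (tens_mul_linl z) (tens_mul_linl y).
move: y; apply: tens_ext => [||a' b'].
- exact: lin_comp (tens_mul_linr _) (tens_mul_linl z).
- exact: lin_comp (tens_mul_linl z) (tens_mul_linr _).
move: z; apply: tens_ext => [||a'' b''].
- exact: lin_comp (tens_mul_linr _) (tens_mul_linr _).
- exact: (tens_mul_linr _).
by rewrite !tens_mulE !mulrA.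
Qed.

Lemma tens_mul1 : left_id (1 ⊗ 1) tens_mul.
Proof.
apply: tens_ext => [||a b]; [exact: tens_mul_linr|exact: lin_id|].
by rewrite tens_mulE !mul1r.
Qed.

Lemma tens_mulr1 : right_id (1 ⊗ 1) tens_mul.
Proof.
apply: tens_ext => [||a b]; [exact: tens_mul_linl|exact: lin_id|].
by rewrite tens_mulE !mulr1.
Qed.

End TensorAlgebra.

Section Bialgebras.
Variable k : fieldType.

Record bialgebra := Bialgebra {
  bialg_alg :> algType k;
  comul : {linear bialg_alg -> tensor bialg_alg bialg_alg};
  counit : {linear bialg_alg -> k^o};
  comul1 : comul 1 = 1 ⊗ 1;
  comulM : forall x y, comul (x * y) = tens_mul (comul x) (comul y);
  counit1 : counit 1 = 1;
  counitM : forall x y, counit (x * y) = counit x * counit y;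
  comulA : forall x, tassoc (tmap comul id (comul x)) = tmap id comul (comul x);
  counit_comul : forall x, tscal (tmap counit id (comul x)) = x;
  comul_counit : forall x, tscal' (tmap id counit (comul x)) = x
}.

Record hopfAlgebra := HopfAlgebra {
  hopf_bialg :> bialgebra;
  antipode : {linear hopf_bialg -> hopf_bialg};
  antipode_mul : forall x,
    tlift (fun y z => antipode y * z) (comul hopf_bialg x) =
      (counit hopf_bialg x : k) *: 1;
  mul_antipode : forall x,
    tlift (fun y z => y * antipode z) (comul hopf_bialg x) =
      (counit hopf_bialg x : k) *: 1
}.

Record comodAlgebra (B : bialgebra) := ComodAlgebra {
  comod_alg :> algType k;
  coact : {linear comod_alg -> tensor B comod_alg};
  coact1 : coact 1 = 1 ⊗ 1;
  coactM : forall x y, coact (x * y) = tens_mul (coact x) (coact y);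
  coactA : forall x, tassoc (tmap (comul B) id (coact x)) = tmap id coact (coact x);
  coact_counit : forall x, tscal (tmap (counit B) id (coact x)) = x
}.

Definition regular_comod (B : bialgebra) : comodAlgebra B :=
  ComodAlgebra (comul1 B) (@comulM B) (@comulA B) (@counit_comul B).

End Bialgebras.

Arguments comul {k B} : rename.
Arguments counit {k B} : rename.
Arguments antipode {k H} : rename.
Arguments coact {k B A} : rename.

Record linCat (k : fieldType) := LinCat {
  ob :> Type;
  hom : ob -> ob -> lmodType k;
  idm : forall X, hom X X;
  comp : forall X Y Z, hom Y Z -> hom X Y -> hom X Z;
  comp_bilin : forall X Y Z, bilin (@comp X Y Z);
  comp_idl : forall X Y (f : hom X Y), comp (idm Y) f = f;
  comp_idr : forall X Y (f : hom X Y), comp f (idm X) = f;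
  compA : forall X Y Z T (f : hom Z T) (g : hom Y Z) (h : hom X Y),
    comp f (comp g h) = comp (comp f g) h
}.

Arguments hom {k} C X Y : rename.
Arguments idm {k} C X : rename.
Arguments comp {k C X Y Z} f g : rename.

Notation "f \c g" := (comp f g) (at level 50, left associativity).

Section LinearCategories.
Variable k : fieldType.
Implicit Types C D E : linCat k.

Definition is_inverse C (X Y : C) (f : hom C X Y) (g : hom C Y X) : Prop :=
  g \c f = idm C X /\ f \c g = idm C Y.

Definition is_iso C (X Y : C) (f : hom C X Y) : Prop :=
  exists g : hom C Y X, is_inverse f g.

Definition is_epi C (X Y : C) (f : hom C X Y) : Prop :=
  forall Z (g h : hom C Y Z), g \c f = h \c f -> g = h.

Definition is_projective C (P : C) : Prop :=
  forall (X Y : C) (f : hom C X Y) (g : hom C P Y),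
    is_epi f -> exists h : hom C P X, f \c h = g.

(* [idm X = 0] says that [X] is a zero object. *)
Definition nonzero_cat C : Prop := exists X : C, idm C X <> 0.

Record linFunctor C D := LinFunctor {
  fob :> C -> D;
  fmap : forall X Y, hom C X Y -> hom D (fob X) (fob Y);
  fmap_linear : forall X Y, linear (@fmap X Y);
  fmap_id : forall X, fmap (idm C X) = idm D (fob X);
  fmap_comp : forall X Y Z (f : hom C Y Z) (g : hom C X Y),
    fmap (f \c g) = fmap f \c fmap g
}.

Definition id_functor C : linFunctor C C.
Proof. by exists (fun X => X) (fun X Y f => f). Defined.

Definition comp_functor C D E (G : linFunctor D E) (F : linFunctor C D) :
  linFunctor C E.
Proof.
exists (fun X => G (F X)) (fun X Y f => fmap G (fmap F f)).
- by move=> X Y; apply: lin_comp; apply: fmap_linear.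
- by move=> X; rewrite !fmap_id.
- by move=> X Y Z f g; rewrite !fmap_comp.
Defined.

Definition nat_isomorphic C D (F G : linFunctor C D) : Prop :=
  exists a : forall X, hom D (F X) (G X),
    (forall X, is_iso (a X)) /\
    (forall X Y (f : hom C X Y), a Y \c fmap F f = fmap G f \c a X).

Definition is_equivalence C D (F : linFunctor C D) : Prop :=
  exists G : linFunctor D C,
    nat_isomorphic (comp_functor G F) (id_functor C) /\
    nat_isomorphic (comp_functor F G) (id_functor D).

End LinearCategories.

Arguments fmap {k C D} F {X Y} f : rename.

Record monCat (k : fieldType) := MonCat {
  mon_cat :> linCat k;
  mob : mon_cat -> mon_cat -> mon_cat;
  mmap : forall X X' Y Y', hom mon_cat X X' -> hom mon_cat Y Y' ->
    hom mon_cat (mob X Y) (mob X' Y');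
  munit : mon_cat;
  massoc : forall X Y Z, hom mon_cat (mob (mob X Y) Z) (mob X (mob Y Z));
  mlunit : forall X, hom mon_cat (mob munit X) X;
  mrunit : forall X, hom mon_cat (mob X munit) X;
  mmap_bilin : forall X X' Y Y', bilin (@mmap X X' Y Y');
  mmap_id : forall X Y, mmap (idm _ X) (idm _ Y) = idm _ (mob X Y);
  mmap_comp : forall X X' X'' Y Y' Y''
    (f : hom mon_cat X' X'') (f' : hom mon_cat X X')
    (g : hom mon_cat Y' Y'') (g' : hom mon_cat Y Y'),
    mmap (f \c f') (g \c g') = mmap f g \c mmap f' g';
  massoc_iso : forall X Y Z, is_iso (massoc X Y Z);
  mlunit_iso : forall X, is_iso (mlunit X);
  mrunit_iso : forall X, is_iso (mrunit X);
  massoc_nat : forall X X' Y Y' Z Z'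
    (f : hom mon_cat X X') (g : hom mon_cat Y Y') (h : hom mon_cat Z Z'),
    massoc X' Y' Z' \c mmap (mmap f g) h = mmap f (mmap g h) \c massoc X Y Z;
  mlunit_nat : forall X X' (f : hom mon_cat X X'),
    mlunit X' \c mmap (idm _ munit) f = f \c mlunit X;
  mrunit_nat : forall X X' (f : hom mon_cat X X'),
    mrunit X' \c mmap f (idm _ munit) = f \c mrunit X;
  mpentagon : forall X Y Z T,
    massoc X Y (mob Z T) \c massoc (mob X Y) Z T =
      mmap (idm _ X) (massoc Y Z T) \c massoc X (mob Y Z) T
        \c mmap (massoc X Y Z) (idm _ T);
  mtriangle : forall X Y,
    mmap (idm _ X) (mlunit Y) \c massoc X munit Y = mmap (mrunit X) (idm _ Y)
}.

Arguments mob {k C} X Y : rename.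
Arguments mmap {k C X X' Y Y'} f g : rename.
Arguments munit {k} C : rename.
Arguments massoc {k C} X Y Z : rename.
Arguments mlunit {k C} X : rename.
Arguments mrunit {k C} X : rename.

(* Abelianness of the underlying category is not a field: it is part of
   [finite_cat] (equivalence with modules over a finite-dimensional algebra),
   and the summands of an abelian linear category are abelian. *)
Record modCat (k : fieldType) (C : monCat k) := ModCat {
  mod_cat :> linCat k;
  aob : C -> mod_cat -> mod_cat;
  amap : forall X X' M M', hom C X X' -> hom mod_cat M M' ->
    hom mod_cat (aob X M) (aob X' M');
  aassoc : forall X Y M, hom mod_cat (aob (mob X Y) M) (aob X (aob Y M));
  alunit : forall M, hom mod_cat (aob (munit C) M) M;
  amap_bilin : forall X X' M M', bilin (@amap X X' M M');
  amap_id : forall X M, amap (idm _ X) (idm _ M) = idm _ (aob X M);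
  amap_comp : forall X X' X'' M M' M''
    (f : hom C X' X'') (f' : hom C X X')
    (g : hom mod_cat M' M'') (g' : hom mod_cat M M'),
    amap (f \c f') (g \c g') = amap f g \c amap f' g';
  aassoc_iso : forall X Y M, is_iso (aassoc X Y M);
  alunit_iso : forall M, is_iso (alunit M);
  aassoc_nat : forall X X' Y Y' M M'
    (f : hom C X X') (g : hom C Y Y') (h : hom mod_cat M M'),
    aassoc X' Y' M' \c amap (mmap f g) h = amap f (amap g h) \c aassoc X Y M;
  alunit_nat : forall M M' (f : hom mod_cat M M'),
    alunit M' \c amap (idm _ (munit C)) f = f \c alunit M;
  apentagon : forall X Y Z M,
    aassoc X Y (aob Z M) \c aassoc (mob X Y) Z M =
      amap (idm _ X) (aassoc Y Z M) \c aassoc X (mob Y Z) M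
        \c amap (massoc X Y Z) (idm _ M);
  atriangle : forall X M,
    amap (idm _ X) (alunit M) \c aassoc X (munit C) M = amap (mrunit X) (idm _ M)
}.

Arguments aob {k C M} X N : rename.
Arguments amap {k C M X X' N N'} f g : rename.
Arguments aassoc {k C M} X Y N : rename.
Arguments alunit {k C M} N : rename.

Section ModuleCategories.
Variables (k : fieldType) (C : monCat k).

(* An equivalence of module categories: a module functor (F, s), with
   [s X N : F (X ⊗ N) -> X ⊗ F N], whose underlying functor is an equivalence. *)
Definition mod_equivalent (M N : modCat C) : Prop :=
  exists (F : linFunctor M N)
         (s : forall (X : C) (A : M), hom N (F (aob X A)) (aob X (F A))),
    [/\ is_equivalence F,
        forall X A, is_iso (s X A),
        forall X X' A A' (f : hom C X X') (g : hom M A A'),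
          s X' A' \c fmap F (amap f g) = amap f (fmap F g) \c s X A,
        forall X Y A,
          aassoc X Y (F A) \c s (mob X Y) A =
            amap (idm _ X) (s Y A) \c s X (aob Y A) \c fmap F (aassoc X Y A)
      & forall A, alunit (F A) \c s (munit C) A = fmap F (alunit A)].

Section DirectSum.
Variables M N : modCat C.

Definition sum_ob : Type := (M * N)%type.
Definition sum_hom (A B : sum_ob) : lmodType k := (hom M A.1 B.1 * hom N A.2 B.2)%type.

Definition sum_linCat : linCat k.
Proof.
refine (@LinCat k sum_ob sum_hom (fun A => (idm M A.1, idm N A.2))
  (fun A B D f g => (f.1 \c g.1, f.2 \c g.2)) _ _ _ _).
- move=> A B D; split=> f a g h; congr pair.
  + exact: (proj1 (comp_bilin (l := M) _ _ _)).
  + exact: (proj1 (comp_bilin (l := N) _ _ _)).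
  + exact: (proj2 (comp_bilin (l := M) _ _ _)).
  + exact: (proj2 (comp_bilin (l := N) _ _ _)).
- by move=> A B [f g]; rewrite /= !comp_idl.
- by move=> A B [f g]; rewrite /= !comp_idr.
- by move=> A B D E f g h; rewrite /= !compA.
Defined.

Lemma sum_iso (A B : sum_linCat) (f : hom sum_linCat A B) :
  is_iso f.1 -> is_iso f.2 -> is_iso f.
Proof.
by move=> [g [h1 h2]] [g' [h1' h2']]; exists (g, g'); split; congr pair.
Qed.

Definition sum_modCat : modCat C.
Proof.
refine (@ModCat k C sum_linCat (fun X A => (aob X A.1, aob X A.2))
  (fun X X' A A' f g => (amap f g.1, amap f g.2))
  (fun X Y A => (aassoc X Y A.1, aassoc X Y A.2))
  (fun A => (alunit A.1, alunit A.2)) _ _ _ _ _ _ _ _ _).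
- move=> X X' A A'; split=> f a g h; congr pair.
  + exact: (proj1 (amap_bilin (m := M) _ _ _ _)).
  + exact: (proj1 (amap_bilin (m := N) _ _ _ _)).
  + exact: (proj2 (amap_bilin (m := M) _ _ _ _)).
  + exact: (proj2 (amap_bilin (m := N) _ _ _ _)).
- by move=> X A; congr pair; apply: amap_id.
- by move=> *; congr pair; apply: amap_comp.
- by move=> X Y A; apply: sum_iso; apply: aassoc_iso.
- by move=> A; apply: sum_iso; apply: alunit_iso.
- by move=> *; congr pair; apply: aassoc_nat.
- by move=> *; congr pair; apply: alunit_nat.
- by move=> *; congr pair; apply: apentagon.
- by move=> *; congr pair; apply: atriangle.
Defined.

End DirectSum.

(* As is usual for this definition, [M] itself is not required to be nonzero. *)
Definition indecomposable (M : modCat C) : Prop :=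
  ~ exists N1 N2 : modCat C,
      [/\ nonzero_cat N1, nonzero_cat N2 & mod_equivalent M (sum_modCat N1 N2)].

Definition exact_modCat (M : modCat C) : Prop :=
  forall (P : C) (N : M), is_projective P -> is_projective (aob P N).

End ModuleCategories.

Section FDModules.
Variables (k : fieldType) (A : algType k).

Record fdmod := FDMod {
  fdmod_space :> lmodType k;
  act : A -> fdmod_space -> fdmod_space;
  act_bilin : bilin act;
  act1 : forall v, act 1 v = v;
  actM : forall a b v, act (a * b) v = act a (act b v);
  fdmod_finite : finite_dim fdmod_space
}.

Definition fdhom_pred (V W : fdmod) : {pred (V -> W)} :=
  fun f => `[< linear f /\ forall a v, f (act a v) = act a (f v) >].
Arguments fdhom_pred : clear implicits.

Record fdhom (V W : fdmod) := FDHom {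
  fdhom_fun :> V -> W;
  fdhomP : fdhom_fun \in fdhom_pred V W
}.

HB.instance Definition _ (V W : fdmod) := [isSub for @fdhom_fun V W].
HB.instance Definition _ (V W : fdmod) := [Choice of fdhom V W by <:].

Lemma fdhom_submod_closed V W : submod_closed (fdhom_pred V W).
Proof.
split=> [|c f g /asboolP [lf hf] /asboolP [lg hg]]; apply/asboolP.
  split=> [a u v | a v]; first by rewrite scaler0 addr0.
  by rewrite (lin0 (proj2 (act_bilin W) a)).
split=> [a u v | a v].
  by rewrite !fctE /= lf lg !scalerDr !scalerA addrACA [c * a]mulrC.
by rewrite !fctE /= hf hg (proj2 (act_bilin W) a).
Qed.

HB.instance Definition _ (V W : fdmod) :=
  GRing.isSubmodClosed.Build k (V -> W) (fdhom_pred V W)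
    (fdhom_submod_closed V W).
HB.instance Definition _ (V W : fdmod) :=
  [SubChoice_isSubLmodule of fdhom V W by <:].

Section FdhomTheory.
Variables V W : fdmod.

Lemma fdhom_ext (f g : fdhom V W) : f =1 g -> f = g.
Proof. by move=> h; apply: val_inj; apply/funext. Qed.

Lemma fdhom_linear (f : fdhom V W) : linear f.
Proof. by have /asboolP [] := fdhomP f. Qed.

Lemma fdhom_act (f : fdhom V W) a v : f (act a v) = act a (f v).
Proof. by have /asboolP [_ ->] := fdhomP f. Qed.

Lemma fdhom_lin2 a (f g : fdhom V W) v : (a *: f + g) v = a *: f v + g v.
Proof. by []. Qed.

Definition mk_fdhom (f : V -> W) (lf : linear f)
    (hf : forall a v, f (act a v) = act a (f v)) : fdhom V W :=
  FDHom (introT (asboolP _) (conj lf hf)).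

End FdhomTheory.

Definition fdhom_id V : fdhom V V :=
  mk_fdhom (@lin_id k V) (fun a v => erefl).

Lemma fdhom_comp_act U V W (f : fdhom V W) (g : fdhom U V) a u :
  f (g (act a u)) = act a (f (g u)).
Proof. by rewrite !fdhom_act. Qed.

Definition fdhom_comp U V W (f : fdhom V W) (g : fdhom U V) : fdhom U W :=
  mk_fdhom (lin_comp (fdhom_linear f) (fdhom_linear g)) (fdhom_comp_act f g).

Lemma fdhom_compE U V W (f : fdhom V W) (g : fdhom U V) u :
  fdhom_comp f g u = f (g u).
Proof. by []. Qed.

Definition fdmod_cat : linCat k.
Proof.
refine (@LinCat k fdmod (fun V W => fdhom V W) fdhom_id fdhom_comp _ _ _ _).
- move=> U V W; split=> f a g h; apply: fdhom_ext => u; first by [].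
  exact: (fdhom_linear f a (g u) (h u)).
- by move=> U V f; apply: fdhom_ext.
- by move=> U V f; apply: fdhom_ext.
- by move=> U V W T f g h; apply: fdhom_ext.
Defined.

Lemma fdmod_iso (V W : fdmod_cat) (f : hom fdmod_cat V W) (g : W -> V) :
  linear g -> cancel f g -> cancel g f -> is_iso f.
Proof.
move=> lg fK gK.
have hg a v : g (act a v) = act a (g v).
  by apply: (can_inj fK); rewrite fdhom_act !gK.
by exists (mk_fdhom lg hg); split; apply: fdhom_ext.
Qed.

End FDModules.

Arguments fdmod_cat {k} A.
Arguments act {k A V} a v : rename.

Section FiniteCategories.
Variable k : fieldType.

(* The library's [algType] excludes the zero algebra, hence [finite_cat] excludes
   the zero category. *)
Definition finite_cat (C : linCat k) : Prop :=
  exists A : algType k, finite_dim A /\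
    exists F : linFunctor C (fdmod_cat A), is_equivalence F.

Implicit Type C : monCat k.

Definition is_left_dual C (Y X : C) : Prop :=
  exists (ev : hom C (mob Y X) (munit C)) (coev : hom C (munit C) (mob X Y))
         (ai : hom C (mob Y (mob X Y)) (mob (mob Y X) Y)),
    [/\ is_inverse (massoc Y X Y) ai,
        mrunit X \c mmap (idm C X) ev \c massoc X Y X \c mmap coev (idm C X)
          = mlunit X
      & mlunit Y \c mmap ev (idm C Y) \c ai \c mmap (idm C Y) coev = mrunit Y].

Definition rigid C : Prop :=
  forall X : C,
    (exists Y : C, is_left_dual Y X) /\ (exists Y : C, is_left_dual X Y).

Definition simple_unit C : Prop :=
  idm C (munit C) <> 0 /\
  forall f : hom C (munit C) (munit C), exists a : k, f = a *: idm C (munit C).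

Definition finite_tensor_cat C : Prop :=
  [/\ finite_cat C, rigid C & simple_unit C].

End FiniteCategories.

Section TensorModules.
Variables (k : fieldType) (B : bialgebra k).

Section Act.
Variables (A : algType k) (V : fdmod B) (W : fdmod A).

Definition tact (x : tensor B A) (t : tensor V W) : tensor V W :=
  tlift (fun b a => tmap (act b) (act a) t) x.

Let actl (A' : algType k) (V' : fdmod A') (a : A') : linear (act a : V' -> V').
Proof. exact: (proj2 (act_bilin V')). Qed.

Let actr (A' : algType k) (V' : fdmod A') (v : V') : linear (fun a : A' => act a v).
Proof. exact: (proj1 (act_bilin V')). Qed.

Lemma tmap_act_bilin t :
  bilin (fun (b : B) (a : A) => tmap (act b : V -> V) (act a : W -> W) t).
Proof.
split=> ?; apply: tlift_param => v w.
- exact: tens_linl (actr v).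
- exact: tens_linr (actr w).
Qed.

Lemma tact_bilin : bilin tact.
Proof.
split=> [t | x]; first exact: tlift_linear (tmap_act_bilin t).
by apply: tlift_param => b a; exact: tmap_linear (actl b) (actl a).
Qed.

Lemma tactE b a (v : V) (w : W) : tact (b ⊗ a) (v ⊗ w) = act b v ⊗ act a w.
Proof. by rewrite /tact (tliftE _ _ (tmap_act_bilin _)) (tmapE (actl b) (actl a)). Qed.

Lemma tact1 t : tact (1 ⊗ 1) t = t.
Proof.
move: t; apply: tens_ext => [||v w]; last by rewrite tactE !act1.
- exact: (proj2 tact_bilin).
- exact: lin_id.
Qed.

Lemma tactM x y t : tact (tens_mul x y) t = tact x (tact y t).
Proof.
move: x; apply: tens_ext => [||b a].
- exact: lin_comp (proj1 tact_bilin t) (tens_mul_linl y).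
- exact: (proj1 tact_bilin).
move: y; apply: tens_ext => [||b' a'].
- exact: lin_comp (proj1 tact_bilin t) (tens_mul_linr _).
- exact: lin_comp (proj2 tact_bilin _) (proj1 tact_bilin t).
move: t; apply: tens_ext => [||v w].
- exact: (proj2 tact_bilin).
- exact: lin_comp (proj2 tact_bilin _) (proj2 tact_bilin _).
by rewrite tens_mulE !tactE !actM.
Qed.

End Act.

(* Only the coaction [A -> B ⊗ A] is used to let [A] act on [V ⊗ W]; the case
   [A = B] gives the tensor product of [B]-modules. *)
Definition tensmod (A : comodAlgebra B) (V : fdmod B) (W : fdmod A) : fdmod A.
Proof.
refine (@FDMod k A (tensor V W) (fun a t => tact (coact a) t) _ _ _ _).
- split=> [t | a]; first exact: lin_comp (proj1 (tact_bilin V W) t) (linearP _).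
  exact: (proj2 (tact_bilin V W)).
- by move=> t; rewrite coact1 tact1.
- by move=> a b t; rewrite coactM tactM.
- exact: finite_dim_tensor (fdmod_finite V) (fdmod_finite W).
Defined.

Lemma tensmod_actE (A : comodAlgebra B) (V : fdmod B) (W : fdmod A) a
  (t : tensor V W) : act a (t : tensmod V W) = tact (coact a) t.
Proof. by []. Qed.

Definition tensmod_map (A : comodAlgebra B) (V V' : fdmod B) (W W' : fdmod A)
  (f : fdhom V V') (g : fdhom W W') : fdhom (tensmod V W) (tensmod V' W').
Proof.
apply: (@mk_fdhom _ _ (tensmod V W) (tensmod V' W') (tmap f g)).
  exact: tmap_linear (fdhom_linear f) (fdhom_linear g).
have lt := tmap_linear (fdhom_linear f) (fdhom_linear g).
move=> a t; rewrite !tensmod_actE; move: (coact a) => x.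
move: x; apply: tens_ext => [||b c].
- exact: lin_comp lt (proj1 (tact_bilin _ _) _).
- exact: (proj1 (tact_bilin _ _) _).
move: t; apply: tens_ext => [||v w].
- exact: lin_comp lt (proj2 (tact_bilin _ _) _).
- exact: lin_comp (proj2 (tact_bilin _ _) _) lt.
by rewrite tactE !(tmapE (fdhom_linear f) (fdhom_linear g)) tactE !fdhom_act.
Defined.

Definition unitmod : fdmod B.
Proof.
refine (@FDMod k B k^o (fun b c => (counit b : k) *: c) _ _ _ _).
- split=> [c | b] a x y /=.
  + by rewrite linearP scalerDl scalerA.
  + by rewrite scalerDr !scalerA mulrC.
- by move=> v; rewrite counit1 scale1r.
- by move=> a b v; rewrite counitM scalerA.
- exact: finite_dim_regular.
Defined.

End TensorModules.

Section ModuleCategoryOfModules.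
Variables (k : fieldType) (B : bialgebra k).

Section Assoc.
Variables (A : comodAlgebra B) (U V : fdmod B) (W : fdmod A).

Notation UV := (tensmod (A := regular_comod B) U V : fdmod B).
Notation VW := (tensmod V W).

Let tact2 (y : tensor B (tensor B A)) (s : tensor U (tensor V W)) :
    tensor U (tensor V W) :=
  tlift (fun (b : B) (z : tensor B A) =>
    tmap (act b : U -> U) (tact z : tensor V W -> tensor V W) s) y.

Let act_lin (b : B) : linear (act b : U -> U).
Proof. exact: (proj2 (act_bilin U)). Qed.

Let tact_lin (z : tensor B A) : linear (tact z : tensor V W -> tensor V W).
Proof. exact: (proj2 (tact_bilin V W)). Qed.

Let tact2_bilin0 s : bilin (fun (b : B) (z : tensor B A) =>
    tmap (act b : U -> U) (tact z : tensor V W -> tensor V W) s).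
Proof.
split=> ?; apply: tlift_param => ? ?.
- by apply: tens_linl; exact: (proj1 (act_bilin U)).
- by apply: tens_linr; exact: (proj1 (tact_bilin V W)).
Qed.

Let tact2_bilin : bilin tact2.
Proof.
split=> [s|y]; first exact: tlift_linear (tact2_bilin0 s).
by apply: tlift_param => b z; exact: tmap_linear (act_lin b) (tact_lin z).
Qed.

Let tact2E b z u t : tact2 (b ⊗ z) (u ⊗ t) = act b u ⊗ tact z t.
Proof.
by rewrite /tact2 (tliftE _ _ (tact2_bilin0 _)) (tmapE (act_lin b) (tact_lin z)).
Qed.

Let tassoc_tact (x : tensor B A) (t : tensor UV W) :
  tassoc (tact x t) = tact2 (tassoc (tmap comul id x)) (tassoc t) :> tensor U VW.
Proof.
have lc : linear (tmap comul id : tensor B A -> tensor (tensor B B) A).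
  by apply: tmap_linear; [exact: linearP | exact: lin_id].
move: x; apply: tens_ext => [||b a].
- exact: lin_comp (@tassoc_linear _ _ _ _) (proj1 (tact_bilin UV W) t).
- apply: lin_comp (proj1 tact2_bilin _) _.
  exact: lin_comp (@tassoc_linear _ _ _ _) lc.
move: t; apply: tens_ext3 => [||u v w].
- exact: lin_comp (@tassoc_linear _ _ _ _) (proj2 (tact_bilin UV W) _).
- exact: lin_comp (proj2 tact2_bilin _) (@tassoc_linear _ _ _ _).
rewrite (tmapE (linearP _) (@lin_id _ _)) tactE tassocE.
rewrite (_ : act b (u ⊗ v : UV) = tact (comul b) (u ⊗ v)) //.
move: (comul b) => y; move: y.
apply: tens_ext => [||b1 b2].
- apply: lin_comp (@tassoc_linear _ _ _ _) _.
  by apply: tens_linl; exact: (proj1 (tact_bilin U V) _).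
- apply: lin_comp (proj1 tact2_bilin _) _.
  by apply: lin_comp (@tassoc_linear _ _ _ _) _; apply: tens_linl; exact: lin_id.
by rewrite tactE !tassocE tact2E tactE.
Qed.

Let tact_coact (x : tensor B A) (s : tensor U VW) :
  tact x s = tact2 (tmap id coact x) s :> tensor U VW.
Proof.
have lc : linear (tmap id coact : tensor B A -> tensor B (tensor B A)).
  by apply: tmap_linear; [exact: lin_id | exact: linearP].
move: x; apply: tens_ext => [||b a].
- exact: (proj1 (tact_bilin U VW) s).
- exact: lin_comp (proj1 tact2_bilin _) lc.
rewrite (tmapE (@lin_id _ _) (linearP _)).
move: s; apply: tens_ext => [||u t].
- exact: (proj2 (tact_bilin U VW) _).
- exact: (proj2 tact2_bilin _).
by rewrite tactE tact2E.
Qed.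

Definition tensmod_assoc : fdhom (tensmod UV W) (tensmod U VW).
Proof.
apply: (@mk_fdhom _ _ (tensmod UV W) (tensmod U VW) tassoc).
  exact: tassoc_linear.
by move=> a t; rewrite !tensmod_actE tassoc_tact tact_coact coactA.
Defined.

End Assoc.

Definition tensmod_lunit (A : comodAlgebra B) (W : fdmod A) :
  fdhom (tensmod (unitmod B) W) W.
Proof.
apply: (@mk_fdhom _ _ (tensmod (unitmod B) W) W tscal).
  exact: tscal_linear.
move=> a t; rewrite tensmod_actE -{2}[a]coact_counit.
move: (coact a) => x; move: x; apply: tens_ext => [||b c].
- exact: lin_comp (@tscal_linear _ _) (proj1 (tact_bilin (unitmod B) W) t).
- apply: lin_comp (proj1 (act_bilin W) _) _.
  apply: lin_comp (@tscal_linear _ _) _.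
  by apply: tmap_linear; [exact: linearP | exact: lin_id].
move: t; apply: tens_ext => [||e w].
- exact: lin_comp (@tscal_linear _ _) (proj2 (tact_bilin (unitmod B) W) _).
- exact: lin_comp (proj2 (act_bilin W) _) (@tscal_linear _ _).
rewrite tactE (tmapE (linearP _) (@lin_id _ _)) !tscalE.
by rewrite (linZ (proj1 (act_bilin W) _)) (linZ (proj2 (act_bilin W) _)) scalerA.
Defined.

Definition tensmod_runit (V : fdmod B) :
  fdhom (tensmod (A := regular_comod B) V (unitmod B) : fdmod B) V.
Proof.
apply: (@mk_fdhom _ _ (tensmod (A := regular_comod B) V (unitmod B)) V tscal').
  exact: tscal'_linear.
move=> a t; rewrite tensmod_actE -{2}[a]comul_counit.
rewrite (_ : @coact _ _ (regular_comod B) a = comul a) //.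
move: (comul a) => x; move: x; apply: tens_ext => [||b c].
- exact: lin_comp (@tscal'_linear _ _) (proj1 (tact_bilin V (unitmod B)) t).
- apply: lin_comp (proj1 (act_bilin V) _) _.
  apply: lin_comp (@tscal'_linear _ _) _.
  by apply: tmap_linear; [exact: lin_id | exact: linearP].
move: t; apply: tens_ext => [||v e].
- exact: lin_comp (@tscal'_linear _ _) (proj2 (tact_bilin V (unitmod B)) _).
- exact: lin_comp (proj2 (act_bilin V) _) (@tscal'_linear _ _).
rewrite tactE (tmapE (@lin_id _ _) (linearP _)) !tscal'E.
by rewrite (linZ (proj1 (act_bilin V) _)) (linZ (proj2 (act_bilin V) _)) scalerA.
Defined.

Notation tmod V W := (tensmod (A := regular_comod B) V W : fdmod B).

Definition tmap_B (V V' W W' : fdmod B) (f : fdhom V V') (g : fdhom W W') :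
  fdhom (tmod V W) (tmod V' W') := tensmod_map (A := regular_comod B) f g.

Definition assoc_B (X Y Z : fdmod B) :
  fdhom (tmod (tmod X Y) Z) (tmod X (tmod Y Z)) :=
  tensmod_assoc (A := regular_comod B) X Y Z.

Lemma tmap_BE (V V' W W' : fdmod B) (f : fdhom V V') (g : fdhom W W') v w :
  tmap_B f g (v ⊗ w) = f v ⊗ g w.
Proof. exact: tmapE (fdhom_linear f) (fdhom_linear g) v w. Qed.

Lemma assoc_BE (X Y Z : fdmod B) (x : X) (y : Y) (z : Z) :
  assoc_B X Y Z (x ⊗ y ⊗ z) = x ⊗ (y ⊗ z).
Proof. exact: tassocE. Qed.

Lemma tensmod_runitE (V : fdmod B) (v : V) (c : k^o) :
  tensmod_runit V (v ⊗ c) = (c : k) *: v.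
Proof. exact: tscal'E. Qed.

Lemma tensmod_runit_nat (V V' : fdmod B) (f : fdhom V V') :
  fdhom_comp (tensmod_runit V') (tmap_B f (fdhom_id (unitmod B)))
  = fdhom_comp f (tensmod_runit V).
Proof.
apply: fdhom_ext; set F := fdhom_comp _ _; set G := fdhom_comp _ _.
apply: (tens_ext (fdhom_linear F) (fdhom_linear G)) => v c; rewrite {}/F {}/G.
rewrite !fdhom_compE tmap_BE !tensmod_runitE.
by rewrite (linZ (fdhom_linear f)).
Qed.

Section Coherence.
Variable A : comodAlgebra B.

Implicit Types (U V X Y Z : fdmod B) (W M N : fdmod A).

Lemma tensmod_mapE V V' W W' (f : fdhom V V') (g : fdhom W W') v w :
  tensmod_map f g (v ⊗ w) = f v ⊗ g w.
Proof. exact: tmapE (fdhom_linear f) (fdhom_linear g) v w. Qed.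

Lemma tensmod_ext V W N (f g : fdhom (tensmod V W) N) :
  (forall v w, f (v ⊗ w) = g (v ⊗ w)) -> f = g.
Proof.
by move=> h; apply: fdhom_ext; exact: (tens_ext (fdhom_linear f) (fdhom_linear g) h).
Qed.

Lemma tensmod_ext3 U V W N (f g : fdhom (tensmod (tmod U V) W) N) :
  (forall u v w, f (u ⊗ v ⊗ w) = g (u ⊗ v ⊗ w)) -> f = g.
Proof.
by move=> h; apply: fdhom_ext; exact: (tens_ext3 (fdhom_linear f) (fdhom_linear g) h).
Qed.

Lemma tensmod_ext4 U V X W N
    (f g : fdhom (tensmod (tmod (tmod U V) X) W) N) :
  (forall u v x w, f (u ⊗ v ⊗ x ⊗ w) = g (u ⊗ v ⊗ x ⊗ w)) -> f = g.
Proof.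
move=> h; apply: tensmod_ext => t w; move: t.
have l : linear (fun t : tensor (tensor U V) X => t ⊗ w).
  by apply: tens_linl; exact: lin_id.
apply: tens_ext3 => [||u v x]; last exact: h.
- exact: lin_comp (fdhom_linear f) l.
- exact: lin_comp (fdhom_linear g) l.
Qed.

Lemma tensmod_assocE U V W (u : U) (v : V) (w : W) :
  tensmod_assoc U V W (u ⊗ v ⊗ w) = u ⊗ (v ⊗ w).
Proof. exact: tassocE. Qed.

Lemma tensmod_lunitE W (c : k^o) (w : W) :
  tensmod_lunit W (c ⊗ w) = (c : k) *: w.
Proof. exact: tscalE. Qed.

Lemma tensmod_map_bilin V V' W W' : bilin (@tensmod_map k B A V V' W W').
Proof.
split=> h a f g; apply: tensmod_ext => v w.
- rewrite (fdhom_lin2 a (tensmod_map f h) (tensmod_map g h)) !tensmod_mapE.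
  by rewrite (fdhom_lin2 a f g) tensDl tensZl.
- rewrite (fdhom_lin2 a (tensmod_map h f) (tensmod_map h g)) !tensmod_mapE.
  by rewrite (fdhom_lin2 a f g) tensDr tensZr.
Qed.

Lemma tensmod_map_id V W :
  tensmod_map (fdhom_id V) (fdhom_id W) = fdhom_id (tensmod V W).
Proof. by apply: tensmod_ext => v w; rewrite tensmod_mapE. Qed.

Lemma tensmod_map_comp V V' V'' W W' W''
    (f : fdhom V' V'') (f' : fdhom V V') (g : fdhom W' W'') (g' : fdhom W W') :
  tensmod_map (fdhom_comp f f') (fdhom_comp g g') =
    fdhom_comp (tensmod_map f g) (tensmod_map f' g').
Proof. by apply: tensmod_ext => v w; rewrite fdhom_compE !tensmod_mapE. Qed.

Lemma tensmod_assoc_iso U V W :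
  is_iso (tensmod_assoc U V W : hom (fdmod_cat A) _ _).
Proof.
apply: (@fdmod_iso _ _ (tensmod (tmod U V) W) (tensmod U (tensmod V W)) _ tassoc_inv).
- exact: tassoc_inv_linear.
- exact: tassocK.
- exact: tassoc_invK.
Qed.

Lemma tensmod_lunit_iso W : is_iso (tensmod_lunit W : hom (fdmod_cat A) _ _).
Proof.
apply: (@fdmod_iso _ _ (tensmod (unitmod B) W) W _ (fun w => (1 : k^o) ⊗ w)).
- by apply: tens_linr; exact: lin_id.
- exact: tscalK.
- by move=> w; rewrite /= tscalE scale1r.
Qed.

Lemma tensmod_runit_iso V :
  is_iso (tensmod_runit V : hom (fdmod_cat B) _ _).
Proof.
apply: (@fdmod_iso _ _ (tmod V (unitmod B)) V _ (fun v => v ⊗ (1 : k^o))).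
- by apply: tens_linl; exact: lin_id.
- exact: tscal'K.
- by move=> w; rewrite /= tscal'E scale1r.
Qed.

Lemma tensmod_assoc_nat U U' V V' W W'
    (f : fdhom U U') (g : fdhom V V') (h : fdhom W W') :
  fdhom_comp (tensmod_assoc U' V' W') (tensmod_map (tmap_B f g) h)
  = fdhom_comp (tensmod_map f (tensmod_map g h)) (tensmod_assoc U V W).
Proof.
apply: tensmod_ext3 => u v w; rewrite !fdhom_compE tensmod_assocE.
by rewrite !tensmod_mapE tmap_BE tensmod_assocE.
Qed.

Lemma tensmod_lunit_nat W W' (f : fdhom W W') :
  fdhom_comp (tensmod_lunit W') (tensmod_map (fdhom_id (unitmod B)) f)
  = fdhom_comp f (tensmod_lunit W).
Proof.
apply: tensmod_ext => c w; rewrite !fdhom_compE tensmod_mapE !tensmod_lunitE.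
by rewrite (linZ (fdhom_linear f)).
Qed.

Lemma tensmod_pentagon X Y Z W :
  fdhom_comp (tensmod_assoc X Y (tensmod Z W)) (tensmod_assoc (tmod X Y) Z W)
  = fdhom_comp
      (fdhom_comp (tensmod_map (fdhom_id X) (tensmod_assoc Y Z W))
                  (tensmod_assoc X (tmod Y Z) W))
      (tensmod_map (assoc_B X Y Z) (fdhom_id W)).
Proof.
apply: tensmod_ext4 => x y z w; rewrite !fdhom_compE !tensmod_assocE.
by rewrite tensmod_mapE assoc_BE !tensmod_assocE tensmod_mapE tensmod_assocE.
Qed.

Lemma tensmod_triangle X W :
  fdhom_comp (tensmod_map (fdhom_id X) (tensmod_lunit W))
    (tensmod_assoc X (unitmod B) W)
  = tensmod_map (tensmod_runit X) (fdhom_id W).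
Proof.
apply: tensmod_ext3 => x c w; rewrite !fdhom_compE !tensmod_assocE.
by rewrite !tensmod_mapE tensmod_lunitE tensmod_runitE tensZr tensZl.
Qed.

End Coherence.

End ModuleCategoryOfModules.

Section Categories.
Variables (k : fieldType) (B : bialgebra k).

Notation tmod V W := (tensmod (A := regular_comod B) V W : fdmod B).

Definition fdmod_monCat : monCat k :=
  @MonCat k (fdmod_cat B) (fun V W : fdmod B => tmod V W)
    (@tmap_B k B) (unitmod B) (@assoc_B k B)
    (fun V => tensmod_lunit (A := regular_comod B) V) (@tensmod_runit k B)
    (@tensmod_map_bilin k B (regular_comod B))
    (@tensmod_map_id k B (regular_comod B))
    (@tensmod_map_comp k B (regular_comod B))
    (@tensmod_assoc_iso k B (regular_comod B))
    (@tensmod_lunit_iso k B (regular_comod B))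
    (@tensmod_runit_iso k B)
    (@tensmod_assoc_nat k B (regular_comod B))
    (@tensmod_lunit_nat k B (regular_comod B))
    (@tensmod_runit_nat k B)
    (@tensmod_pentagon k B (regular_comod B))
    (@tensmod_triangle k B (regular_comod B)).

Definition fdmod_modCat (A : comodAlgebra B) : modCat fdmod_monCat :=
  @ModCat k fdmod_monCat (fdmod_cat A) (@tensmod k B A)
    (@tensmod_map k B A) (@tensmod_assoc k B A) (@tensmod_lunit k B A)
    (@tensmod_map_bilin k B A) (@tensmod_map_id k B A)
    (@tensmod_map_comp k B A) (@tensmod_assoc_iso k B A)
    (@tensmod_lunit_iso k B A) (@tensmod_assoc_nat k B A)
    (@tensmod_lunit_nat k B A) (@tensmod_pentagon k B A)
    (@tensmod_triangle k B A).

End Categories.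

Section QuotientAlgebra.
Variables (k : fieldType) (A : algType k).

Record ideal2 := Ideal2 {
  ideal2_set :> A -> Prop;
  ideal2_0 : ideal2_set 0;
  ideal2D : forall x y, ideal2_set x -> ideal2_set y -> ideal2_set (x + y);
  ideal2Ml : forall a x, ideal2_set x -> ideal2_set (a * x);
  ideal2Mr : forall a x, ideal2_set x -> ideal2_set (x * a);
  ideal2_proper : ~ ideal2_set 1
}.

Variable I : ideal2.

Definition ideal2_pred : {pred A} := fun x => `[< I x >].

Lemma ideal2N x : I x -> I (- x).
Proof. by move=> h; rewrite -mulN1r; exact: ideal2Ml. Qed.

Lemma ideal2_zmod_closed : zmod_closed ideal2_pred.
Proof.
split=> [|x y /asboolP hx /asboolP hy]; apply/asboolP; first exact: ideal2_0.
by apply: ideal2D => //; exact: ideal2N.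
Qed.

HB.instance Definition _ := GRing.isZmodClosed.Build A ideal2_pred ideal2_zmod_closed.

Definition qalg : Type := Quotient.quot ideal2_pred.

HB.instance Definition _ := GRing.Zmodule.on qalg.

Definition qpi (x : A) : qalg := \pi_(Quotient.quot ideal2_pred) x.
Definition qrepr (x : qalg) : A := repr (x : Quotient.quot ideal2_pred).

Lemma qreprK : cancel qrepr qpi.
Proof. by move=> x; exact: reprK. Qed.

Lemma qpi_eq x y : qpi x = qpi y <-> I (x - y).
Proof.
split=> [h | h].
  by apply/asboolP; have /eqP := h; rewrite -Quotient.idealrBE.
by apply/eqP; rewrite -Quotient.idealrBE; apply/asboolP.
Qed.

Lemma qpi_repr x : I (qrepr (qpi x) - x).
Proof. by apply/qpi_eq; exact: qreprK. Qed.

Lemma qpiB : {morph qpi : x y / x - y}.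
Proof.
by move=> x y; rewrite /qpi (raddfB (\pi_(Quotient.quot ideal2_pred))).
Qed.

Definition qmul (x y : qalg) : qalg := qpi (qrepr x * qrepr y).
Definition qscale (a : k) (x : qalg) : qalg := qpi (a *: qrepr x).

Lemma qpiM x y : qpi (x * y) = qmul (qpi x) (qpi y).
Proof.
apply/esym/qpi_eq.
rewrite -[_ - _](subrKA (qrepr (qpi x) * y)) -mulrBr -mulrBl.
by apply: ideal2D; [apply: ideal2Ml | apply: ideal2Mr]; exact: qpi_repr.
Qed.

Lemma qpiZ a x : qpi (a *: x) = qscale a (qpi x).
Proof.
apply/esym/qpi_eq; rewrite -scalerBr -[X in _ *: X]mul1r scalerAl.
by apply: ideal2Ml; exact: qpi_repr.
Qed.

Lemma qpiD : {morph qpi : x y / x + y}.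
Proof.
by move=> x y; rewrite /qpi (raddfD (\pi_(Quotient.quot ideal2_pred))).
Qed.

Lemma qmulA : associative qmul.
Proof.
move=> x y z; rewrite -[x]qreprK -[y]qreprK -[z]qreprK -!qpiM.
by rewrite mulrA.
Qed.

Lemma qmul1 : left_id (qpi 1) qmul.
Proof. by move=> x; rewrite -[x]qreprK -qpiM mul1r. Qed.

Lemma qmulr1 : right_id (qpi 1) qmul.
Proof. by move=> x; rewrite -[x]qreprK -qpiM mulr1. Qed.

Lemma qmulDl : left_distributive qmul +%R.
Proof.
move=> x y z; rewrite -[x]qreprK -[y]qreprK -[z]qreprK.
by rewrite -qpiD -!qpiM mulrDl qpiD.
Qed.

Lemma qmulDr : right_distributive qmul +%R.
Proof.
move=> x y z; rewrite -[x]qreprK -[y]qreprK -[z]qreprK.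
by rewrite -qpiD -!qpiM mulrDr qpiD.
Qed.

Lemma q1_neq0 : qpi 1 != 0.
Proof.
apply/eqP; rewrite -(subrr (qpi 1)) -qpiB => /qpi_eq.
by rewrite subrr subr0; exact: ideal2_proper.
Qed.

HB.instance Definition _ := GRing.Zmodule_isNzRing.Build qalg
  qmulA qmul1 qmulr1 qmulDl qmulDr q1_neq0.

Lemma qscaleA a b x : qscale a (qscale b x) = qscale (a * b) x.
Proof. by rewrite -[x]qreprK -!qpiZ scalerA. Qed.

Lemma qscale1 : left_id 1 qscale.
Proof. by move=> x; rewrite -[x]qreprK -qpiZ scale1r. Qed.

Lemma qscaleDr : right_distributive qscale +%R.
Proof.
move=> a x y; rewrite -[x]qreprK -[y]qreprK.
by rewrite -qpiD -!qpiZ scalerDr qpiD.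
Qed.

Lemma qscaleDl x : {morph qscale^~ x : a b / a + b}.
Proof. by move=> a b; rewrite -[x]qreprK -!qpiZ scalerDl qpiD. Qed.

HB.instance Definition _ := GRing.Zmodule_isLmodule.Build k qalg
  qscaleA qscale1 qscaleDr qscaleDl.

Let qME x y : qpi x * qpi y = qpi (x * y).
Proof. by rewrite qpiM. Qed.

Let qZE a x : a *: qpi x = qpi (a *: x).
Proof. by rewrite qpiZ. Qed.

Lemma qscaleAl a (x y : qalg) : a *: (x * y) = (a *: x) * y.
Proof.
rewrite -[x]qreprK -[y]qreprK qZE !qME !qZE.
by rewrite scalerAl.
Qed.

HB.instance Definition _ := GRing.Lmodule_isLalgebra.Build k qalg qscaleAl.

Lemma qscaleAr a (x y : qalg) : a *: (x * y) = x * (a *: y).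
Proof.
rewrite -[x]qreprK -[y]qreprK qZE !qME !qZE.
by rewrite scalerAr.
Qed.

HB.instance Definition _ := GRing.Lalgebra_isAlgebra.Build k qalg qscaleAr.

Lemma qpi_linear : linear qpi.
Proof. by move=> a x y; rewrite qpiD qpiZ. Qed.

HB.instance Definition _ := GRing.isLinear.Build k A qalg *:%R qpi qpi_linear.

Lemma qpi_monoid_morphism : monoid_morphism qpi.
Proof. by split=> // x y; rewrite qpiM. Qed.

HB.instance Definition _ :=
  GRing.isMonoidMorphism.Build A qalg qpi qpi_monoid_morphism.

End QuotientAlgebra.

Arguments qpi {k A} I x.

Section CentralHopf.
Variables (k : fieldType) (H : hopfAlgebra k).

Definition is_subalgebra (S : set H) : Prop :=
  [/\ S 1, forall x y, S x -> S y -> S (x + y),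
      forall (a : k) x, S x -> S (a *: x)
    & forall x y, S x -> S y -> S (x * y)].

Definition affine : Prop :=
  exists s : seq H, forall S : set H,
    is_subalgebra S -> (forall x, x \in s -> S x) -> forall x, S x.

Record centralHopfSub := CentralHopfSub {
  csub :> H -> Prop;
  csub_subalgebra : is_subalgebra csub;
  (* [comul] maps [csub] to the image of [csub ⊗ csub] in [H ⊗ H] *)
  csub_comul : forall c, csub c -> exists s : seq (H * H),
    (forall p, p \in s -> csub p.1 /\ csub p.2) /\
    comul c = \sum_(p <- s) p.1 ⊗ p.2;
  csub_antipode : forall c, csub c -> csub (antipode c);
  csub_central : forall c x, csub c -> c * x = x * c
}.

Variable C : centralHopfSub.

Definition fin_gen_module : Prop :=
  exists (n : nat) (h : 'I_n -> H), forall x, exists c : 'I_n -> H,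
    (forall i, C (c i)) /\ x = \sum_(i < n) c i * h i.

Definition is_ideal (J : set H) : Prop :=
  [/\ (J `<=` C)%classic, J 0, forall x y, J x -> J y -> J (x + y)
    & forall c x, C c -> J x -> J (c * x)].

Definition is_maximal_ideal (m : set H) : Prop :=
  [/\ is_ideal m, m <> (C : set H)
    & forall J, is_ideal J -> (m `<=` J)%classic -> J <> (C : set H) -> J = m].

Record maxSpec := MaxSpec {
  max_set :> H -> Prop;
  max_ideal : is_maximal_ideal max_set
}.

Lemma csub1 : C 1. Proof. by case: (csub_subalgebra C). Qed.
Lemma csubD x y : C x -> C y -> C (x + y).
Proof. by case: (csub_subalgebra C) => _ h _ _; exact: h. Qed.
Lemma csubZ (a : k) x : C x -> C (a *: x).
Proof. by case: (csub_subalgebra C) => _ _ h _; exact: h. Qed.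
Lemma csubM x y : C x -> C y -> C (x * y).
Proof. by case: (csub_subalgebra C) => _ _ _ h; exact: h. Qed.
Lemma csubN x : C x -> C (- x).
Proof. by rewrite -scaleN1r; exact: csubZ. Qed.
Lemma csub0 : C 0. Proof. by rewrite -(scale0r (1 : H)); exact: csubZ csub1. Qed.

Section MaxIdeal.
Variable m : maxSpec.

Lemma max_sub x : m x -> C x.
Proof. by case: (max_ideal m) => [[h _ _ _] _ _]; exact: h. Qed.
Lemma max0 : m 0. Proof. by case: (max_ideal m) => [[]]. Qed.
Lemma maxD x y : m x -> m y -> m (x + y).
Proof. by case: (max_ideal m) => [[_ _ h _] _ _]; exact: h. Qed.
Lemma maxMl c x : C c -> m x -> m (c * x).
Proof. by case: (max_ideal m) => [[_ _ _ h] _ _]; exact: h. Qed.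
Lemma maxMr c x : C c -> m x -> m (x * c).
Proof. by move=> hc hx; rewrite -(csub_central x hc); exact: maxMl. Qed.
Lemma maxN x : m x -> m (- x).
Proof. by move=> h; rewrite -mulN1r; apply: maxMl h; exact: csubN csub1. Qed.
Lemma max_proper : ~ m 1.
Proof.
case: (max_ideal m) => [_ h _] m1; apply: h; apply/seteqP; split=> c.
  exact: max_sub.
by move=> hc; rewrite -[c]mulr1; exact: maxMl.
Qed.

(* [max_ext] is the set [mH] of finite sums of products [c * x], [c] in [m]. *)
Definition max_ext (x : H) : Prop :=
  exists s : seq (H * H), (forall p, p \in s -> m p.1) /\
    x = \sum_(p <- s) p.1 * p.2.

Lemma max_ext0 : max_ext 0.
Proof. by exists [::]; split=> //; rewrite big_nil. Qed.

Lemma max_extD x y : max_ext x -> max_ext y -> max_ext (x + y).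
Proof.
move=> [s [hs ->]] [t [ht ->]]; exists (s ++ t); rewrite big_cat; split=> // p.
by rewrite mem_cat => /orP[]; [exact: hs | exact: ht].
Qed.

Lemma max_ext_gen c x : m c -> max_ext (c * x).
Proof.
move=> mc; exists [:: (c, x)]; rewrite big_seq1; split=> // p.
by rewrite inE => /eqP ->.
Qed.

Lemma max_ext_ind (P : H -> Prop) : P 0 ->
  (forall x y, P x -> P y -> P (x + y)) ->
  (forall c x, m c -> P (c * x)) -> forall x, max_ext x -> P x.
Proof.
move=> P0 PD Pg x [s [hs ->]]; elim: s hs => [|p s ih] hs; first by rewrite big_nil.
rewrite big_cons; apply: PD; first by apply: Pg; apply: hs; rewrite mem_head.
by apply: ih => q qs; apply: hs; rewrite inE qs orbT.
Qed.

Lemma max_extMl a x : max_ext x -> max_ext (a * x).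
Proof.
apply: (max_ext_ind (P := fun x => max_ext (a * x))) => [|y z|c y mc].
- by rewrite mulr0; exact: max_ext0.
- by rewrite mulrDr; exact: max_extD.
- by rewrite mulrA -(csub_central a (max_sub mc)) -mulrA; exact: max_ext_gen.
Qed.

Lemma max_extMr a x : max_ext x -> max_ext (x * a).
Proof.
apply: (max_ext_ind (P := fun x => max_ext (x * a))) => [|y z|c y mc].
- by rewrite mul0r; exact: max_ext0.
- by rewrite mulrDl; exact: max_extD.
- by rewrite -mulrA; exact: max_ext_gen.
Qed.

(* Nakayama's lemma: the finitely generated faithful [C]-module [H] satisfies
   [mH <> H]. *)
Lemma max_ext_proper : fin_gen_module -> ~ max_ext 1.
Proof.
move=> [n [h hh]] h1.
pose G x := exists a : 'I_n -> H,
  (forall i, m (a i)) /\ x = \sum_(i < n) a i * h i.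
have gen : forall x, max_ext x -> G x.
  apply: max_ext_ind => [|y z [a [ma ->]] [b [mb ->]]|c y mc].
  - exists (fun=> 0); split=> [i|]; first exact: max0.
    by rewrite big1 // => i _; rewrite mul0r.
  - exists (fun i => a i + b i); split=> [i|]; first exact: maxD.
    by rewrite -big_split; apply: eq_bigr => i _; rewrite mulrDl.
  - have [d [Cd ->]] := hh y; exists (fun i => c * d i).
    split=> [i|]; first exact: maxMr.
    by rewrite mulr_sumr; apply: eq_bigr => i _; rewrite mulrA.
pose N j x := exists a : 'I_n -> H, [/\ forall i, m (a i),
  forall i : 'I_n, (n <= i + j)%N -> a i = 0 & x = \sum_(i < n) a i * h i].
suff /(_ n (leqnn n)) [s [Cs ms hs]] : forall j, (j <= n)%N ->
    exists s, [/\ C s, m (1 - s) & forall l, N j (s * h l)].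
  have s0 : s = 0.
    rewrite -[s]mulr1; have [c [Cc ->]] := hh 1; rewrite mulr_sumr big1 // => i _.
    rewrite mulrA (csub_central (c i) Cs) -mulrA.
    have [a [_ a0 ->]] := hs i; rewrite big1 ?mulr0 // => l _.
    by rewrite a0 ?mul0r // leq_addl.
  by apply: max_proper; move: ms; rewrite s0 subr0.
elim=> [|j ih] hj.
  exists 1; split; first exact: csub1.
    by rewrite subrr; exact: max0.
  move=> l; rewrite mul1r -[h l]mul1r.
  have [a [ma ea]] := gen _ (max_extMr (h l) h1); exists a; split=> // i.
  by rewrite addn0 leqNgt ltn_ord.
have [s [Cs ms hs]] := ih (ltnW hj).
have hi0 : (n - j.+1 < n)%N by rewrite ltn_subrL (leq_ltn_trans _ hj).
pose i0 := Ordinal hi0.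
have i0E : (i0 + j).+1 = n by rewrite /= -addnS subnK.
have [b [mb b0 eb]] := hs i0.
exists ((s - b i0) * s); split.
- by apply: csubM => //; apply: csubD => //; apply: csubN; exact: max_sub.
- rewrite (_ : 1 - _ = (1 - s) * (1 + s) + b i0 * s); last first.
    rewrite [(s - _) * s]mulrBl opprB mulrBl mul1r mulrDr mulr1.
    by rewrite opprD !addrA addrK addrAC.
  apply: maxD; apply: maxMr => //; exact: csubD csub1 Cs.
move=> l; have [a [ma a0 ea]] := hs l.
exists (fun i => if i == i0 then 0 else (s - b i0) * a i + a i0 * b i); split.
- move=> i; case: eqP => _; first exact: max0.
  apply: maxD; apply: maxMl => //; last exact: max_sub.
  by apply: csubD => //; apply: csubN; exact: max_sub.
- move=> i hi; case: eqP => // /eqP ni.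
  have {}hi : (n <= i + j)%N.
    move: hi; rewrite addnS leq_eqVlt ltnS => /orP[e|//].
    case/eqP: ni; apply: val_inj; apply: (@addIn j); apply: succn_inj.
    exact: etrans (esym (eqP e)) (esym i0E).
  by rewrite (a0 i hi) (b0 i hi) !mulr0 addr0.
have e0 : (s - b i0) * h i0 = \sum_(i < n | i != i0) b i * h i.
  by rewrite mulrBl eb [in LHS](bigD1 i0) //= addrAC subrr add0r.
rewrite -mulrA ea mulr_sumr (bigD1 i0) //= [RHS](bigD1 i0) //= eqxx mul0r add0r.
have comm : (s - b i0) * a i0 = a i0 * (s - b i0).
  by rewrite -(csub_central _ (max_sub (ma i0))).
rewrite mulrA comm -mulrA e0 mulr_sumr -big_split /=; apply: eq_bigr => i ni.
by rewrite (negbTE ni) [RHS]mulrDl !mulrA addrC.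
Qed.

End MaxIdeal.

Definition aug_set (c : H) : Prop := C c /\ counit c = 0.

Lemma aug_maximal : is_maximal_ideal aug_set.
Proof.
split.
- split.
  + by move=> c [].
  + by split; [exact: csub0 | exact: linear0].
  + by move=> x y [Cx ex] [Cy ey]; split; [exact: csubD|rewrite linearD ex ey addr0].
  + by move=> c x Cc [Cx ex]; split; [exact: csubM|rewrite counitM ex mulr0].
- move=> e; have [_ /eqP] : aug_set 1 by rewrite e; exact: csub1.
  by rewrite counit1 oner_eq0.
move=> J [JC J0 JD JM] sJ nJ; apply/seteqP; split=> [x Jx|]; last exact: sJ.
split; first exact: JC.
apply: contrapT => /eqP ex; apply: nJ; apply/seteqP; split=> // c Cc.
pose e : k := counit x.
have Je : J (e *: 1).
  rewrite -[e *: 1](subKr x); apply: JD => //.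
  rewrite -[- _]mulN1r; apply: JM; first by apply: csubN; exact: csub1.
  apply: sJ; split.
    by apply: csubD; [exact: JC | apply: csubN; apply: csubZ; exact: csub1].
  by rewrite linearB linearZ /= counit1 [_ *: _]mulr1 subrr.
have -> : c = (e^-1 *: c) * (e *: 1).
  by rewrite -scalerAl -scalerAr mulr1 scalerA mulVf // scale1r.
by apply: JM Je; exact: csubZ.
Qed.

Definition aug : maxSpec := MaxSpec aug_maximal.

End CentralHopf.

Section QuotientStructures.
Variables (k : fieldType) (H : hopfAlgebra k) (C : centralHopfSub H).
Hypothesis Cfg : fin_gen_module C.
Implicit Type m : maxSpec C.

Definition mH (m : maxSpec C) : ideal2 H :=
  Ideal2 (max_ext0 m) (@max_extD _ _ _ m) (@max_extMl _ _ _ m)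
    (@max_extMr _ _ _ m) (@max_ext_proper _ _ _ m Cfg).

Definition hquot (m : maxSpec C) : algType k := qalg (mH m).

Notation pi m := (qpi (mH m) : H -> hquot m).
Notation eps := (aug C).

Let pi_lin m : linear (pi m). Proof. exact: qpi_linear. Qed.

Let pi2 (m : maxSpec C) : tensor H H -> tensor (hquot eps) (hquot m) :=
  tmap (pi eps) (pi m).

Let pi2_lin m : linear (pi2 m).
Proof. exact: tmap_linear (pi_lin eps) (pi_lin m). Qed.

Let pi2E m x y : pi2 m (x ⊗ y) = pi eps x ⊗ pi m y.
Proof. exact: tmapE (pi_lin eps) (pi_lin m) x y. Qed.

Let pi2M m x y : pi2 m (tens_mul x y) = tens_mul (pi2 m x) (pi2 m y).
Proof.
move: x; apply: tens_ext => [||a b].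
- exact: lin_comp (pi2_lin m) (tens_mul_linl y).
- exact: lin_comp (tens_mul_linl _) (pi2_lin m).
move: y; apply: tens_ext => [||a' b'].
- exact: lin_comp (pi2_lin m) (tens_mul_linr _).
- exact: lin_comp (tens_mul_linr _) (pi2_lin m).
by rewrite tens_mulE !pi2E tens_mulE -!rmorphM.
Qed.

Lemma pi_eq m x y : mH m (x - y) -> pi m x = pi m y.
Proof. by move=> h; apply/qpi_eq. Qed.

Lemma pi_aug c : C c -> pi eps c = (counit c : k) *: 1.
Proof.
move=> Cc; rewrite -[1](rmorph1 (qpi (mH eps))) -linearZ; apply: pi_eq.
rewrite -[_ - _]mulr1; apply: max_ext_gen; split.
  by apply: csubD => //; apply: csubN; apply: csubZ; exact: csub1.
by rewrite linearB linearZ /= counit1 [_ *: _]mulr1 subrr.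
Qed.

Lemma pi2_comul m c : m c -> pi2 m (comul c) = 0.
Proof.
move=> mc; have [s [hs ec]] := csub_comul (max_sub mc).
have -> : pi2 m (comul c) = 1 ⊗ pi m (tscal (tmap counit id (comul c))).
  rewrite ec (lin_sum (pi2_lin m)).
  have l1 : linear (tmap counit id : tensor H H -> tensor k^o H).
    by apply: tmap_linear; [exact: linearP | exact: lin_id].
  rewrite (lin_sum l1) (lin_sum (@tscal_linear _ _)) linear_sum.
  rewrite (lin_sum (proj2 (tens_bilin _ _) _)); apply: eq_big_seq => p ps.
  have [C1 C2] := hs p ps.
  rewrite pi2E pi_aug // (tmapE (linearP _) (@lin_id _ _)) tscalE linearZ.
  by rewrite tensZl tensZr.
rewrite counit_comul (_ : pi m c = 0) ?(lin0 (proj2 (tens_bilin _ _) _)) //.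
rewrite -(linear0 (qpi (mH m))); apply: pi_eq.
by rewrite subr0 -[c]mulr1; exact: max_ext_gen.
Qed.

Lemma pi2_comul_mH m x : mH m x -> pi2 m (comul x) = 0.
Proof.
apply: (max_ext_ind (P := fun x => pi2 m (comul x) = 0)) => [|y z ey ez|c y mc].
- by rewrite linear0 (lin0 (pi2_lin m)).
- by rewrite linearD (linD (pi2_lin m)) ey ez addr0.
- by rewrite comulM pi2M pi2_comul // (lin0 (tens_mul_linl _)).
Qed.

(* Independent of the representative, see [qcoactE]. *)
Definition qcoact (m : maxSpec C) (x : hquot m) : tensor (hquot eps) (hquot m) :=
  tmap (pi eps) (pi m) (comul (qrepr x)).

Lemma qcoactE m x : qcoact (pi m x) = pi2 m (comul x).
Proof.
apply/eqP; rewrite -subr_eq0; apply/eqP.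
rewrite /qcoact -/(pi2 m _) -[X in _ - X]scale1r -scaleNr addrC -(pi2_lin m).
rewrite scaleN1r addrC -linearB; apply: pi2_comul_mH; exact: qpi_repr.
Qed.

Lemma qcoact_linear m : linear (@qcoact m).
Proof.
move=> a x y; rewrite -[x]qreprK -[y]qreprK -(pi_lin m) !qcoactE.
by rewrite linearP (pi2_lin m).
Qed.

HB.instance Definition _ m :=
  GRing.isLinear.Build k (hquot m) (tensor (hquot eps) (hquot m)) *:%R
    (@qcoact m) (@qcoact_linear m).

Lemma qcoact1 m : qcoact (1 : hquot m) = 1 ⊗ 1.
Proof. by rewrite -(rmorph1 (qpi (mH m))) qcoactE comul1 pi2E !rmorph1. Qed.

Lemma qcoactM m (x y : hquot m) :
  qcoact (x * y) = tens_mul (qcoact x) (qcoact y).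
Proof.
rewrite -[x]qreprK -[y]qreprK -(rmorphM (qpi (mH m))) !qcoactE.
by rewrite comulM pi2M.
Qed.

Lemma qcoactA m (x : hquot m) :
  tassoc (tmap (@qcoact eps) id (qcoact x)) = tmap id (@qcoact m) (qcoact x).
Proof.
have lq : linear (tmap (@qcoact eps) id :
    tensor (hquot eps) (hquot m) -> tensor (tensor (hquot eps) (hquot eps)) (hquot m)).
  by apply: tmap_linear; [exact: qcoact_linear | exact: lin_id].
have lq' : linear (tmap id (@qcoact m) :
    tensor (hquot eps) (hquot m) -> tensor (hquot eps) (tensor (hquot eps) (hquot m))).
  by apply: tmap_linear; [exact: lin_id | exact: qcoact_linear].
have lc : linear (tmap comul id : tensor H H -> tensor (tensor H H) H).
  by apply: tmap_linear; [exact: linearP | exact: lin_id].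
have lc' : linear (tmap id comul : tensor H H -> tensor H (tensor H H)).
  by apply: tmap_linear; [exact: lin_id | exact: linearP].
have lp := tmap_linear (pi_lin eps) (pi2_lin m).
rewrite -[x]qreprK qcoactE; set t := comul _.
transitivity (tmap (pi eps) (pi2 m) (tassoc (tmap comul id t))).
  move: t; apply: tens_ext => [||a b].
  - exact: lin_comp (@tassoc_linear _ _ _ _) (lin_comp lq (pi2_lin m)).
  - exact (lin_comp lp (lin_comp (@tassoc_linear _ _ _ _) lc)).
  rewrite pi2E (tmapE (@qcoact_linear eps) (@lin_id _ _)) qcoactE.
  rewrite (tmapE (linearP _) (@lin_id _ _)); move: (comul a) => y; move: y.
  have l (A : lmodType k) (c : A) (A' : lmodType k) (f : tensor H H -> A') :
      linear f -> linear (fun t => f t ⊗ c).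
    exact: tens_linl.
  apply: tens_ext => [||a1 a2].
  - exact: lin_comp (@tassoc_linear _ _ _ _) (l _ _ _ _ (pi2_lin eps)).
  - exact: lin_comp lp (lin_comp (@tassoc_linear _ _ _ _) (l _ _ _ _ (@lin_id _ _))).
  by rewrite pi2E !tassocE (tmapE (pi_lin eps) (pi2_lin m)) pi2E.
rewrite /t comulA; move: (comul _) => {}t; move: t; apply: tens_ext => [||a b].
- exact: lin_comp lp lc'.
- exact: lin_comp lq' (pi2_lin m).
rewrite (tmapE (@lin_id _ _) (linearP _)) (tmapE (pi_lin eps) (pi2_lin m)) pi2E.
by rewrite (tmapE (@lin_id _ _) (@qcoact_linear m)) qcoactE.
Qed.

Lemma counit_mH x : mH eps x -> counit x = 0.
Proof.
apply: (max_ext_ind (P := fun x => counit x = 0)) => [|y z ey ez|c y [_ ec]].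
- exact: linear0.
- by rewrite linearD ey ez addr0.
- by rewrite counitM ec mul0r.
Qed.

Definition qcounit (x : hquot eps) : k^o := counit (qrepr x).

Lemma qcounitE x : qcounit (pi eps x) = counit x.
Proof.
apply/eqP; rewrite -subr_eq0 -linearB; apply/eqP; apply: counit_mH.
exact: qpi_repr.
Qed.

Lemma qcounit_linear : linear qcounit.
Proof.
move=> a x y; rewrite -[x]qreprK -[y]qreprK -(pi_lin eps) !qcounitE.
exact: linearP.
Qed.

HB.instance Definition _ :=
  GRing.isLinear.Build k (hquot eps) k^o *:%R qcounit qcounit_linear.

Lemma qcounit1 : qcounit 1 = 1.
Proof. by rewrite -(rmorph1 (qpi (mH eps))) qcounitE counit1. Qed.

Lemma qcounitM (x y : hquot eps) : qcounit (x * y) = qcounit x * qcounit y.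
Proof.
rewrite -[x]qreprK -[y]qreprK -(rmorphM (qpi (mH eps))) !qcounitE.
exact: counitM.
Qed.

Lemma qcounit_coact m (x : hquot m) : tscal (tmap qcounit id (qcoact x)) = x.
Proof.
have lq : linear (tmap qcounit id : tensor (hquot eps) (hquot m) -> tensor k^o (hquot m)).
  by apply: tmap_linear; [exact: qcounit_linear | exact: lin_id].
have lc : linear (tmap counit id : tensor H H -> tensor k^o H).
  by apply: tmap_linear; [exact: linearP | exact: lin_id].
rewrite -{2}[x]qreprK -{1}[x]qreprK qcoactE -[in RHS](counit_comul (qrepr x)).
move: (comul _); apply: tens_ext => [||a b].
- exact: lin_comp (@tscal_linear _ _) (lin_comp lq (pi2_lin m)).
- exact: lin_comp (pi_lin m) (lin_comp (@tscal_linear _ _) lc).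
rewrite pi2E (tmapE qcounit_linear (@lin_id _ _)) qcounitE.
by rewrite (tmapE (linearP _) (@lin_id _ _)) !tscalE (linZ (pi_lin m)).
Qed.

Lemma qcoact_counit (x : hquot eps) :
  tscal' (tmap id qcounit (qcoact x)) = x.
Proof.
have lq : linear (tmap id qcounit : tensor (hquot eps) (hquot eps) -> tensor (hquot eps) k^o).
  by apply: tmap_linear; [exact: lin_id | exact: qcounit_linear].
have lc : linear (tmap id counit : tensor H H -> tensor H k^o).
  by apply: tmap_linear; [exact: lin_id | exact: linearP].
rewrite -{2}[x]qreprK -{1}[x]qreprK qcoactE -[in RHS](comul_counit (qrepr x)).
move: (comul _); apply: tens_ext => [||a b].
- exact: lin_comp (@tscal'_linear _ _) (lin_comp lq (pi2_lin eps)).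
- exact: lin_comp (pi_lin eps) (lin_comp (@tscal'_linear _ _) lc).
rewrite pi2E (tmapE (@lin_id _ _) qcounit_linear) qcounitE.
by rewrite (tmapE (@lin_id _ _) (linearP _)) !tscal'E (linZ (pi_lin eps)).
Qed.

Definition quot_bialg : bialgebra k :=
  @Bialgebra k (hquot eps) (@qcoact eps) qcounit (qcoact1 eps) (@qcoactM eps)
    qcounit1 qcounitM (@qcoactA eps) (@qcounit_coact eps) qcoact_counit.

Definition quot_comod (m : maxSpec C) : comodAlgebra quot_bialg :=
  @ComodAlgebra k quot_bialg (hquot m) (@qcoact m) (qcoact1 m) (@qcoactM m)
    (@qcoactA m) (@qcounit_coact m).

End QuotientStructures.

(* Main.v *)
From HB Require Import structures.
From mathcomp Require Import all_boot all_algebra ring.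
From mathcomp Require Import boolp classical_sets functions.
Require Import Defs.

(** Write [Hb] for the quotient of [H] by the ideal generated by the
    augmentation ideal of [C], and [A] for the quotient of [H] by [mH].  The
    theorem rests on three facts.

    Finiteness.  The residue field [K = C/m] acts on [A], and [A] has a finite
    [K]-basis containing [1].  The structure constants of [A] and the
    coordinates of algebra generators of [A] generate [K] as a ring over [k],
    because the coordinate along [1] recovers an element of [K]
    ([residue_finitely_generated]).  By Zariski's lemma [K] is algebraic over
    [k], hence equal to [k] ([nullstellensatz]).  So [A] is finite-dimensional
    ([finite_dim_hquot]), as is [Hb], which is the case of the augmentation
    ideal, and [C] acts on [A] by scalars ([pi_central_scalar]).

    Rigidity.  The antipode of [H] is antimultiplicative ([antipodeM]), so it
    descends to [Hb] ([quot_hopf]).  In a finite-dimensional Hopf algebra a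
    partial trace produces a nonzero left integral ([exists_left_integral]);
    the integral makes the antipode [S] injective ([antipode_eq0]), hence
    bijective.  The dual space of a module [X], with [Hb] acting through [S] or
    through the inverse of [S], is then a left or a right dual of [X]
    ([finite_hopf_rigid]).

    The Galois property.  The formula [x_1 ⊗ S x_2] for [x] in [H] induces a map
    [tau : Hb -> A ⊗ A] inverting the canonical map
    [x ⊗ y |-> x_(-1) ⊗ x_(0) y] from [A ⊗ A] to [Hb ⊗ A] ([qtranslationP]).  It
    is well defined because [C] acts by scalars: the contribution of [c] in [C]
    is the scalar by which [c_1 * S c_2] acts, that is, the counit of [c].
    Consequently, for a free module [Hb ⊗ X] and an [A]-module [M], the
    [A]-module [(Hb ⊗ X) ⊗ M] is free on the vector space [X ⊗ M]: its
    [A]-linear maps to [N] are the same as the linear maps from [X ⊗ M] to [N]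
    ([galois_hom_ext], [galois_hom_extend]).

    Exactness follows, because a projective [Hb]-module [P] is a direct summand
    of the free module [Hb ⊗ P], so that [P ⊗ M] is a direct summand of a free
    [A]-module ([galois_exact]).  For indecomposability, a decomposition of the
    module category would give two nonzero idempotents [e1], [e2] of a single
    module [M], coming from different summands; every composite
    [e2 f (id ⊗ e1)] with [f : X ⊗ M -> M] would vanish, whereas freeness of
    [Hb ⊗ M] provides an [f] for which it does not ([galois_nonzero_hom],
    [galois_indecomposable]). *)

Set Implicit Arguments.
Unset Strict Implicit.
Unset Printing Implicit Defensive.

Import GRing.Theory.
Local Open Scope ring_scope.

(** * Zariski's lemma *)

Section Zariski.

Definition subring_set (K : fieldType) (S : K -> Prop) : Prop :=
  [/\ S 1, forall x y, S x -> S y -> S (x - y)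
    & forall x y, S x -> S y -> S (x * y)].

(** Being algebraic over the fraction field of [A], phrased through integrality
    so that closure under ring operations comes from that of integral
    elements. *)
Definition frac_integral (A : idomainType) (K : fieldType) (phi : {rmorphism A -> K})
  (y : K) : Prop := exists2 a, a != 0 & integralOver phi (phi a * y).

(** Membership in the ring generated by [phi A] and [s], tested on all subrings;
    this avoids polynomials in several variables. *)
Definition in_adjoin (A : idomainType) (K : fieldType) (phi : {rmorphism A -> K})
    (s : seq K) (y : K) : Prop :=
  forall S, subring_set S -> (forall a, S (phi a)) -> (forall z, z \in s -> S z) -> S y.

Section Basics.
Variables (A : idomainType) (K : fieldType) (phi : {rmorphism A -> K}).

Lemma frac_integral_subring : subring_set (frac_integral phi).
Proof.
split=> [|x y [a a0 ax] [b b0 byy]|x y [a a0 ax] [b b0 byy]].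
- by exists 1; rewrite ?oner_neq0 // rmorph1 mulr1; exact: integral1.
- exists (a * b); first by rewrite mulf_neq0.
  rewrite (_ : _ * _ = phi b * (phi a * x) - phi a * (phi b * y)); last first.
    by rewrite rmorphM mulrBr !mulrA [phi b * _]mulrC.
  by apply: integral_sub; apply: integral_mul => //; exact: integral_id.
- exists (a * b); first by rewrite mulf_neq0.
  by rewrite rmorphM mulrACA; exact: integral_mul.
Qed.

Lemma frac_integral_id a : frac_integral phi (phi a).
Proof.
by exists 1; rewrite ?oner_neq0 // rmorph1 mul1r; exact: integral_id.
Qed.

(** If [c] is the leading coefficient of [p] and [d] its degree, then
    [c ^+ d.-1 * p.[y]] is a monic polynomial in [c * y]. *)
Lemma root_frac_integral (p : {poly A}) y :
  injective phi -> p != 0 -> root (map_poly phi p) y -> frac_integral phi y.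
Proof.
move=> phi_inj p0 /eqP py; exists (lead_coef p); first by rewrite lead_coef_eq0.
set c := lead_coef p; set d := (size p).-1.
have dE : size p = d.+1 by rewrite prednK // size_poly_gt0.
case: (posnP d) => [d0 | d_gt0].
  move: py; have /size_poly1P [b b0 ->] : size p == 1%N by rewrite dE d0.
  by rewrite map_polyC hornerC => /eqP; rewrite -(rmorph0 phi) (inj_eq phi_inj) (negbTE b0).
pose q : {poly A} := \poly_(i < d.+1) (if i == d then 1 else p`_i * c ^+ (d.-1 - i)).
have qs : size q = d.+1 by rewrite /q size_poly_eq // eqxx oner_neq0.
exists q; first by rewrite monicE lead_coefE qs coef_poly ltnSn eqxx.
apply/eqP; have -> : (map_poly phi q).[phi c * y] = phi c ^+ d.-1 * (map_poly phi p).[y].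
  rewrite !horner_coef !(size_map_inj_poly phi_inj (rmorph0 phi)) qs dE.
  rewrite mulr_sumr; apply: eq_bigr => i _; rewrite !coef_map coef_poly ltn_ord /=.
  case: eqP => [-> | /eqP ni].
    rewrite rmorph1 mul1r exprMn mulrA; congr (_ * _).
    by rewrite -{1}(prednK d_gt0) exprSr /c lead_coefE.
  have hi : (i <= d.-1)%N by rewrite -ltnS prednK // ltn_neqAle ni -ltnS ltn_ord.
  rewrite rmorphM rmorphXn exprMn -{2}(subnK hi) exprD.
  rewrite [phi p`_i * _]mulrC -!mulrA; congr (_ * _); exact: mulrCA.
by rewrite py mulr0.
Qed.

End Basics.

Lemma frac_integral_trans (A A' : idomainType) (K : fieldType) (phi : {rmorphism A -> K})
  (psi : {rmorphism A' -> K}) (f : {rmorphism A -> A'}) y :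
  injective f -> phi =1 psi \o f -> frac_integral phi y -> frac_integral psi y.
Proof.
move=> f_inj e [a a0 [p mp pr]]; exists (f a).
  by rewrite -(rmorph0 f) (inj_eq f_inj).
exists (map_poly f p); first exact: monic_map.
by rewrite -map_poly_comp -(eq_map_poly e); rewrite [psi _](esym (e a)).
Qed.

Lemma common_denominator (A : idomainType) (K : fieldType) (phi : {rmorphism A -> K})
  (s : seq K) : (forall z, frac_integral phi z) ->
  exists2 f, f != 0 & forall z, z \in s -> integralOver phi (phi f * z).
Proof.
move=> h; elim: s => [|z s [f f0 ih]]; first by exists 1; rewrite ?oner_neq0.
have [a a0 az] := h z; exists (a * f); first by rewrite mulf_neq0.
move=> w; rewrite inE rmorphM => /orP[/eqP -> | ws].
  by rewrite mulrAC; apply: integral_mul az _; exact: integral_id.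
by rewrite -mulrA; apply: integral_mul; [exact: integral_id | exact: ih].
Qed.

(** If [psi 'X] is transcendental over [A], a field cannot be algebraic over
    [A['X]] and also be generated by finitely many elements over the fraction
    field of [A].  With a common denominator [f] of the generators, every
    element becomes integral after multiplication by a power of [f] and an
    element of [A].  Applied to the inverse of [g = 1 + 'X * f], an integral
    equation shows that [g] divides a power of [f ^+ N * a]; since ['X * f] is
    [-1] modulo [g], it divides a nonzero constant, but [g] is not constant. *)
Lemma transcendental_absurd (A : idomainType) (K : fieldType)
  (psi : {rmorphism {poly A} -> K}) (s : seq K) :
  injective psi -> (forall z, frac_integral psi z) ->
  ~ (forall y, exists2 a : A, a != 0 & in_adjoin psi s (psi a%:P * y)).
Proof.
move=> psi_inj fi gen; have [f f0 hf] := common_denominator s fi.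
pose g : {poly A} := 1 + 'X * f.
have gs : size g = (size f).+1.
  have Xfs : size ('X * f) = (size f).+1 by rewrite -(commr_polyX f) size_mulX.
  by rewrite /g addrC size_polyDl Xfs // size_poly1 ltnS size_poly_gt0.
have {}gs : (1 < size g)%N by rewrite gs ltnS size_poly_gt0.
have g0 : g != 0 by rewrite -size_poly_gt0 (ltn_trans _ gs).
have [a a0 ha] := gen (psi g)^-1.
pose S z := exists N, integralOver psi (psi f ^+ N * z).
have int_f N : integralOver psi (psi f ^+ N).
  by rewrite -rmorphXn; exact: integral_id.
have [N [p mp pr]] : S (psi a%:P * (psi g)^-1).
  apply: ha => [|p|z zs].
  - split=> [|x y [i ix] [j jy]|x y [i ix] [j jy]].
    + by exists 0%N; rewrite mulr1; exact: integral1.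
    + exists (i + j)%N; rewrite mulrBr exprD.
      apply: integral_sub; last by rewrite -mulrA; exact: integral_mul.
      by rewrite mulrAC; exact: integral_mul.
    + by exists (i + j)%N; rewrite exprD mulrACA; exact: integral_mul.
  - by exists 0%N; rewrite expr0 mul1r; exact: integral_id.
  - by exists 1%N; rewrite expr1; exact: hf.
have pg0 : psi g != 0 by rewrite -(rmorph0 psi) (inj_eq psi_inj).
pose u := f ^+ N * a%:P; pose d := (size p).-1.
have dE : size p = d.+1 by rewrite prednK // size_poly_gt0 monic_neq0.
have e : (map_poly psi p).[psi u / psi g] = 0.
  by apply/eqP; rewrite /u rmorphM rmorphXn -mulrA.
(* multiply the integral equation of u / g by g ^+ d *)
have [h hE] : exists h, u ^+ d = g * h.
  exists (- \sum_(i < d) p`_i * u ^+ i * g ^+ (d.-1 - i)).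
  have : \sum_(i < d.+1) p`_i * u ^+ i * g ^+ (d - i) = 0.
    apply: (psi_inj); rewrite rmorph0 rmorph_sum.
    transitivity (psi g ^+ d * (map_poly psi p).[psi u / psi g]); last by rewrite e mulr0.
    rewrite horner_coef (size_map_inj_poly psi_inj (rmorph0 psi)) dE.
    rewrite mulr_sumr; apply: eq_bigr => i _; rewrite coef_map /= expr_div_n.
    rewrite rmorphM [psi (_ * u ^+ _)]rmorphM !rmorphXn.
    have hi : (i <= d)%N by rewrite -ltnS.
    have -> : psi g ^+ d = psi g ^+ (d - i) * psi g ^+ i by rewrite -exprD subnK.
    have gi0 : psi g ^+ i != 0 by rewrite expf_neq0.
    by rewrite [_ * (_ * _)]mulrACA [psi g ^+ i * _]mulrC divfK // mulrC mulrA.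
  rewrite big_ord_recr /= subnn expr0 mulr1.
  have -> : p`_d = 1 by rewrite -(eqP mp) lead_coefE.
  rewrite mul1r => /eqP; rewrite addrC addr_eq0 => /eqP ->.
  rewrite mulrN; congr (- _); rewrite mulr_sumr; apply: eq_bigr => i _.
  rewrite -[(d - i)%N]prednK ?subn_gt0 // exprS mulrCA; congr (_ * (_ * _)).
  by rewrite -!subn1 subnAC.
(* 'X * f = -1 modulo g, so the power of f can be removed *)
have [h' h'E] : exists h', (a ^+ d)%:P = g * h'.
  have Xf : 'X * f = g - 1 by rewrite /g addrC addKr.
  pose M := (N * d)%N.
  have : 'X ^+ M * u ^+ d = g * ('X ^+ M * h) by rewrite hE mulrCA.
  rewrite /u exprMn -exprM -/M [_ * (f ^+ M * _)]mulrA -exprMn Xf => e1.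
  have [r rE] : exists r, (g - 1) ^+ M = g * r + (-1) ^+ M.
    elim: M {e1} => [|M [r ih]]; first by exists 0; rewrite !expr0 mulr0 add0r.
    exists (r * (g - 1) + (-1) ^+ M); rewrite exprS ih.
    by rewrite [in RHS]exprS; ring.
  exists ((-1) ^+ M * ('X ^+ M * h - r * a%:P ^+ d)); rewrite rmorphXn /=.
  rewrite mulrCA mulrBr -e1 rE mulrA mulrDl addrAC subrr add0r mulrA -exprMn.
  by rewrite mulrNN mulr1 expr1n mul1r.
have : size ((a ^+ d)%:P) = 1%N by rewrite size_polyC expf_neq0.
have [h0 | h0] := eqVneq h' 0; first by rewrite h'E h0 mulr0 size_poly0.
rewrite h'E size_mul // => e2; have hs : (0 < size h')%N by rewrite size_poly_gt0.
by move: e2; rewrite -(subnKC gs) -(prednK hs) addnS !addSn.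
Qed.

Lemma horner_injective (A : idomainType) (K : fieldType) (phi : {rmorphism A -> K}) x :
  injective phi -> ~ frac_integral phi x ->
  injective (horner_eval x \o map_poly phi : {rmorphism {poly A} -> K}).
Proof.
move=> phi_inj nx; apply: raddf_inj => p /= /eqP px; apply/eqP; apply: contrapT => /negP p0.
by apply: nx; apply: root_frac_integral p0 _.
Qed.

(** The generators in [t] are those already known to be algebraic.  An algebraic
    generator is moved from [s] to [t]; a transcendental one is absorbed into
    the coefficient ring, which becomes [{poly A}].  In the second case the
    induction makes the field algebraic over [{poly A}], and
    [transcendental_absurd] applies. *)
Theorem zariski_lemma (A : idomainType) (K : fieldType) (phi : {rmorphism A -> K})
    (s t : seq K) : injective phi -> (forall z, z \in t -> frac_integral phi z) ->
  (forall y, exists2 a : A, a != 0 & in_adjoin phi (s ++ t) (phi a * y)) ->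
  forall y, frac_integral phi y.
Proof.
elim: s A phi t => [|x s ih] A phi t phi_inj ht gen.
  move=> y; have [a a0 ha] := gen y.
  have [b b0 hb] := ha _ (frac_integral_subring phi) (@frac_integral_id _ _ phi) ht.
  by exists (b * a); rewrite ?mulf_neq0 // rmorphM -mulrA.
have [xi | nx] := pselect (frac_integral phi x).
  apply: (ih A phi (x :: t)) => // [z|y].
    by rewrite inE => /orP[/eqP -> | /ht].
  have [a a0 ha] := gen y; exists a => // S Sr SA Sst; apply: ha => // z zst.
  by apply: Sst; move: zst; rewrite !(inE, mem_cat) orbCA.
pose psi : {rmorphism {poly A} -> K} := horner_eval x \o map_poly phi.
have psi_inj := horner_injective phi_inj nx.
have psiC a : psi a%:P = phi a by rewrite /= /horner_eval map_polyC hornerC.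
have psiX : psi 'X = x by rewrite /= /horner_eval map_polyX hornerX.
have genX y : exists2 a : A, a != 0 & in_adjoin psi (s ++ t) (psi a%:P * y).
  have [a a0 ha] := gen y; exists a => // S Sr SA Sst; rewrite psiC.
  apply: ha => // [b|z]; first by rewrite -psiC.
  by rewrite inE => /orP[/eqP -> | /Sst //]; rewrite -psiX.
have alg : forall y, frac_integral psi y.
  apply: (ih _ psi t) => // [z zt|y].
    apply: (@frac_integral_trans _ _ _ phi psi (polyC : {rmorphism A -> {poly A}})).
    - exact: polyC_inj.
    - by move=> a; rewrite -psiC.
    - exact: ht.
  by have [a a0 ha] := genX y; exists a%:P => //; rewrite polyC_eq0.
by case: (@transcendental_absurd A K psi (s ++ t) psi_inj alg genX).
Qed.

(** An algebraic element over [k] is the root of a polynomial that splits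
    over [k]. *)
Theorem nullstellensatz (k : closedFieldType) (K : fieldType) (phi : {rmorphism k -> K})
    (s : seq K) :
  (forall y, in_adjoin phi s y) -> forall y, exists a, y = phi a.
Proof.
move=> gen y; have alg : frac_integral phi y.
  apply: (@zariski_lemma k K phi s [::]) => // [|z]; first exact: fmorph_inj.
  by exists 1; [exact: oner_neq0 | rewrite cats0; exact: gen].
have [a a0 [p mp pr]] := alg.
have [r rE] := closed_field_poly_normal p.
have pE : map_poly phi p = \prod_(z <- map phi r) ('X - z%:P).
  rewrite rE (eqP mp) scale1r rmorph_prod big_map; apply: eq_bigr => z _.
  by rewrite rmorphB /= map_polyX map_polyC.
have a0' : phi a != 0 by rewrite fmorph_eq0.
move: pr; rewrite pE root_prod_XsubC => /mapP[z _ zE].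
by exists (a^-1 * z); rewrite rmorphM -zE fmorphV mulKf.
Qed.

End Zariski.

(** * Bases of finite-dimensional spaces *)

Section Bases.
Variable k : fieldType.

(** The coordinate functions are part of the data because traces, dual spaces
    and structure constants are all expressed through them. *)
Record basis (V : lmodType k) := Basis {
  bdim : nat;
  bvec : 'I_bdim -> V;
  coord : 'I_bdim -> V -> k^o;
  coord_linear : forall i, linear (coord i);
  coord_sum : forall v, v = \sum_i (coord i v : k) *: bvec i;
  coord_bvec : forall i j, coord i (bvec j) = (i == j)%:R
}.

Arguments bvec {V} b i.
Arguments coord {V} b i v.
Arguments coord_linear {V} b i.
Arguments coord_sum {V} b v.
Arguments coord_bvec {V} b i j.

Lemma basis_of_free_span (V : lmodType k) n (e : 'I_n -> V) :
  (forall v, exists c : 'I_n -> k, v = \sum_i c i *: e i) ->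
  (forall c : 'I_n -> k, \sum_i c i *: e i = 0 -> forall i, c i = 0) ->
  exists b : basis V, exists nE : bdim b = n, forall i, bvec b i = e (cast_ord nE i).
Proof.
move=> span free; have /choice [c hc] : forall v, exists c : 'I_n -> k, v = \sum_i c i *: e i.
  exact: span.
have uniq (a b : 'I_n -> k) : \sum_i a i *: e i = \sum_i b i *: e i -> forall i, a i = b i.
  move=> ab i; apply/eqP; rewrite -subr_eq0; apply/eqP; move: i.
  apply: (free (fun i => a i - b i)).
  under eq_bigr do rewrite scalerBl.
  by rewrite sumrB ab subrr.
have lc i : linear (fun v => c v i : k^o).
  move=> a u v; apply: (uniq _ (fun i => a * c u i + c v i)).
  rewrite -hc {1}(hc u) {1}(hc v) scaler_sumr -big_split /=.
  by apply: eq_bigr => j _; rewrite scalerDl scalerA.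
have dc i j : c (e j) i = (i == j)%:R.
  apply: (uniq _ (fun i => (i == j)%:R)); rewrite -hc (bigD1 j) //= eqxx scale1r.
  by rewrite big1 ?addr0 // => l /negPf ->; rewrite scale0r.
exists (@Basis V n e (fun i v => c v i) lc hc dc), erefl => i.
by rewrite cast_ord_id.
Qed.

(** A family of least length that spans [V] together with [v0] is free together
    with [v0]: a relation would either express one of its members through the
    others, or make [v0] zero. *)
Lemma basis_extending (V : lmodType k) (v0 : V) : finite_dim V -> v0 != 0 ->
  exists (b : basis V) (i : 'I_(bdim b)), bvec b i = v0.
Proof.
move=> [n0 [e0 span0]] nz.
pose P n := `[< exists e : 'I_n -> V, forall v, exists c0 (c : 'I_n -> k),
  v = c0 *: v0 + \sum_i c i *: e i >].
have exP : exists n, P n.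
  exists n0; apply/asboolP; exists e0 => v; have [c ->] := span0 v.
  by exists 0, c; rewrite scale0r add0r.
case: (ex_minnP exP) => n /asboolP [e span] min.
pose f (i : 'I_n.+1) := if unlift ord0 i is Some j then e j else v0.
have fS (c : 'I_n.+1 -> k) :
    \sum_i c i *: f i = c ord0 *: v0 + \sum_i c (lift ord0 i) *: e i.
  rewrite big_ord_recl /f unlift_none; congr (_ + _).
  by apply: eq_bigr => i _; rewrite liftK.
have [||b [nE bE]] := @basis_of_free_span V n.+1 f.
- move=> v; have [c0 [c ->]] := span v.
  exists (fun i => if unlift ord0 i is Some j then c j else c0).
  by rewrite fS unlift_none; congr (_ + _); apply: eq_bigr => i _; rewrite liftK.
- move=> c; rewrite fS => c_eq0.
  have cl j : c (lift ord0 j) = 0.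
    apply/eqP; apply: contrapT => /negP cj.
    case: n e span min f fS c c_eq0 j cj => [|n] e span min f fS c c_eq0 j cj.
      by case: j {cj}.
    suff : P n by move=> /min; rewrite ltnn.
    apply/asboolP; exists (fun i => e (lift j i)) => v.
    have [d0 [d ->]] := span v; pose r := d j / c (lift ord0 j).
    exists (d0 - r * c ord0), (fun i => d (lift j i) - r * c (lift ord0 (lift j i))).
    have -> : d0 *: v0 + \sum_i d i *: e i =
        (d0 - r * c ord0) *: v0 + \sum_i (d i - r * c (lift ord0 i)) *: e i.
      rewrite -[LHS]subr0 -[X in _ - X](scaler0 _ r) -[X in r *: X]c_eq0.
      rewrite scalerDr opprD addrACA scalerBl scalerA.
      congr (_ + _); rewrite scaler_sumr -sumrB; apply: eq_bigr => i _.
      by rewrite scalerBl scalerA.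
    by rewrite (bigD1_ord _ (erefl : xpredT j)) /= divfK // subrr scale0r add0r.
  have c0 : c ord0 = 0.
    apply/eqP; move/eqP: c_eq0; rewrite big1 => [|j _]; last by rewrite cl scale0r.
    by rewrite addr0 scaler_eq0 (negPf nz) orbF.
  by move=> i; case: (unliftP ord0 i) => [j ->|->].
- have h : (0 < bdim b)%N by rewrite nE.
  exists b, (Ordinal h); rewrite bE /f (_ : cast_ord _ _ = ord0) ?unlift_none //.
  exact: val_inj.
Qed.

Lemma exists_basis (V : lmodType k) : finite_dim V -> inhabited (basis V).
Proof.
move=> fV; have [[v0 nz] | h] := pselect (exists v0 : V, v0 != 0).
  by have [b _] := basis_extending fV nz; split.
have z (v : V) : v = 0 by apply/eqP; apply: contrapT => /negP nz; apply: h; exists v.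
have [||b _] := @basis_of_free_span V 0 (fun _ => 0); last by split.
- by move=> v; exists (fun _ => 0); rewrite big_ord0; exact: z.
- by move=> c _ [].
Qed.

Lemma coord_eq (V : lmodType k) (b : basis V) (u v : V) :
  (forall i, coord b i u = coord b i v) -> u = v.
Proof.
by move=> h; rewrite (coord_sum b u) (coord_sum b v); apply: eq_bigr => i _; rewrite h.
Qed.

Lemma linear_inj_surj (V : lmodType k) (f : V -> V) : finite_dim V ->
  linear f -> (forall v, f v = 0 -> v = 0) -> exists g, [/\ linear g, cancel f g & cancel g f].
Proof.
move=> fV lf f0; have [b] := exists_basis fV.
pose v2r v : 'rV[k]_(bdim b) := \row_i coord b i v.
pose r2v (r : 'rV[k]_(bdim b)) := \sum_i r 0 i *: bvec b i.
have r2vK r : v2r (r2v r) = r.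
  apply/rowP => i; rewrite mxE /r2v (lin_sum (coord_linear b i)) (bigD1 i) //=.
  rewrite (linZ (coord_linear b i)) coord_bvec eqxx [_ *: _]mulr1 big1 ?addr0 // => j ji.
  by rewrite (linZ (coord_linear b i)) coord_bvec eq_sym (negPf ji) scaler0.
have v2rK v : r2v (v2r v) = v.
  by rewrite [RHS](coord_sum b); apply: eq_bigr => i _; rewrite mxE.
have r2v_lin : linear r2v.
  move=> a u v; rewrite /r2v scaler_sumr -big_split; apply: eq_bigr => i _ /=.
  by rewrite !mxE scalerDl scalerA.
have v2r_lin : linear v2r.
  by move=> a u v; apply/rowP => i; rewrite !mxE (coord_linear b i).
pose M : 'M[k]_(bdim b) := \matrix_i v2r (f (bvec b i)).
have ME r : r *m M = v2r (f (r2v r)).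
  rewrite /r2v (lin_sum lf) (lin_sum v2r_lin); apply/rowP => j.
  rewrite mxE summxE; apply: eq_bigr => i _.
  by rewrite (linZ lf) (linZ v2r_lin) !mxE.
have Mu : M \in unitmx.
  rewrite -row_free_unit; apply: inj_row_free => r; rewrite ME => h.
  rewrite -[r]r2vK (f0 (r2v r)) ?(lin0 v2r_lin) // -[LHS]v2rK h.
  exact: lin0 r2v_lin.
exists (fun v => r2v (v2r v *m invmx M)); split.
- by move=> a u v; rewrite v2r_lin mulmxDl -scalemxAl r2v_lin.
- by move=> v; rewrite -{1}[v]v2rK -ME mulmxK // v2rK.
- by move=> v; rewrite -[LHS]v2rK -ME mulmxKV // v2rK.
Qed.

End Bases.

Arguments bvec {k V} b i.
Arguments coord {k V} b i v.
Arguments coord_linear {k V} b i.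
Arguments coord_sum {k V} b v.
Arguments coord_bvec {k V} b i j.

(** * Sweedler calculus *)

Section Combinators.
Variables (k : fieldType) (T : lmodType k).

Lemma lin_app (U V : lmodType k) (f : {linear U -> V}) (g : T -> U) :
  linear g -> linear (fun t => f (g t)).
Proof. by move=> lg a x y; rewrite lg linearP. Qed.

Lemma lin_mull (A : algType k) (f : T -> A) y : linear f -> linear (fun t => f t * y).
Proof. exact: (lin_comp (proj1 (mul_bilin A) y)). Qed.

Lemma lin_mulr (A : algType k) (f : T -> A) y : linear f -> linear (fun t => y * f t).
Proof. exact: (lin_comp (proj2 (mul_bilin A) y)). Qed.

Lemma lin_scalel (V : lmodType k) (f : T -> k^o) (v : V) :
  linear f -> linear (fun t => (f t : k) *: v).
Proof. by move=> lf a x y; rewrite lf scalerDl scalerA. Qed.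

Lemma lin_scaler (V : lmodType k) (f : T -> V) (c : k) :
  linear f -> linear (fun t => c *: f t).
Proof. by move=> lf a x y; rewrite lf scalerDr !scalerA mulrC. Qed.

Lemma lin_big (V : lmodType k) I (r : seq I) (f : I -> T -> V) :
  (forall i, linear (f i)) -> linear (fun t => \sum_(i <- r) f i t).
Proof.
move=> lf a x y; rewrite scaler_sumr -big_split; apply: eq_bigr => i _; exact: lf.
Qed.

Lemma lin_tlift (V W U : lmodType k) (F : V -> W -> U) (f : T -> tensor V W) :
  bilin F -> linear f -> linear (fun t => tlift F (f t)).
Proof. by move=> bF; exact: lin_comp (tlift_linear bF). Qed.

Lemma lin_bilinl (V W U : lmodType k) (F : V -> W -> U) (f : T -> V) w :
  bilin F -> linear f -> linear (fun t => F (f t) w).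
Proof. by move=> [bF _]; exact: lin_comp (bF w). Qed.

Lemma lin_bilinr (V W U : lmodType k) (F : V -> W -> U) (f : T -> W) v :
  bilin F -> linear f -> linear (fun t => F v (f t)).
Proof. by move=> [_ bF]; exact: lin_comp (bF v). Qed.

End Combinators.

Lemma tlift_comp (k : fieldType) (V W U U' : lmodType k) (F : V -> W -> U)
    (g : U -> U') (x : tensor V W) :
  linear g -> g (tlift F x) = tlift (fun v w => g (F v w)) x.
Proof. by move=> lg; rewrite /tlift /fsum_eval (lin_sum lg). Qed.

Lemma eq_tlift (k : fieldType) (V W U : lmodType k) (F G : V -> W -> U) x :
  (forall v w, F v w = G v w) -> tlift F x = tlift G x.
Proof. by move=> h; apply: eq_bigr => p _; exact: h. Qed.

Lemma tlift_exchange (k : fieldType) (V W V' W' U : lmodType k)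
    (F : V -> W -> V' -> W' -> U) x y :
  tlift (fun v w => tlift (fun v' w' => F v w v' w') y) x =
  tlift (fun v' w' => tlift (fun v w => F v w v' w') x) y.
Proof. exact: exchange_big. Qed.

(** [\Delta_(a, b <- x) f a b] is the sum written [f x_1 x_2] in Sweedler
    notation. *)
Definition sw (k : fieldType) (B : bialgebra k) (U : lmodType k) (f : B -> B -> U)
  (x : B) : U := tlift f (comul x).

Notation "\Delta_ ( a , b <- x ) E" := (sw (fun a b => E) x)
  (at level 41, E at level 41, a binder, b binder,
   format "\Delta_ ( a ,  b  <-  x )  E").

Lemma sw_linear (k : fieldType) (B : bialgebra k) (T U : lmodType k)
    (f : B -> B -> U) (g : T -> B) :
  bilin f -> linear g -> linear (fun t => \Delta_(a, b <- g t) f a b).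
Proof. by move=> bf lg; apply: lin_tlift => //; apply: lin_app. Qed.

Lemma sw_param (k : fieldType) (B : bialgebra k) (T U : lmodType k)
    (f : T -> B -> B -> U) x :
  (forall a b, linear (fun t => f t a b)) ->
  linear (fun t => \Delta_(a, b <- x) f t a b).
Proof. exact: tlift_param. Qed.

(** [lin] proves linearity and bilinearity by recursion on the shape of the
    expression: a hole in a product, a tensor, a scaling, a sum, a bilinear map
    applied to a tensor, or a map whose linearity is a hypothesis. *)
Ltac lin_step :=
  first
  [ assumption
  | exact: lin_id
  | exact: linearP
  | split=> ?
  | apply: lin_mull
  | apply: lin_mulr
  | apply: tens_linl
  | apply: tens_linr
  | apply: lin_scalel
  | apply: lin_scaler
  | apply: lin_app
  | apply: tlift_param => ? ?
  | apply: sw_param => ? ?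
  | apply: lin_tlift
  | apply: sw_linear
  | apply: lin_big => ?
  | match goal with
    | h : linear _ |- _ => apply: (lin_comp h)
    | h : bilin _ |- _ => apply: (lin_bilinl _ h)
    | h : bilin _ |- _ => apply: (lin_bilinr _ h)
    | h : forall _, linear _ |- _ => apply: (lin_comp (h _))
    | h : forall _ _, linear _ |- _ => apply: (lin_comp (h _ _))
    end ].
Ltac lin := repeat lin_step.

Section Sweedler.
Variables (k : fieldType) (B : bialgebra k).
Implicit Types (U V : lmodType k) (x y : B).

Lemma eq_sw U (f g : B -> B -> U) x :
  (forall a b, f a b = g a b) -> sw f x = sw g x.
Proof. exact: eq_tlift. Qed.

Lemma sw_comp U V (f : B -> B -> U) (g : U -> V) x :
  linear g -> g (\Delta_(a, b <- x) f a b) = \Delta_(a, b <- x) g (f a b).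
Proof. exact: tlift_comp. Qed.

Lemma sw_exchange U (f : B -> B -> B -> B -> U) x y :
  \Delta_(a, b <- x) \Delta_(c, d <- y) f a b c d =
  \Delta_(c, d <- y) \Delta_(a, b <- x) f a b c d.
Proof. exact: tlift_exchange. Qed.

Lemma sw_sum U I (r : seq I) (F : I -> B -> B -> U) x :
  \sum_(i <- r) \Delta_(a, b <- x) F i a b = \Delta_(a, b <- x) \sum_(i <- r) F i a b.
Proof. exact: exchange_big. Qed.

(** Both sides are the sum [f x_1 x_2 x_3]. *)
Lemma swA U (f : B -> B -> B -> U) x :
  (forall b c, linear (fun a => f a b c)) ->
  (forall a c, linear (fun b => f a b c)) ->
  (forall a b, linear (fun c => f a b c)) ->
  \Delta_(a, b <- x) \Delta_(c, d <- a) f c d b =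
  \Delta_(a, b <- x) \Delta_(c, d <- b) f a c d.
Proof.
move=> l1 l2 l3.
have b3 a : bilin (f a) by split.
have b1 : bilin (fun a => tlift (f a)).
  by split=> z; [apply: tlift_param | exact: tlift_linear].
have lc1 : linear (tmap comul id : tensor B B -> tensor (tensor B B) B).
  by apply: tmap_linear; lin.
have lc2 : linear (tmap id comul : tensor B B -> tensor B (tensor B B)).
  by apply: tmap_linear; lin.
have := congr1 (tlift (fun a => tlift (f a))) (comulA x).
have -> : \Delta_(a, b <- x) \Delta_(c, d <- b) f a c d =
    tlift (fun a => tlift (f a)) (tmap id comul (comul x)).
  rewrite {1}/sw; move: (comul x); apply: tens_ext => [||a b].
  - apply: tlift_linear; split=> z; first by apply: sw_param.
    by apply: sw_linear.
  - exact: lin_comp (tlift_linear b1) lc2.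
  rewrite tliftE ?(tmapE (@lin_id _ _) (linearP _)) ?tliftE //.
  by split=> z; [apply: sw_param | apply: sw_linear].
move=> <-; rewrite {1}/sw; move: (comul x); apply: tens_ext => [||a b].
- apply: tlift_linear; split=> z; last by apply: sw_param.
  by apply: sw_linear => //; split.
- apply: lin_comp (tlift_linear b1) _.
  exact: lin_comp (@tassoc_linear _ _ _ _) lc1.
rewrite tliftE ?(tmapE (linearP _) (@lin_id _ _)); last first.
  split=> z; last by apply: sw_param.
  by apply: sw_linear => //; split.
rewrite /sw; move: (comul a); apply: tens_ext => [||c d].
- by apply: tlift_linear; split.
- apply: lin_comp (tlift_linear b1) _; apply: lin_comp (@tassoc_linear _ _ _ _) _.
  by lin.
by rewrite tassocE !tliftE //; split.
Qed.

Lemma sw_counitl U (f : B -> U) x :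
  linear f -> \Delta_(a, b <- x) ((counit a : k) *: f b) = f x.
Proof.
move=> lf; rewrite -[in RHS](counit_comul x).
rewrite /sw; move: (comul x); apply: tens_ext => [||a b].
- by apply: tlift_linear; lin.
- apply: lin_comp lf _; apply: lin_comp (@tscal_linear _ _) _.
  by apply: tmap_linear; lin.
by rewrite tliftE ?(tmapE (linearP _) (@lin_id _ _)) ?tscalE ?(linZ lf) //; lin.
Qed.

Lemma sw_counitr U (f : B -> U) x :
  linear f -> \Delta_(a, b <- x) ((counit b : k) *: f a) = f x.
Proof.
move=> lf; rewrite -[in RHS](comul_counit x).
rewrite /sw; move: (comul x); apply: tens_ext => [||a b].
- by apply: tlift_linear; lin.
- apply: lin_comp lf _; apply: lin_comp (@tscal'_linear _ _) _.
  by apply: tmap_linear; lin.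
by rewrite tliftE ?(tmapE (@lin_id _ _) (linearP _)) ?tscal'E ?(linZ lf) //; lin.
Qed.

Lemma sw1 U (f : B -> B -> U) : bilin f -> \Delta_(a, b <- 1) f a b = f 1 1.
Proof. by move=> bf; rewrite /sw comul1 tliftE. Qed.

Lemma swM U (f : B -> B -> U) x y : bilin f ->
  \Delta_(a, b <- x * y) f a b =
  \Delta_(a, b <- x) \Delta_(c, d <- y) f (a * c) (b * d).
Proof.
move=> bf; rewrite /sw comulM; move: (comul x); apply: tens_ext => [||a b].
- exact: lin_comp (tlift_linear bf) (tens_mul_linl (comul y)).
- by lin.
move: (comul y); apply: tens_ext => [||c d].
- exact: lin_comp (tlift_linear bf) (tens_mul_linr _).
- by lin.
by rewrite tens_mulE !tliftE //; lin.
Qed.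

End Sweedler.

Section Antipode.
Variables (k : fieldType) (H : hopfAlgebra k).
Notation S := (@antipode k H).
Implicit Types (x y : H).

Lemma sw_antil (U : lmodType k) (f : H -> U) x : linear f ->
  \Delta_(a, b <- x) f (S a * b) = (counit x : k) *: f 1.
Proof. by move=> lf; rewrite -(linZ lf) -antipode_mul (tlift_comp _ _ lf). Qed.

Lemma sw_antir (U : lmodType k) (f : H -> U) x : linear f ->
  \Delta_(a, b <- x) f (a * S b) = (counit x : k) *: f 1.
Proof. by move=> lf; rewrite -(linZ lf) -mul_antipode (tlift_comp _ _ lf). Qed.

Lemma antipode1 : S 1 = 1.
Proof.
have := sw_antil 1 (@lin_id _ H); rewrite sw1 ?mulr1; last by lin.
by rewrite counit1 scale1r.
Qed.

Lemma counit_antipode x : counit (S x) = counit x.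
Proof.
rewrite -[LHS](sw_counitr x (f := fun a => counit (S a))); last by lin.
transitivity (\Delta_(a, b <- x) (counit (S a * b) : k^o)).
  by apply: eq_sw => a b; rewrite counitM mulrC.
rewrite (sw_antil x (f := counit)); last by lin.
by rewrite counit1 [_ *: _]mulr1.
Qed.

(** Both [S (x * y)] and [S y * S x] are convolution inverses of the
    multiplication.  Accordingly the sum [E] of
    [S (x_1 y_1) x_2 y_2 S y_3 S x_3] collapses to the one or to the other,
    depending on which antipode is cancelled first. *)
Lemma antipodeM x y : S (x * y) = S y * S x.
Proof.
pose E := \Delta_(a, b <- x) \Delta_(c, d <- y) \Delta_(p, q <- b) \Delta_(r, s <- d)
  (S (a * c) * (p * r * (S s * S q))).
transitivity E.
  transitivity (\Delta_(a, b <- x) \Delta_(c, d <- y)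
      ((counit b : k) *: ((counit d : k) *: S (a * c)))).
    under eq_sw => a b.
      rewrite (_ : sw _ _ = (counit b : k) *: S (a * y)); first over.
      rewrite -(sw_comp (fun c d => (counit d : k) *: S (a * c))); last by lin.
      by rewrite (sw_counitr y (f := fun c => S (a * c))); last by lin.
    by rewrite (sw_counitr x (f := fun a => S (a * y))); last by lin.
  apply: eq_sw => a b; apply: eq_sw => c d.
  transitivity (\Delta_(p, q <- b) ((counit d : k) *: (S (a * c) * (p * S q)))).
    by rewrite (sw_antir b (f := fun z => (counit d : k) *: (S (a * c) * z))) ?mulr1 //; lin.
  apply: eq_sw => p q.
  rewrite -[p in LHS]mulr1.
  rewrite -(sw_antir d (f := fun z => S (a * c) * (p * z * S q))); last by lin.
  by apply: eq_sw => r s; rewrite !mulrA.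
rewrite /E; under eq_sw => a b do rewrite sw_exchange.
rewrite -(swA (f := fun a p q => \Delta_(c, d <- y) \Delta_(r, s <- d)
  (S (a * c) * (p * r * (S s * S q))))); try by move=> *; lin.
transitivity (\Delta_(a, b <- x) \Delta_(c, d <- y)
  ((counit a : k) *: ((counit c : k) *: (S d * S b)))); last first.
  transitivity (\Delta_(a, b <- x) ((counit a : k) *: (S y * S b))); last first.
    by rewrite (sw_counitl x (f := fun b => S y * S b)); last by lin.
  apply: eq_sw => a b; rewrite -(sw_comp (fun c d => (counit c : k) *: (S d * S b))); last by lin.
  by rewrite (sw_counitl y (f := fun d => S d * S b)); last by lin.
apply: eq_sw => a b.
transitivity (\Delta_(p, q <- a) \Delta_(c, d <- y) \Delta_(r, s <- c)
  (S (p * r) * (q * s * (S d * S b)))).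
  apply: eq_sw => p q; apply/esym.
  by apply: (swA (f := fun c r s => S (p * c) * (q * r * (S s * S b)))) => *; lin.
rewrite sw_exchange; apply: eq_sw => c d.
rewrite -(swM (f := fun u v => S u * (v * (S d * S b)))); last by lin.
under eq_sw => u v do rewrite mulrA.
rewrite (sw_antil (a * c) (f := fun z => z * (S d * S b))); last by lin.
by rewrite mul1r scalerA counitM.
Qed.

End Antipode.

Section Translation.
Variables (k : fieldType) (H : hopfAlgebra k).
Notation S := (@antipode k H).

(** In Sweedler notation [(a_1 b)_1 ⊗ S (a_1 b)_2 a_2 = a b_1 ⊗ S b_2]: the map
    [b |-> b_1 ⊗ S b_2] is compatible with multiplication by [a].  This makes
    the trace below an integral, and is inherited by the translation maps of
    the quotients of [H]. *)
Lemma sw_translation (U : lmodType k) (F : H -> H -> U) a b : bilin F ->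
  \Delta_(a1, a2 <- a) \Delta_(p, q <- a1 * b) F p (S q * a2) =
  \Delta_(p, q <- b) F (a * p) (S q).
Proof.
move=> bF.
transitivity (\Delta_(a1, a2 <- a) \Delta_(r, s <- a1) \Delta_(p, q <- b)
    F (r * p) (S q * (S s * a2))).
  apply: eq_sw => a1 a2; rewrite (swM (f := fun p q => F p (S q * a2))); last by lin.
  by apply: eq_sw => r s; apply: eq_sw => p q; rewrite antipodeM !mulrA.
rewrite (swA (f := fun r s t => \Delta_(p, q <- b) F (r * p) (S q * (S s * t)))) => *;
  try by lin.
transitivity (\Delta_(a1, a2 <- a) ((counit a2 : k) *: \Delta_(p, q <- b) F (a1 * p) (S q))).
  apply: eq_sw => a1 a2.
  rewrite (sw_antil _ (f := fun z => \Delta_(p, q <- b) F (a1 * p) (S q * z))).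
    by congr (_ *: _); apply: eq_sw => p q; rewrite mulr1.
  by lin.
by rewrite (sw_counitr a (f := fun z => \Delta_(p, q <- b) F (z * p) (S q))) //; lin.
Qed.

End Translation.

(** * Integrals and bijectivity of the antipode *)

Section FiniteHopf.
Variables (k : fieldType) (H : hopfAlgebra k).
Hypothesis fH : finite_dim H.
Notation S := (@antipode k H).

Definition left_integral (l : H) : Prop := forall a, a * l = (counit a : k) *: l.

Section Trace.
Variable b : basis H.
Notation e := (bvec b).
Notation c := (coord b).

(** The cyclicity of the trace, for a family [T f u] depending linearly on a
    functional [f] and a vector [u]; the sum over the dual bases [c], [e] is a
    trace with values in [U]. *)
Lemma trace_cyclic (U : lmodType k) (T : (H -> k^o) -> H -> U) (P : H -> H) :
  linear P -> (forall i, linear (T (c i))) ->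
  (forall a : 'I_(bdim b) -> k,
     T (fun x => \sum_l a l *: c l x) =1 fun u => \sum_l a l *: T (c l) u) ->
  \sum_i T (c i) (P (e i)) = \sum_i T (fun x => c i (P x)) (e i).
Proof.
move=> lP lT Tsum.
transitivity (\sum_i \sum_j (c j (P (e i)) : k) *: T (c i) (e j)).
  apply: eq_bigr => i _; rewrite {1}(coord_sum b (P (e i))) (lin_sum (lT i)).
  by apply: eq_bigr => j _; rewrite (linZ (lT i)).
rewrite exchange_big; apply: eq_bigr => i _ /=.
rewrite -Tsum; congr (T _ _); apply/funext => x.
rewrite {2}(coord_sum b x) (lin_sum lP) (lin_sum (coord_linear b i)).
apply: eq_bigr => l _; rewrite (linZ lP) (linZ (coord_linear b i)).
by rewrite [LHS]mulrC.
Qed.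

(** On [H ⊗ H^*], the diagonal action, where [a] sends a functional [f] to
    [f (_ * a)], becomes the action on the first factor alone after the
    substitution [h ⊗ f |-> h_1 ⊗ S h_2 f].  The antipode, seen as an element of
    [H ⊗ H^*], is invariant for the diagonal action, so the values of its image
    are left integrals.  [trace_integral (S x)] is the value at [x], and the
    formula makes sense with any [y] in place of [S x]. *)
Definition trace_integral (y : H) : H :=
  \sum_i \Delta_(p, q <- e i) ((c i (S (S q) * y) : k) *: p).

Lemma trace_integralP y : left_integral (trace_integral y).
Proof.
have lc i : linear (c i) by exact: coord_linear.
move=> a.
transitivity (\sum_i \Delta_(a1, a2 <- a) \Delta_(p, q <- a1 * e i)
    ((c i (S a2 * (S (S q) * y)) : k) *: p)).
  rewrite /trace_integral mulr_sumr; apply: eq_bigr => i _.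
  rewrite (sw_comp (fun p q => (c i (S (S q) * y) : k) *: p) (g := fun z => a * z)); last by lin.
  transitivity (\Delta_(p, q <- e i) ((c i (S (S q) * y) : k) *: (a * p))).
    by apply: eq_sw => p q; rewrite scalerAr.
  rewrite -(@sw_translation _ _ _ (fun p z => (c i (S z * y) : k) *: p)); last by lin.
  apply: eq_sw => a1 a2; apply: eq_sw => p q; by rewrite antipodeM mulrA.
transitivity (\Delta_(a1, a2 <- a) \sum_i \Delta_(p, q <- e i)
    ((c i (a1 * S a2 * (S (S q) * y)) : k) *: p)).
  rewrite sw_sum; apply: eq_sw => a1 a2.
  pose T (f : H -> k^o) u :=
    \Delta_(p, q <- u) ((f (S a2 * (S (S q) * y)) : k) *: p).
  rewrite -[LHS]/(\sum_i T (c i) (a1 * e i)) trace_cyclic //.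
  - by apply: eq_bigr => i _; apply: eq_sw => p q; rewrite !mulrA.
  - by lin.
  - by rewrite /T => i; lin.
  - move=> g u; transitivity (\sum_l \Delta_(p, q <- u)
        (g l *: ((c l (S a2 * (S (S q) * y)) : k) *: p))).
      rewrite sw_sum; apply: eq_sw => p q; rewrite scaler_suml.
      by apply: eq_bigr => l _; rewrite scalerA.
    by apply: eq_bigr => l _; rewrite -sw_comp //; lin.
rewrite -sw_sum scaler_sumr; apply: eq_bigr => i _.
rewrite sw_exchange.
rewrite (sw_comp (fun p q => (c i (S (S q) * y) : k) *: p)
  (g := fun z => (counit a : k) *: z)); last by lin.
apply: eq_sw => p q.
by rewrite (sw_antir a (f := fun z => (c i (z * (S (S q) * y)) : k) *: p)) ?mul1r //; lin.
Qed.

(** The substitution of [trace_integral] is invertible: applying the coproduct,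
    taking [y = S (e j)] and contracting the second leg with [c j] leads from
    the elements [trace_integral y] back to [1]. *)
Lemma trace_integral_neq0 : exists y, trace_integral y <> 0.
Proof.
have lc i : linear (c i) by exact: coord_linear.
apply: contrapT => h; have {h} Z y : trace_integral y = 0.
  by apply: contrapT => nz; apply: h; exists y.
suff : (1 : H) = 0 by apply/eqP; exact: oner_neq0.
transitivity (\sum_j \Delta_(r, s <- trace_integral (S (e j))) ((c j s : k) *: r)); last first.
  rewrite big1 // => j _; rewrite Z.
  by apply: (@lin0 _ H H (fun x => \Delta_(r, s <- x) ((c j s : k) *: r))); lin.
transitivity (\sum_j \sum_i \Delta_(p, q <- e i) \Delta_(r, s <- p)
    ((c i (S (S q) * S (e j)) : k) *: ((c j s : k) *: r))); last first.
  apply: eq_bigr => j _.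
  have l : linear (fun x => \Delta_(r, s <- x) ((c j s : k) *: r)) by lin.
  rewrite (lin_sum l); apply: eq_bigr => i _; rewrite (sw_comp _ _ l).
  apply: eq_sw => p q; rewrite (linZ l).
  by rewrite -(sw_comp (fun r s => (c j s : k) *: r) _
    (g := fun z => (c i (S (S q) * S (e j)) : k) *: z)); last by lin.
rewrite exchange_big /= [LHS](coord_sum b); apply: eq_bigr => i _.
transitivity (\Delta_(p, q <- e i) \Delta_(r, s <- p) ((c i (S (S q) * S s) : k) *: r)); last first.
  rewrite sw_sum; apply: eq_sw => p q; rewrite sw_sum; apply: eq_sw => r s.
  have l : linear (fun z => (c i (S (S q) * S z) : k) *: r) by lin.
  rewrite {1}(coord_sum b s) (lin_sum l); apply: eq_bigr => j _.
  by rewrite (linZ l) !scalerA mulrC.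
rewrite (swA (f := fun r s q => (c i (S (S q) * S s) : k) *: r)) => *; try by lin.
rewrite -(sw_counitr (e i) (f := fun r => (c i 1 : k) *: r)); last by lin.
apply: eq_sw => r s; under eq_sw => p q do rewrite -antipodeM.
by rewrite (sw_antir s (f := fun z => (c i (S z) : k) *: r)) ?antipode1 //; lin.
Qed.

End Trace.

Lemma exists_left_integral : exists l, left_integral l /\ l <> 0.
Proof.
have [b] := exists_basis fH; have [y ny] := trace_integral_neq0 b.
by exists (trace_integral b y); split=> //; exact: trace_integralP.
Qed.

(** In Sweedler notation [l_1 ⊗ a l_2 = S a l_1 ⊗ l_2]: the left-hand side is
    [S a_1 (a_2 l)_1 ⊗ (a_2 l)_2], and [a_2 l] is [l] times the counit
    of [a_2]. *)
Lemma left_integral_shift l (U : lmodType k) (F : H -> H -> U) a :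
  left_integral l -> bilin F ->
  \Delta_(p, q <- l) F p (a * q) = \Delta_(p, q <- l) F (S a * p) q.
Proof.
move=> il bF.
transitivity (\Delta_(a1, a2 <- a) \Delta_(p, q <- a2 * l) F (S a1 * p) q); last first.
  transitivity (\Delta_(a1, a2 <- a) ((counit a2 : k) *: \Delta_(p, q <- l) F (S a1 * p) q)).
    apply: eq_sw => a1 a2; rewrite il.
    by apply: (@linZ _ _ _ (fun x => \Delta_(p, q <- x) F (S a1 * p) q)); lin.
  by rewrite (sw_counitr a (f := fun z => \Delta_(p, q <- l) F (S z * p) q)) //; lin.
transitivity (\Delta_(a1, a2 <- a) \Delta_(r, s <- a2) \Delta_(p, q <- l)
    F (S a1 * r * p) (s * q)); last first.
  apply: eq_sw => a1 a2; rewrite (swM (f := fun p q => F (S a1 * p) q)); last by lin.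
  by apply: eq_sw => r s; apply: eq_sw => p q; rewrite mulrA.
rewrite -(swA (f := fun a1 r s => \Delta_(p, q <- l) F (S a1 * r * p) (s * q))) => *; try by lin.
transitivity (\Delta_(a1, a2 <- a) ((counit a1 : k) *: \Delta_(p, q <- l) F p (a2 * q))).
  by rewrite (sw_counitl a (f := fun z => \Delta_(p, q <- l) F p (z * q))) //; lin.
apply: eq_sw => a1 a2.
rewrite (sw_antil a1 (f := fun z => \Delta_(p, q <- l) F (z * p) (a2 * q))); last by lin.
by congr (_ *: _); apply: eq_sw => p q; rewrite mul1r.
Qed.

(** Choose a functional [g] with [g l] nonzero.  Then [g l *: a] is the sum of
    [a * Q l_1 * l_2], where [Q p] is the sum of [g p_1 *: S p_2].  After
    expanding [Q l_1] in a basis, each factor [a * e] standing before [l_2] can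
    be moved by [left_integral_shift] to the first leg, where it becomes
    [S (a * e) = S e * S a = 0]. *)
Lemma antipode_eq0 a : S a = 0 -> a = 0.
Proof.
move=> Sa; have [l [il nl]] := exists_left_integral.
have [b] := exists_basis fH.
have [i0 gl] : exists i, coord b i l != 0.
  apply: contrapT => h; apply: nl; apply: (coord_eq (b := b)) => i.
  rewrite (lin0 (coord_linear b i)).
  by apply/eqP; apply: contrapT => /negP nz; apply: h; exists i.
pose g := coord b i0; have lg : linear g by exact: coord_linear.
have lc i : linear (coord b i) by exact: coord_linear.
pose Q p : H := \Delta_(r, s <- p) ((g r : k) *: S s).
have lQ : linear Q by rewrite /Q; lin.
suff : (g l : k) *: a = 0 by move/eqP; rewrite scaler_eq0 (negPf gl) => /eqP.
transitivity (\Delta_(p, q <- l) (a * Q p * q)).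
  transitivity (\Delta_(p, q <- l) \Delta_(r, s <- p) ((g r : k) *: (a * S s * q))); last first.
    apply: eq_sw => p q; have l' : linear (fun z => a * z * q) by lin.
    rewrite /Q (sw_comp _ _ l').
    by apply: eq_sw => r s; rewrite -scalerAr scalerAl.
  rewrite (swA (f := fun r s q => (g r : k) *: (a * S s * q))) => *; try by lin.
  rewrite -(sw_counitr l (f := fun z => (g z : k) *: a)); last by lin.
  apply: eq_sw => r s; under [RHS]eq_sw => u v do rewrite -mulrA.
  by rewrite (sw_antil s (f := fun z => (g r : k) *: (a * z))) ?mulr1 //; lin.
transitivity (\sum_i \Delta_(p, q <- l) ((coord b i (Q p) : k) *: (a * bvec b i * q))).
  rewrite sw_sum; apply: eq_sw => p q; rewrite {1}(coord_sum b (Q p)) mulr_sumr mulr_suml.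
  by apply: eq_bigr => i _; rewrite -scalerAr -scalerAl.
rewrite big1 // => i _.
rewrite (@left_integral_shift l _ (fun p q => (coord b i (Q p) : k) *: q)) //; last by lin.
rewrite antipodeM Sa mulr0.
rewrite (eq_sw (g := fun p q => 0)); last first.
  by move=> p q; rewrite mul0r (lin0 lQ) (lin0 (lc i)) scale0r.
by rewrite /sw /tlift /fsum_eval big1.
Qed.

Lemma antipode_bijective : exists g : H -> H,
  [/\ linear g, cancel S g & cancel g S].
Proof. by apply: linear_inj_surj => //; [lin | exact: antipode_eq0]. Qed.

End FiniteHopf.

(** * Dual modules and rigidity *)

Section DualSpace.
Variables (k : fieldType) (V : lmodType k).

Definition dual_pred : {pred (V -> k^o)} := fun f => `[< linear f >].

Record dual := Dual { dual_fun :> V -> k^o; dualP : dual_fun \in dual_pred }.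

HB.instance Definition _ := [isSub for dual_fun].
HB.instance Definition _ := [Choice of dual by <:].

Lemma dual_submod_closed : submod_closed dual_pred.
Proof.
split=> [|c f g /asboolP lf /asboolP lg]; apply/asboolP => a u v.
  by rewrite /= scaler0 addr0.
by rewrite !fctE /= lf lg !scalerDr !scalerA addrACA [c * a]mulrC.
Qed.

HB.instance Definition _ :=
  GRing.isSubmodClosed.Build k (V -> k^o) dual_pred dual_submod_closed.
HB.instance Definition _ := [SubChoice_isSubLmodule of dual by <:].

Lemma dual_ext (f g : dual) : f =1 g -> f = g.
Proof. by move=> h; apply: val_inj; apply/funext. Qed.

Lemma dual_linear (f : dual) : linear f.
Proof. by have /asboolP := dualP f. Qed.

Definition mk_dual (f : V -> k^o) (lf : linear f) : dual := Dual (introT (asboolP _) lf).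

Lemma dual_eval_bilin : bilin (fun (f : dual) (v : V) => f v).
Proof. by split=> [v a f g | f] //; exact: dual_linear. Qed.

Definition dual_coord (b : basis V) i : dual := mk_dual (coord_linear b i).

Arguments dual_coord : clear implicits.

Lemma dual_coord_sum (b : basis V) (f : dual) :
  f = \sum_i (f (bvec b i) : k) *: dual_coord b i.
Proof.
apply: dual_ext => v; rewrite {1}(coord_sum b v) (lin_sum (dual_linear f)).
have l : linear (fun f : dual => f v) by exact: (proj1 dual_eval_bilin).
rewrite (lin_sum l (index_enum _) (fun i => (f (bvec b i) : k) *: dual_coord b i)).
by apply: eq_bigr => i _; rewrite (linZ (dual_linear f)) (linZ l) [LHS]mulrC.
Qed.

Lemma scale_eval_bilin (W : lmodType k) v : bilin (fun (w : W) (f : dual) => (f v : k) *: w).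
Proof.
split=> z; first exact: lin_scaler (@lin_id _ _).
exact: lin_scalel (proj1 dual_eval_bilin v).
Qed.

Lemma eval_scale_bilin (W : lmodType k) v : bilin (fun (f : dual) (w : W) => (f v : k) *: w).
Proof.
split=> z; last exact: lin_scaler (@lin_id _ _).
exact: lin_scalel (proj1 dual_eval_bilin v).
Qed.

Lemma tens_dual_eq (W : lmodType k) (t u : tensor W dual) : finite_dim V ->
  (forall v, tlift (fun w (f : dual) => (f v : k) *: w) t =
             tlift (fun w (f : dual) => (f v : k) *: w) u) -> t = u.
Proof.
move=> /exists_basis [b] h.
have bev := scale_eval_bilin W.
have E (x : tensor W dual) :
    x = \sum_i tlift (fun w (f : dual) => (f (bvec b i) : k) *: w) x ⊗ dual_coord b i.
  move: x; apply: tens_ext => [||w f].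
  - exact: lin_id.
  - by apply: lin_big => i; apply: tens_linl; exact: (tlift_linear (bev _)).
  rewrite {1}(dual_coord_sum b f) (lin_sum (proj2 (tens_bilin _ _) w)).
  by apply: eq_bigr => i _; rewrite (tliftE _ _ (bev _)) tensZr tensZl.
by rewrite (E t) (E u); apply: eq_bigr => i _; rewrite h.
Qed.

Lemma dual_tens_eq (W : lmodType k) (t u : tensor dual W) : finite_dim V ->
  (forall v, tlift (fun (f : dual) w => (f v : k) *: w) t =
             tlift (fun (f : dual) w => (f v : k) *: w) u) -> t = u.
Proof.
move=> /exists_basis [b] h.
have bev := eval_scale_bilin W.
have E (x : tensor dual W) :
    x = \sum_i dual_coord b i ⊗ tlift (fun (f : dual) w => (f (bvec b i) : k) *: w) x.
  move: x; apply: tens_ext => [||f w].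
  - exact: lin_id.
  - by apply: lin_big => i; apply: tens_linr; exact: (tlift_linear (bev _)).
  rewrite {1}(dual_coord_sum b f) (lin_sum (proj1 (tens_bilin _ _) w)).
  by apply: eq_bigr => i _; rewrite (tliftE _ _ (bev _)) tensZr tensZl.
by rewrite (E t) (E u); apply: eq_bigr => i _; rewrite h.
Qed.

Lemma finite_dim_dual : finite_dim V -> finite_dim dual.
Proof.
move=> /exists_basis [b]; exists (bdim b), (dual_coord b) => f.
by exists (fun i => f (bvec b i)); exact: dual_coord_sum.
Qed.

End DualSpace.

Arguments dual_coord {k V} b i.

Lemma id_functor_equivalence (k : fieldType) (C : linCat k) : is_equivalence (id_functor C).
Proof.
exists (id_functor C); split; exists (fun X => idm _ X); split=> [X|X Y f].
- by exists (idm _ X); split; exact: comp_idl.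
- by rewrite comp_idl comp_idr.
- by exists (idm _ X); split; exact: comp_idl.
- by rewrite comp_idl comp_idr.
Qed.

Lemma fdmod_finite_cat (k : fieldType) (A : algType k) :
  finite_dim A -> finite_cat (fdmod_cat A).
Proof.
by move=> fA; exists A; split=> //; exists (id_functor _); exact: id_functor_equivalence.
Qed.

Section Rigidity.
Variables (k : fieldType).

Lemma tensmod_act_tens (B : bialgebra k) (A : comodAlgebra B) (V : fdmod B)
    (W : fdmod A) (a : A) (v : V) (w : W) :
  act a (v ⊗ w : tensmod V W) = tlift (fun p q => act p v ⊗ act q w) (coact a).
Proof.
rewrite tensmod_actE; move: (coact a); apply: tens_ext => [||p q].
- exact: (proj1 (tact_bilin V W)).
- by have h1 := act_bilin V; have h2 := act_bilin W; lin.
by rewrite tactE tliftE //; have h1 := act_bilin V; have h2 := act_bilin W; lin.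
Qed.

Variables (H : hopfAlgebra k).
Hypothesis fH : finite_dim H.
Notation S := (@antipode k H).

(** Left and right duals arise from the same construction, with the two modules
    exchanged: an invariant pairing with dual families. *)
Section DualPair.
Variables (Y X : fdmod H) (pair : Y -> X -> k^o) (n : nat) (x : 'I_n -> X) (y : 'I_n -> Y).
Hypothesis pair_bilin : bilin pair.
Hypothesis pair_act : forall a v w,
  \Delta_(p, q <- a) pair (act p v) (act q w) = (counit a : k) *: pair v w.
Hypothesis copair_act : forall a,
  \sum_i \Delta_(p, q <- a) act p (x i) ⊗ act q (y i) =
  (counit a : k) *: \sum_i x i ⊗ y i.
Hypothesis sumx : forall v, \sum_i (pair (y i) v : k) *: x i = v.
Hypothesis sumy : forall w, \sum_i (pair w (x i) : k) *: y i = w.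

Notation tmod V W := (tensmod (A := regular_comod H) V W : fdmod H).

Let evl : linear (tlift pair : tmod Y X -> unitmod H).
Proof. exact: tlift_linear. Qed.

Let ev_act a (t : tmod Y X) :
  (tlift pair (act a t) : unitmod H) = act a (tlift pair t : unitmod H).
Proof.
have lact := proj2 (act_bilin (tmod Y X)) a.
have lact' := proj2 (act_bilin (unitmod H)) a.
move: t; apply: tens_ext => [||v w].
- exact: lin_comp evl lact.
- exact: lin_comp lact' evl.
rewrite tliftE // (@tensmod_act_tens H (regular_comod H)) (tlift_comp _ _ evl).
by rewrite -[RHS]pair_act; apply: eq_tlift => p q; rewrite tliftE.
Qed.

Let ev : fdhom (tmod Y X) (unitmod H) := mk_fdhom evl ev_act.

Let copair : tmod X Y := \sum_i x i ⊗ y i.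

Let coevl : linear (fun c : unitmod H => (c : k) *: copair).
Proof. by move=> a u v; rewrite scalerDl scalerA. Qed.

Let coev_act a (c : unitmod H) : ((act a c : k) *: copair) = act a ((c : k) *: copair).
Proof.
have lact := proj2 (act_bilin (tmod X Y)) a.
rewrite (linZ lact) (lin_sum lact).
transitivity ((c : k) *: \sum_i \Delta_(p, q <- a) act p (x i) ⊗ act q (y i)).
  by rewrite copair_act scalerA mulrC -scalerA.
congr (_ *: _); apply: eq_bigr => i _; apply/esym.
exact: (@tensmod_act_tens H (regular_comod H)).
Qed.

Let coev : fdhom (unitmod H) (tmod X Y) := mk_fdhom coevl coev_act.

Lemma dual_pair_left_dual : is_left_dual (C := fdmod_monCat H) Y X.
Proof.
have [ai [ai1 ai2]] := massoc_iso (m := fdmod_monCat H) Y X Y.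
have aiE (u : Y) (v : X) (w : Y) : (ai : fdhom _ _) (u ⊗ (v ⊗ w)) = u ⊗ v ⊗ w.
  have := congr1 (fun f : fdhom (tmod (tmod Y X) Y) (tmod (tmod Y X) Y) =>
    f (u ⊗ v ⊗ w)) ai1.
  by rewrite /= tassocE.
have evE u v : ev (u ⊗ v) = pair u v by rewrite /= tliftE.
exists ev, coev, ai; split=> //.
- apply: (@tensmod_ext _ H (regular_comod H) (unitmod H) X X) => c v.
  pose G := fdhom_comp (tensmod_runit X)
    (fdhom_comp (tmap_B (fdhom_id X) ev) (assoc_B X Y X)).
  transitivity (G (coev c ⊗ v)); first by rewrite -(tmap_BE coev (fdhom_id X)).
  have lG : linear (fun t : tmod X Y => G (t ⊗ v)).
    exact: lin_comp (fdhom_linear G) (proj1 (tens_bilin _ _) v).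
  rewrite (linZ lG) (lin_sum lG) [RHS](@tensmod_lunitE _ H (regular_comod H)).
  congr (_ *: _); rewrite -[RHS]sumx; apply: eq_bigr => i _.
  by rewrite !fdhom_compE assoc_BE tmap_BE tensmod_runitE evE.
- apply: (@tensmod_ext _ H (regular_comod H) Y (unitmod H) Y) => u c.
  pose G := fdhom_comp (tensmod_lunit (A := regular_comod H) Y)
    (fdhom_comp (tmap_B ev (fdhom_id Y)) (ai : fdhom (tmod Y (tmod X Y)) (tmod (tmod Y X) Y))).
  transitivity (G (u ⊗ coev c)); first by rewrite -(tmap_BE (fdhom_id Y) coev).
  have lG : linear (fun t : tmod X Y => G (u ⊗ t)).
    exact: lin_comp (fdhom_linear G) (proj2 (tens_bilin _ _) u).
  rewrite (linZ lG) (lin_sum lG) [RHS]tensmod_runitE.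
  congr (_ *: _); rewrite -[RHS]sumy; apply: eq_bigr => i _.
  by rewrite !fdhom_compE aiE tmap_BE (@tensmod_lunitE _ H (regular_comod H)) evE.
Qed.

End DualPair.

(** The anti-endomorphism [s] is the antipode for left duals and its inverse for
    right duals. *)
Section DualModule.
Variables (s : H -> H) (X : fdmod H).
Hypotheses (ls : linear s) (s1 : s 1 = 1) (sM : forall a b, s (a * b) = s b * s a).

Lemma dual_act_linear a (f : dual X) : linear (fun v => f (act (s a) v)).
Proof. exact: lin_comp (dual_linear f) (proj2 (act_bilin X) _). Qed.

Definition dualmod : fdmod H.
Proof.
refine (@FDMod k H (dual X) (fun a f => mk_dual (dual_act_linear a f)) _ _ _ _).
- split=> [f a u v|a c f g]; apply: dual_ext => w //=.
  rewrite ls (proj1 (act_bilin X)); exact: dual_linear.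
- by move=> f; apply: dual_ext => v /=; rewrite s1 act1.
- by move=> a b f; apply: dual_ext => v /=; rewrite sM actM.
- exact: finite_dim_dual (fdmod_finite X).
Defined.

End DualModule.

Lemma left_dual_antipode (X : fdmod H) : exists Y, is_left_dual (C := fdmod_monCat H) Y X.
Proof.
have ls : linear S by lin.
have [b] := exists_basis (fdmod_finite X).
pose Y := dualmod X ls (antipode1 H) (@antipodeM _ H).
have hX := act_bilin X.
exists Y.
refine (@dual_pair_left_dual Y X (fun f v => (f : dual X) v) _ (bvec b) (dual_coord b) _ _ _ _ _).
- exact: dual_eval_bilin.
- move=> a f v; have lf := dual_linear f.
  transitivity (\Delta_(p, q <- a) (f : dual X) (act (S p * q) v)).
    by apply: eq_sw => p q; rewrite actM.
  by rewrite (sw_antil a (f := fun z => (f : dual X) (act z v))) ?act1 //; lin.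
- move=> a; apply: tens_dual_eq => [|v]; first exact: fdmod_finite.
  have bev := @scale_eval_bilin _ X X v.
  have lev := tlift_linear bev.
  rewrite (lin_sum lev) (linZ lev) (lin_sum lev).
  transitivity (\sum_i \Delta_(p, q <- a) ((coord b i (act (S q) v) : k) *: act p (bvec b i))).
    by apply: eq_bigr => i _; rewrite (sw_comp _ _ lev); apply: eq_sw => p q; rewrite tliftE.
  rewrite sw_sum.
  transitivity (\Delta_(p, q <- a) act (p * S q) v).
    apply: eq_sw => p q; rewrite actM [in RHS](coord_sum b (act (S q) v)).
    rewrite (lin_sum (proj2 hX p)); apply: eq_bigr => i _.
    by rewrite (linZ (proj2 hX p)).
  rewrite (sw_antir a (f := fun z => act z v)) ?act1; last by lin.
  by congr (_ *: _); rewrite {1}(coord_sum b v); apply: eq_bigr => i _; rewrite tliftE.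
- by move=> v; rewrite [RHS](coord_sum b v).
- by move=> f; rewrite [RHS](dual_coord_sum b f).
Qed.

(** The inverse [s] of the antipode satisfies the antipode identities with the
    two legs of the coproduct exchanged, as one sees by applying the antipode to
    both sides. *)
Lemma right_dual_antipode (X : fdmod H) : exists Y, is_left_dual (C := fdmod_monCat H) X Y.
Proof.
have [s [ls sK Ks]] := antipode_bijective fH.
have s1 : s 1 = 1 by apply: (can_inj sK); rewrite Ks antipode1.
have sM a c : s (a * c) = s c * s a by apply: (can_inj sK); rewrite Ks antipodeM !Ks.
have sw_sl (U : lmodType k) (F : H -> U) a : linear F ->
    \Delta_(p, q <- a) F (s q * p) = (counit a : k) *: F 1.
  move=> lF; transitivity (\Delta_(p, q <- a) F (s (S p * q))).
    by apply: eq_sw => p q; rewrite sM sK.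
  by rewrite (sw_antil a (f := fun z => F (s z))) ?s1 //; lin.
have sw_sr (U : lmodType k) (F : H -> U) a : linear F ->
    \Delta_(p, q <- a) F (q * s p) = (counit a : k) *: F 1.
  move=> lF; transitivity (\Delta_(p, q <- a) F (s (p * S q))).
    by apply: eq_sw => p q; rewrite sM sK.
  by rewrite (sw_antir a (f := fun z => F (s z))) ?s1 //; lin.
have [b] := exists_basis (fdmod_finite X).
pose Y := dualmod X ls s1 sM.
have hX := act_bilin X.
exists Y.
refine (@dual_pair_left_dual X Y (fun v f => (f : dual X) v) _ (dual_coord b) (bvec b) _ _ _ _ _).
- by have [h1 h2] := dual_eval_bilin X; split=> ?; [exact: h2 | exact: h1].
- move=> a v f; have lf := dual_linear f.
  transitivity (\Delta_(p, q <- a) (f : dual X) (act (s q * p) v)).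
    by apply: eq_sw => p q; rewrite actM.
  by rewrite (sw_sl _ (fun z => (f : dual X) (act z v))) ?act1 //; lin.
- move=> a; apply: dual_tens_eq => [|v]; first exact: fdmod_finite.
  have bev := @eval_scale_bilin _ X X v.
  have lev := tlift_linear bev.
  rewrite (lin_sum lev) (linZ lev) (lin_sum lev).
  transitivity (\sum_i \Delta_(p, q <- a) ((coord b i (act (s p) v) : k) *: act q (bvec b i))).
    by apply: eq_bigr => i _; rewrite (sw_comp _ _ lev); apply: eq_sw => p q; rewrite tliftE.
  rewrite sw_sum.
  transitivity (\Delta_(p, q <- a) act (q * s p) v).
    apply: eq_sw => p q; rewrite actM [in RHS](coord_sum b (act (s p) v)).
    rewrite (lin_sum (proj2 hX q)); apply: eq_bigr => i _.
    by rewrite (linZ (proj2 hX q)).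
  rewrite (sw_sr _ (fun z => act z v)) ?act1; last by lin.
  by congr (_ *: _); rewrite {1}(coord_sum b v); apply: eq_bigr => i _; rewrite tliftE.
- by move=> f; rewrite [RHS](dual_coord_sum b f).
- by move=> v; rewrite [RHS](coord_sum b v).
Qed.

Theorem finite_hopf_rigid : rigid (fdmod_monCat H).
Proof. by move=> X; split; [exact: left_dual_antipode | exact: right_dual_antipode]. Qed.

Theorem finite_hopf_tensor_cat : finite_tensor_cat (fdmod_monCat H).
Proof.
split; [ | exact: finite_hopf_rigid | ].
  exact: fdmod_finite_cat.
split.
  move=> /(congr1 (fun f : fdhom (unitmod H) (unitmod H) => f 1)) /= /eqP.
  by apply/negP; exact: oner_neq0.
move=> f; exists ((f : fdhom (unitmod H) (unitmod H)) 1); apply: fdhom_ext => c.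
rewrite -[c in LHS]mulr1 (linZ (fdhom_linear f)).
exact: mulrC.
Qed.

End Rigidity.

(** * Epimorphisms and free modules *)

Section LinearLifting.
Variable k : fieldType.

Lemma linear_lift (V X Y : lmodType k) (f : X -> Y) (g : V -> Y) :
  finite_dim V -> linear f -> linear g -> (forall y, exists x, f x = y) ->
  exists2 h : V -> X, linear h & forall v, f (h v) = g v.
Proof.
move=> /exists_basis [b] lf lg /choice [r fr].
exists (fun v => \sum_i (coord b i v : k) *: r (g (bvec b i))) => [|v].
  by apply: lin_big => i; apply: lin_scalel; exact: coord_linear.
rewrite (lin_sum lf) [in RHS](coord_sum b v) (lin_sum lg).
by apply: eq_bigr => i _; rewrite (linZ lf) fr (linZ lg).
Qed.

Lemma separate_image (X Y : lmodType k) (f : X -> Y) y0 :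
  finite_dim X -> finite_dim Y -> linear f -> (forall x, f x <> y0) ->
  exists l : Y -> k^o, [/\ linear l, forall x, l (f x) = 0 & l y0 <> 0].
Proof.
move=> /exists_basis [b] /exists_basis [c] lf ny.
pose v2r y : 'rV[k]_(bdim c) := \row_i coord c i y.
have lv : linear v2r.
  by move=> a u v; apply/rowP => i; rewrite !mxE (coord_linear c i).
pose M : 'M[k]_(bdim b, bdim c) := \matrix_i v2r (f (bvec b i)).
have fM x : v2r (f x) = (\row_i coord b i x) *m M.
  rewrite {1}(coord_sum b x) (lin_sum lf) (lin_sum lv); apply/rowP => j.
  rewrite mxE summxE; apply: eq_bigr => i _.
  by rewrite (linZ lf) (linZ lv) !mxE.
have : ~~ (v2r y0 <= M)%MS.
  apply/negP => /submxP [r rE]; apply: (ny (\sum_i r 0 i *: bvec b i)).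
  apply: (coord_eq (b := c)) => j.
  have : v2r (f (\sum_i r 0 i *: bvec b i)) = v2r y0.
    rewrite rE fM; congr (_ *m _); apply/rowP => i; rewrite mxE.
    rewrite (lin_sum (coord_linear b i)) (bigD1 i) //=.
    rewrite (linZ (coord_linear b i)) coord_bvec eqxx [_ *: _]mulr1 big1 ?addr0 // => l li.
    by rewrite (linZ (coord_linear b i)) coord_bvec eq_sym (negPf li) scaler0.
  by move/rowP/(_ j); rewrite !mxE.
rewrite submxE => /eqP nz.
have [j jn] : exists j, (v2r y0 *m cokermx M) 0 j <> 0.
  by apply: contrapT => h; apply: nz; apply/rowP => j; rewrite [RHS]mxE;
     apply: contrapT => hj; apply: h; exists j.
exists (fun y => (v2r y *m cokermx M) 0 j); split=> // [a u v|x].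
  by rewrite lv mulmxDl -scalemxAl !mxE.
by rewrite fM -mulmxA mulmx_coker mulmx0 mxE.
Qed.

End LinearLifting.

Section Epimorphisms.
Variables (k : fieldType) (A : algType k).
Hypothesis fA : finite_dim A.

Lemma coind_act_linear a (f : dual A) : linear (fun x : A => f (x * a)).
Proof. by apply: lin_comp (dual_linear f) _; lin. Qed.

(** The coinduced module: an [A]-linear map [Y -> coindmod] is the same as a
    linear functional on [Y]. *)
Definition coindmod : fdmod A.
Proof.
refine (@FDMod k A (dual A) (fun a f => mk_dual (coind_act_linear a f)) _ _ _ _).
- split=> [f a u v|a c f g]; apply: dual_ext => x //=.
  by rewrite mulrDr -scalerAr (dual_linear f).
- by move=> f; apply: dual_ext => x /=; rewrite mulr1.
- by move=> a b f; apply: dual_ext => x /=; rewrite mulrA.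
- exact: finite_dim_dual.
Defined.

Section CoindHom.
Variables (Y : fdmod A) (l : Y -> k^o).
Hypothesis ll : linear l.

Lemma coind_fun_linear y : linear (fun x : A => l (act x y)).
Proof. exact: lin_comp ll (proj1 (act_bilin Y) y). Qed.

Lemma coind_hom_linear : linear (fun y => mk_dual (coind_fun_linear y) : coindmod).
Proof.
by move=> a u v; apply: dual_ext => x /=; rewrite (proj2 (act_bilin Y) x) ll.
Qed.

Lemma coind_hom_act a y : (mk_dual (coind_fun_linear (act a y)) : coindmod) =
  act a (mk_dual (coind_fun_linear y) : coindmod).
Proof. by apply: dual_ext => x /=; rewrite actM. Qed.

Definition coind_hom : fdhom Y coindmod := mk_fdhom coind_hom_linear coind_hom_act.

End CoindHom.

(** If [y0] is not in the image of [f], a functional vanishing on the image but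
    not at [y0] gives a nonzero map from [Y] to the coinduced module whose
    composite with [f] is zero. *)
Lemma epi_surj (X Y : fdmod_cat A) (f : hom (fdmod_cat A) X Y) :
  is_epi f -> forall y, exists x, (f : fdhom X Y) x = y.
Proof.
move=> epi y0; apply: contrapT => ny.
have lf := fdhom_linear f.
have [|l [ll lf0 ly0]] := separate_image (fdmod_finite X) (fdmod_finite Y) lf (y0 := y0).
  by move=> x xy; apply: ny; exists x.
have e : coind_hom ll = 0 :> fdhom Y coindmod.
  apply: (epi coindmod); apply: fdhom_ext => x; apply: dual_ext => a.
  by rewrite /= -fdhom_act lf0.
apply: ly0; rewrite -[y0]act1.
by have := congr1 (fun g : fdhom Y coindmod => (g y0 : dual A) 1) e.
Qed.

Lemma surj_epi (X Y : fdmod_cat A) (f : hom (fdmod_cat A) X Y) :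
  (forall y, exists x, (f : fdhom X Y) x = y) -> is_epi f.
Proof.
move=> sf Z g h e; apply: fdhom_ext => y; have [x <-] := sf y.
exact: (congr1 (fun u : fdhom X Z => u x) e).
Qed.

Section FreeModules.
Variables (X : lmodType k).
Hypothesis fX : finite_dim X.

Lemma free_act_bilin : bilin (fun (a : A) (t : tensor A X) =>
  tmap (fun x => a * x) id t).
Proof.
split=> [t|a]; last by apply: tmap_linear; lin.
by apply: tlift_param => x y; lin.
Qed.

Definition freemod : fdmod A.
Proof.
refine (@FDMod k A (tensor A X) (fun a t => tmap (fun x => a * x) id t) _ _ _ _).
- exact: free_act_bilin.
- apply: tens_ext => [||a x]; [exact: (proj2 free_act_bilin) | exact: lin_id |].
  by rewrite tmapE ?mul1r //; lin.
- move=> a b; apply: tens_ext => [||c x].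
  + exact: (proj2 free_act_bilin).
  + exact: lin_comp (proj2 free_act_bilin a) (proj2 free_act_bilin b).
  by rewrite !tmapE ?mulrA //; lin.
- exact: finite_dim_tensor.
Defined.

Lemma freemod_actE a b (x : X) : act a (b ⊗ x : freemod) = (a * b) ⊗ x.
Proof. by rewrite /= tmapE //; lin. Qed.

End FreeModules.

Lemma free_cover_act (P : fdmod A) a (t : freemod (fdmod_finite P)) :
  tlift (fun a p => act a p : P) (act a t) = act a (tlift (fun a p => act a p : P) t).
Proof.
have lt := tlift_linear (act_bilin P).
move: t; apply: tens_ext => [||b p].
- exact: lin_comp lt (proj2 (act_bilin (freemod _)) a).
- exact: lin_comp (proj2 (act_bilin P) a) lt.
by rewrite freemod_actE !(tliftE _ _ (act_bilin P)) actM.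
Qed.

(** The action map from [A ⊗ P], with [A] acting on the left factor only. *)
Definition free_cover (P : fdmod A) : fdhom (freemod (fdmod_finite P)) P :=
  @mk_fdhom _ _ (freemod _) P _ (tlift_linear (act_bilin P)) (@free_cover_act P).

Lemma free_coverE (P : fdmod A) a (p : P) : free_cover P (a ⊗ p) = act a p.
Proof. exact: tliftE (act_bilin P). Qed.

Lemma free_cover_split (P : fdmod_cat A) : is_projective P ->
  exists h : fdhom P (freemod (fdmod_finite P)), forall p, free_cover P (h p) = p.
Proof.
move=> proj; have [|h hE] := proj _ _ (free_cover P : hom (fdmod_cat A) _ _) (idm _ P).
  by apply: surj_epi => p; exists (1 ⊗ p); rewrite free_coverE act1.
by exists h => p; have := congr1 (fun g : fdhom P P => g p) hE.
Qed.

End Epimorphisms.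

(** * Galois comodule algebras *)

Section GaloisComodules.
Variables (k : fieldType) (B : bialgebra k) (A : comodAlgebra B).

(** Writing [tau b] as [b' ⊗ b''], the last two conditions say that
    [(a_(-1) b)' ⊗ (a_(-1) b)'' a_(0) = a b' ⊗ b''] and
    [b'_(-1) ⊗ b'_(0) b'' = b ⊗ 1].  With [tau 1 = 1 ⊗ 1] they make
    [b ⊗ y |-> b' ⊗ b'' y] the inverse of the canonical map
    [x ⊗ y |-> x_(-1) ⊗ x_(0) y]: such an [A] is called a Galois object
    of [B]. *)
Definition translation_map (tau : B -> tensor A A) : Prop :=
  [/\ linear tau, tau 1 = 1 ⊗ 1,
      forall (a : A) (b : B) (U : lmodType k) (F : A -> A -> U), bilin F ->
        tlift (fun p a' => tlift (fun u w => F u (w * a')) (tau (p * b))) (coact a) =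
        tlift (fun u w => F (a * u) w) (tau b)
    & forall (b : B) (U : lmodType k) (F : B -> A -> U), bilin F ->
        tlift (fun u w => tlift (fun p u' => F p (u' * w)) (coact u)) (tau b) = F b 1].

Variable tau : B -> tensor A A.
Hypothesis tauP : translation_map tau.
Hypotheses (fB : finite_dim B).

Let ltau : linear tau. Proof. by case: tauP. Qed.
Let tau1 : tau 1 = 1 ⊗ 1. Proof. by case: tauP. Qed.
Let tau_coact (a : A) (b : B) (U : lmodType k) (F : A -> A -> U) : bilin F ->
  tlift (fun p a' => tlift (fun u w => F u (w * a')) (tau (p * b))) (coact a) =
  tlift (fun u w => F (a * u) w) (tau b).
Proof. by case: tauP => _ _ h _; exact: h. Qed.
Let coact_tau (b : B) (U : lmodType k) (F : B -> A -> U) : bilin F ->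
  tlift (fun u w => tlift (fun p u' => F p (u' * w)) (coact u)) (tau b) = F b 1.
Proof. by case: tauP => _ _ _ h; exact: h. Qed.

Section Universal.
Variables (X : lmodType k) (fX : finite_dim X) (M N : fdmod A).
Notation FX := (freemod fB fX : fdmod B).

Lemma galois_act (a : A) b (x : X) (m : M) :
  act a ((b ⊗ x : FX) ⊗ m : tensmod FX M) =
  tlift (fun p q => ((p * b) ⊗ x : FX) ⊗ act q m) (coact a).
Proof.
rewrite tensmod_act_tens; apply: eq_tlift => p q; congr (_ ⊗ _).
exact: freemod_actE.
Qed.

(** The second Galois condition writes [(b ⊗ x) ⊗ m] as the sum of
    [b' ((1 ⊗ x) ⊗ b'' m)], so [(B ⊗ X) ⊗ M] is generated over [A] by the
    elements [(1 ⊗ x) ⊗ m]. *)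
Lemma galois_homE (f : fdhom (tensmod FX M) N) b (x : X) (m : M) :
  f ((b ⊗ x : FX) ⊗ m) = tlift (fun u w => act u (f ((1 ⊗ x : FX) ⊗ act w m))) (tau b).
Proof.
have lf := fdhom_linear f; have hM := act_bilin M.
rewrite -{1}[m]act1 -(@coact_tau b _ (fun p a => f ((p ⊗ x : FX) ⊗ act a m))); last first.
  split=> z; apply: lin_comp lf _; first by apply: tens_linl; apply: tens_linl; exact: lin_id.
  by apply: tens_linr; exact: (proj1 hM m).
apply: eq_tlift => u w; rewrite -fdhom_act galois_act (tlift_comp _ _ lf).
by apply: eq_tlift => p q; rewrite mulr1 actM.
Qed.

Lemma galois_hom_ext (f g : fdhom (tensmod FX M) N) :
  (forall x m, f ((1 ⊗ x : FX) ⊗ m) = g ((1 ⊗ x : FX) ⊗ m)) -> f = g.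
Proof.
move=> h; apply: fdhom_ext; apply: (tens_ext3 (fdhom_linear f) (fdhom_linear g)).
move=> b x m; rewrite [LHS]galois_homE [RHS]galois_homE.
by apply: eq_tlift => u w; rewrite h.
Qed.

(** The generators [(1 ⊗ x) ⊗ m] are free: the formula of [galois_homE] defines
    an extension of any linear map [L], and its [A]-linearity is the first
    Galois condition. *)
Section Extend.
Variable L : tensor X M -> N.
Hypothesis lL : linear L.

Let core (x : X) (m : M) (u w : A) : N := act u (L (x ⊗ act w m)).

Let core_bilin x m : bilin (core x m).
Proof.
split=> z; first exact: (proj1 (act_bilin N) _).
apply: lin_comp (proj2 (act_bilin N) z) _; apply: lin_comp lL _.
by apply: tens_linr; exact: (proj1 (act_bilin M) m).
Qed.

Let inner (m : M) (s : tensor B X) : N :=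
  tlift (fun b x => tlift (core x m) (tau b)) s.

Let inner_bilin0 m : bilin (fun b x => tlift (core x m) (tau b)).
Proof.
split=> z; first by apply: lin_comp (tlift_linear (core_bilin z m)) ltau.
apply: tlift_param => u w; apply: lin_comp (proj2 (act_bilin N) u) _.
by apply: lin_comp lL _; apply: tens_linl; exact: lin_id.
Qed.

Let inner_bilin : bilin (fun (s : tensor B X) m => inner m s).
Proof.
split=> z; first exact: tlift_linear.
apply: tlift_param => b x; apply: tlift_param => u w.
apply: lin_comp (proj2 (act_bilin N) u) _; apply: lin_comp lL _.
by apply: tens_linr; exact: (proj2 (act_bilin M) w).
Qed.

Let ext_fun (t : tensmod FX M) : N := tlift (fun (s : FX) m => inner m s) t.

Let ext_linear : linear ext_fun. Proof. exact: tlift_linear. Qed.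

Let ext_funE b x m : ext_fun ((b ⊗ x : FX) ⊗ m) = tlift (core x m) (tau b).
Proof. by rewrite /ext_fun (tliftE _ _ inner_bilin) /inner tliftE. Qed.

Let ext_act (a : A) (t : tensmod FX M) : ext_fun (act a t) = act a (ext_fun t).
Proof.
have la := proj2 (act_bilin (tensmod FX M)) a; have lN := proj2 (act_bilin N) a.
move: t; apply: tens_ext3 => [||b x m].
- exact: lin_comp ext_linear la.
- exact: lin_comp lN ext_linear.
rewrite galois_act (tlift_comp _ _ ext_linear) ext_funE (tlift_comp _ _ lN).
transitivity (tlift (fun p a' => tlift (fun u w => core x m u (w * a')) (tau (p * b))) (coact a)).
  apply: eq_tlift => p a'; rewrite ext_funE; apply: eq_tlift => u w.
  by rewrite /core actM.
by rewrite (tau_coact _ _ (core_bilin x m)); apply: eq_tlift => u w; rewrite /core actM.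
Qed.

Lemma galois_hom_extend : exists f : fdhom (tensmod FX M) N,
  forall x m, f ((1 ⊗ x : FX) ⊗ m) = L (x ⊗ m).
Proof.
exists (mk_fdhom ext_linear ext_act) => x m.
by rewrite /= ext_funE tau1 (tliftE _ _ (core_bilin x m)) /core !act1.
Qed.

End Extend.
End Universal.

(** A map from [P ⊗ N] is composed with [FP ⊗ N -> P ⊗ N], where [FP] is the free
    module [B ⊗ P].  Lifting from [FP ⊗ N] along an epimorphism amounts to
    lifting linear maps, and the splitting of [FP -> P] brings the lift back to
    [P ⊗ N]. *)
Theorem galois_exact : finite_dim A -> exact_modCat (fdmod_modCat A).
Proof.
move=> fA P N projP X Y f g epi_f.
have [h hK] := free_cover_split fB projP.
pose FP := freemod fB (fdmod_finite P).
pose g' : fdhom (tensmod FP N) Y :=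
  fdhom_comp g (tensmod_map (free_cover fB P) (fdhom_id N)).
have lf := fdhom_linear f; have lg := fdhom_linear g.
have [L lL fL] := linear_lift (finite_dim_tensor (fdmod_finite P) (fdmod_finite N))
  lf lg (epi_surj fA epi_f).
have [phi phiE] := galois_hom_extend (fdmod_finite P) lL.
have e : fdhom_comp f phi = g'.
  apply: galois_hom_ext => p n; rewrite !fdhom_compE phiE fL.
  by rewrite tensmod_mapE free_coverE act1.
exists (fdhom_comp phi (tensmod_map h (fdhom_id N))).
apply: fdhom_ext => t.
rewrite -[LHS]/(fdhom_comp f phi (tensmod_map h (fdhom_id N) t)) e.
rewrite /g' fdhom_compE -[X in g X = _]fdhom_compE -tensmod_map_comp.
have -> : fdhom_comp (free_cover fB P) h = fdhom_id P by apply: fdhom_ext.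
congr (g _).
exact: (congr1 (fun u : fdhom (tensmod P N) (tensmod P N) => u t) (tensmod_map_id P N)).
Qed.


(** With [X] free of rank one, maps [X ⊗ M -> M] are arbitrary linear
    endomorphisms of [M]; one that sends a vector of the image of [e1] to a
    vector outside the kernel of [e2] has the required property. *)
Lemma galois_nonzero_hom (M : fdmod A) (e1 e2 : fdhom M M) :
  e1 <> 0 -> e2 <> 0 ->
  exists (X : fdmod B) (f : fdhom (tensmod X M) M),
    fdhom_comp e2 (fdhom_comp f (tensmod_map (fdhom_id X) e1)) <> 0.
Proof.
have nz (e : fdhom M M) : e <> 0 -> exists v, e v <> 0.
  move=> ne; apply: contrapT => h; apply: ne; apply: fdhom_ext => v.
  by apply: contrapT => ev; apply: h; exists v.
move=> /nz [v e1v] /nz [w e2w]; have [b] := exists_basis (fdmod_finite M).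
have [i ci] : exists i, coord b i (e1 v) <> 0.
  apply: contrapT => h; apply: e1v; apply: (coord_eq (b := b)) => i.
  rewrite (lin0 (coord_linear b i)); apply: contrapT => ci; apply: h; by exists i.
pose L (t : tensor k^o M) : M := (coord b i (tscal t) : k) *: w.
have lL : linear L.
  by apply: lin_scalel; apply: lin_comp (coord_linear b i) (@tscal_linear _ _).
have [f fE] := galois_hom_extend (finite_dim_regular k) lL.
pose X : fdmod B := freemod fB (finite_dim_regular k).
exists X, f => e.
have := congr1 (fun g : fdhom (tensmod X M) M => g ((1 ⊗ (1 : k^o) : X) ⊗ v)) e.
rewrite !fdhom_compE tensmod_mapE fE /L tscalE scale1r (linZ (fdhom_linear e2)).
move/eqP; rewrite scaler_eq0 => /orP[/eqP|/eqP]; [exact: ci | exact: e2w].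
Qed.

End GaloisComodules.

Section LinCatLemmas.
Variables (k : fieldType) (C : linCat k).

Lemma comp0l (X Y Z : C) (f : hom C X Y) : (0 : hom C Y Z) \c f = 0.
Proof. exact: (lin0 (proj1 (comp_bilin (l := C) X Y Z) f)). Qed.

Lemma comp0r (X Y Z : C) (f : hom C Y Z) : f \c (0 : hom C X Y) = 0.
Proof. exact: (lin0 (proj2 (comp_bilin (l := C) X Y Z) f)). Qed.

Lemma iso_comp_eq0 (X Y Z : C) (a : hom C X Y) (f : hom C Y Z) :
  is_iso a -> f \c a = 0 -> f = 0.
Proof. by move=> [b [_ ab]] fa; rewrite -[f]comp_idr -ab compA fa comp0l. Qed.

Lemma comp_iso_eq0 (X Y Z : C) (a : hom C Y Z) (f : hom C X Y) :
  is_iso a -> a \c f = 0 -> f = 0.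
Proof. by move=> [b [ba _]] fa; rewrite -[f]comp_idl -ba -compA fa comp0r. Qed.

End LinCatLemmas.

Lemma fmap_eq0 (k : fieldType) (C D : linCat k) (F : linFunctor C D) (G : linFunctor D C) :
  nat_isomorphic (comp_functor G F) (id_functor C) ->
  forall X Y (f : hom C X Y), fmap F f = 0 -> f = 0.
Proof.
move=> [a [iso nat]] X Y f f0; apply: (iso_comp_eq0 (iso X)).
by rewrite -[LHS]nat /= f0 (lin0 (@fmap_linear _ _ _ G (F X) (F Y))) comp0r.
Qed.

(** If the category were the sum of [N1] and [N2], an object with nonzero
    components [n1] and [n2] would correspond to an [A]-module with two
    endomorphisms, the identities of the components.  On the side of the sum,
    [E1] has no second component, and acting by objects preserves this, while
    [E2] has no first component; so the composite of [galois_nonzero_hom] is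
    zero. *)
Theorem galois_indecomposable (k : fieldType) (B : bialgebra k) (A : comodAlgebra B)
    (tau : B -> tensor A A) :
  translation_map tau -> finite_dim B -> indecomposable (fdmod_modCat A).

Proof.
move=> tauP fB [N1 [N2 [[n1 id1] [n2 id2] [F [s [[G [GF FG]] siso snat _ _]]]]]].
pose n : sum_modCat N1 N2 := (n1, n2).
pose E1 : hom (sum_modCat N1 N2) n n := (idm N1 n1, 0).
pose E2 : hom (sum_modCat N1 N2) n n := (0, idm N2 n2).
have Ge1 : fmap G E1 <> 0.
  by move=> /(fmap_eq0 FG) /(congr1 fst).
have Ge2 : fmap G E2 <> 0.
  by move=> /(fmap_eq0 FG) /(congr1 snd).
have [X [f nz]] := galois_nonzero_hom tauP fB Ge1 Ge2.
apply: nz; apply: (fmap_eq0 GF).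
have [a [aiso anat]] := FG.
have iso2 (C D : modCat (fdmod_monCat B)) (p q : sum_modCat C D) (u : hom (sum_modCat C D) p q) :
    is_iso u -> is_iso u.1 /\ is_iso u.2.
  by move=> [v [/= vu uv]]; split;
    [exists v.1; split; [exact: (congr1 fst vu) | exact: (congr1 fst uv)]
    |exists v.2; split; [exact: (congr1 snd vu) | exact: (congr1 snd uv)]].
have FE1 : (fmap F (fmap G E1)).2 = 0.
  apply: (comp_iso_eq0 (iso2 _ _ _ _ _ (aiso n)).2).
  by rewrite -[LHS]/(a n \c fmap (comp_functor F G) E1).2 anat /= comp0l.
have FE2 : (fmap F (fmap G E2)).1 = 0.
  apply: (comp_iso_eq0 (iso2 _ _ _ _ _ (aiso n)).1).
  by rewrite -[LHS]/(a n \c fmap (comp_functor F G) E2).1 anat /= comp0l.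
have FXE1 (Z : fdmod_monCat B) : (fmap F (amap (idm _ Z) (fmap G E1))).2 = 0.
  apply: (comp_iso_eq0 (iso2 _ _ _ _ _ (siso Z (G n))).2).
  rewrite -[LHS]/(s Z (G n) \c fmap F (amap (idm _ Z) (fmap G E1))).2 snat /= FE1.
  by rewrite (lin0 (proj2 (amap_bilin (m := N2) _ _ _ _) _)) comp0l.
pose g : hom (fdmod_modCat A) (aob (X : fdmod_monCat B) (G n)) (G n) := f.
rewrite -[fdhom_comp _ _]/(fmap G E2 \c (g \c amap (idm (fdmod_monCat B) X) (fmap G E1))).
rewrite !fmap_comp; apply: injective_projections => /=.
- by rewrite FE2 comp0l.
- by rewrite FXE1 !comp0r.
Qed.

(** * The residue field of a maximal ideal *)

Section ResidueField.
Variables (k : fieldType) (H : hopfAlgebra k) (C : centralHopfSub H).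
Hypothesis Cfg : fin_gen_module C.
Variable m : maxSpec C.

Notation A := (hquot Cfg m).
Notation pi := (qpi (mH Cfg m) : H -> A).

Lemma pi_max c : m c -> pi c = 0.
Proof.
move=> mc; rewrite -(linear0 (qpi (mH Cfg m))); apply: pi_eq.
by rewrite subr0 -[c]mulr1; exact: max_ext_gen.
Qed.

(** The field [C/m] is realised as the image of [C] in the quotient of [H] by
    [mH]; the elements of [C] that die in it are those of [m]. *)
Definition residue_pred : {pred A} := fun x => `[< exists2 c, C c & x = pi c >].

Record residue := Residue { residue_val :> A; residueP : residue_val \in residue_pred }.

HB.instance Definition _ := [isSub for residue_val].
HB.instance Definition _ := [Choice of residue by <:].

Lemma residue_pi c : C c -> pi c \in residue_pred.
Proof. by move=> Cc; apply/asboolP; exists c. Qed.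

Lemma residue_subring_closed : subring_closed residue_pred.
Proof.
split=> [|x y /asboolP [c Cc ->] /asboolP [d Cd ->]|x y /asboolP [c Cc ->] /asboolP [d Cd ->]].
- by rewrite -(rmorph1 (qpi (mH Cfg m))); apply: residue_pi; exact: csub1.
- by rewrite -(raddfB (qpi (mH Cfg m))); apply: residue_pi; apply: csubD => //; exact: csubN.
- by rewrite -(rmorphM (qpi (mH Cfg m))); apply: residue_pi; exact: csubM.
Qed.

HB.instance Definition _ :=
  GRing.isSubringClosed.Build A residue_pred residue_subring_closed.
HB.instance Definition _ := [SubChoice_isSubNzRing of residue by <:].

Lemma residue_central (x : residue) (y : A) : val x * y = y * val x.
Proof.
have [c Cc ->] : exists2 c, C c & val x = pi c by exact/asboolP/residueP.
rewrite -[y]qreprK.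
by rewrite -!(rmorphM (qpi (mH Cfg m))) (csub_central _ Cc).
Qed.

Lemma residue_mulC : commutative (@GRing.mul residue).
Proof. by move=> x y; apply: val_inj; rewrite !rmorphM residue_central. Qed.

HB.instance Definition _ := GRing.PzRing_hasCommutativeMul.Build residue residue_mulC.

(** If [c] in [C] has nonzero image then it is not in [m], so the ideal
    [m + C c] is all of [C] by maximality. *)
Lemma residue_inv_exists (x : residue) :
  exists y : residue, (x = 0 -> y = 0) /\ (x != 0 -> y * x = 1).
Proof.
have [-> | x0] := eqVneq x 0; first by exists 0; split.
have [c Cc xE] : exists2 c, C c & val x = pi c by exact/asboolP/residueP.
pose J z := exists a d, [/\ m a, C d & z = a + d * c].
have J_ideal : is_ideal C J.
  split.
  - by move=> _ [a [d [ma Cd ->]]]; apply: csubD; [exact: max_sub ma | exact: csubM].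
  - by exists 0, 0; rewrite mul0r addr0; split=> //; [exact: max0 | exact: csub0].
  - move=> _ _ [a [d [ma Cd ->]]] [a' [d' [ma' Cd' ->]]].
    exists (a + a'), (d + d'); rewrite mulrDl addrACA.
    by split=> //; [exact: maxD | exact: csubD].
  - move=> e _ Ce [a [d [ma Cd ->]]]; exists (e * a), (e * d).
    by rewrite mulrDr mulrA; split=> //; [exact: maxMl | exact: csubM].
have [_ _ maximal] := max_ideal m.
have mJ : (max_set m `<=` J)%classic.
  by move=> a ma; exists a, 0; rewrite mul0r addr0; split=> //; exact: csub0.
have JC : J = (C : set H).
  apply: contrapT => ne; have Jm := maximal J J_ideal mJ ne.
  have mc : m c.
    rewrite -[max_set m]Jm; exists 0, 1; rewrite mul1r add0r.
    by split=> //; [exact: max0 | exact: csub1].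
  by case/eqP: x0; apply: val_inj; rewrite xE pi_max.
have : J 1 by rewrite JC; exact: csub1.
move=> [a [d [ma Cd e1]]]; exists (Residue (residue_pi Cd)).
split=> [x_eq0|_]; first by rewrite x_eq0 eqxx in x0.
apply: val_inj; rewrite rmorphM rmorph1 [X in _ * X]xE /=.
rewrite -(rmorphM (qpi (mH Cfg m))) -(rmorph1 (qpi (mH Cfg m))) e1.
by rewrite rmorphD /= (pi_max ma) add0r.
Qed.

Definition residue_inv (x : residue) : residue := sval (cid (residue_inv_exists x)).

Lemma residue_mulVf x : x != 0 -> residue_inv x * x = 1.
Proof. by move=> x0; rewrite /residue_inv; case: cid => y /= [_ h]; exact: h. Qed.

Lemma residue_inv0 : residue_inv 0 = 0.
Proof. by rewrite /residue_inv; case: cid => y /= [h _]; exact: h. Qed.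

HB.instance Definition _ := GRing.ComNzRing_isField.Build residue residue_mulVf residue_inv0.

(** A copy of the quotient algebra that carries its vector space structure over
    the residue field instead of the one over [k]. *)
Definition residue_space : Type := A.
HB.instance Definition _ := GRing.Zmodule.on residue_space.

Definition residue_scale (c : residue) (x : residue_space) : residue_space :=
  (val c : A) * (x : A).

Lemma residue_scaleA a b x :
  residue_scale a (residue_scale b x) = residue_scale (a * b) x.
Proof. by rewrite /residue_scale rmorphM mulrA. Qed.
Lemma residue_scale1 : left_id 1 residue_scale.
Proof. by move=> x; rewrite /residue_scale rmorph1 mul1r. Qed.
Lemma residue_scaleDr : right_distributive residue_scale +%R.
Proof. by move=> a x y; exact: mulrDr. Qed.
Lemma residue_scaleDl x : {morph residue_scale^~ x : a b / a + b}.
Proof. by move=> a b; rewrite /residue_scale rmorphD mulrDl. Qed.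

HB.instance Definition _ := GRing.Zmodule_isLmodule.Build residue residue_space
  residue_scaleA residue_scale1 residue_scaleDr residue_scaleDl.

Definition residue_scalar (a : k) : residue :=
  Residue (residue_pi (csubZ a (csub1 C))).

Lemma residue_scalarE a : val (residue_scalar a) = a *: 1 :> A.
Proof. by rewrite /= linearZ /= (rmorph1 (qpi (mH Cfg m))). Qed.

Lemma residue_scalar_additive : zmod_morphism residue_scalar.
Proof.
move=> a b; apply: val_inj.
by rewrite (raddfB val) residue_scalarE scalerBl -!residue_scalarE.
Qed.

Lemma residue_scalar_monoid : monoid_morphism residue_scalar.
Proof.
split=> [|a b]; apply: val_inj; rewrite ?(rmorph1 val) ?(rmorphM val) residue_scalarE.
  by rewrite scale1r.
by rewrite -scalerA -[b *: 1]mul1r scalerAl -!residue_scalarE.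
Qed.

HB.instance Definition _ := GRing.isZmodMorphism.Build k residue residue_scalar
  residue_scalar_additive.
HB.instance Definition _ := GRing.isMonoidMorphism.Build k residue residue_scalar
  residue_scalar_monoid.

Lemma finite_dim_residue_space : finite_dim (residue_space : lmodType residue).
Proof.
have [n [h hh]] := Cfg; exists n, (fun i => pi (h i) : residue_space) => x.
have [c [Cc cE]] := hh (qrepr (x : A)).
exists (fun i => Residue (residue_pi (Cc i))).
rewrite -[LHS](qreprK (x : A)) cE (raddf_sum (qpi (mH Cfg m))); apply: eq_bigr => i _.
exact: (rmorphM (qpi (mH Cfg m))).
Qed.

End ResidueField.

Section Finiteness.
Variables (k : closedFieldType) (H : hopfAlgebra k) (C : centralHopfSub H).
Hypothesis H_affine : affine H.
Hypothesis Cfg : fin_gen_module C.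
Variable m : maxSpec C.

Notation A := (hquot Cfg m).
Notation pi := (qpi (mH Cfg m) : H -> A).
Notation K := (residue Cfg m).
Notation AK := (residue_space Cfg m).

Lemma residue_scaleE (c : K) (x : AK) : c *: x = (val c * (x : A)) :> A.
Proof. by []. Qed.

(** Let [S] be a subring containing [k], the coordinates of the algebra
    generators [g] and the structure constants, for a basis having [1] as a
    member.  The elements of [H] all of whose coordinates lie in [S] form a
    subalgebra containing [g], hence everything; and the coordinate along [1] of
    an element [y] of the residue field is [y]. *)
Lemma residue_finitely_generated :
  exists s : seq K, forall y, in_adjoin (residue_scalar Cfg m) s y.
Proof.
have [g gen] := H_affine.
have nz1 : (1 : A) != 0 :> AK by exact: oner_neq0.
have [b [i0 bi0]] := basis_extending (finite_dim_residue_space Cfg m) nz1.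
pose I := 'I_(bdim b).
exists ([seq coord b l (pi x : AK) | x <- g, l <- enum I] ++
  [seq coord b p.1 ((bvec b p.2.1 : A) * (bvec b p.2.2 : A) : AK) | p <- enum {: I * (I * I)}]).
move=> y S [S1 SB SM] Sk Ss.
have S0 : S 0 by rewrite -(subrr 1); exact: SB.
have SD u v : S u -> S v -> S (u + v).
  by move=> Su Sv; rewrite -[v]opprK; apply: (SB) => //; rewrite -sub0r; exact: SB.
have Ssum J (r : seq J) (f : J -> K) : (forall j, S (f j)) -> S (\sum_(j <- r) f j).
  by move=> Sf; elim/big_ind: _ => // j _; exact: Sf.
pose T (x : H) := forall l, S (coord b l (pi x : AK)).
have T_sub : is_subalgebra T.
  split.
  - move=> l; rewrite (rmorph1 (qpi (mH Cfg m))) -bi0 coord_bvec.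
    by case: (_ == _); [exact: S1 | exact: S0].
  - move=> u v Tu Tv l; rewrite (raddfD (qpi (mH Cfg m))).
    by rewrite (linD (coord_linear b l)); exact: SD.
  - move=> a u Tu l.
    have -> : pi (a *: u) = residue_scalar Cfg m a *: (pi u : AK) :> AK.
      by rewrite residue_scaleE residue_scalarE -scalerAl mul1r linearZ.
    by rewrite (linZ (coord_linear b l)); apply: (SM); [exact: Sk | exact: Tu].
  - move=> u v Tu Tv l; rewrite (rmorphM (qpi (mH Cfg m))).
    have -> : pi u * pi v = \sum_i \sum_j (coord b i (pi u) * coord b j (pi v) : K) *:
        ((bvec b i : A) * (bvec b j : A) : AK) :> AK.
      rewrite {1}(coord_sum b (pi u : AK)) {1}(coord_sum b (pi v : AK)) mulr_suml.
      apply: eq_bigr => i _; rewrite mulr_sumr; apply: eq_bigr => j _.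
      rewrite !residue_scaleE (rmorphM val) -!mulrA; congr (_ * _).
      by rewrite !mulrA; congr (_ * _); rewrite residue_central.
    rewrite (lin_sum (coord_linear b l)); apply: (Ssum) => i.
    rewrite (lin_sum (coord_linear b l)); apply: Ssum => j.
    rewrite (linZ (coord_linear b l)); apply: (SM); first exact: SM.
    apply: Ss; rewrite mem_cat; apply/orP; right.
    by apply/mapP; exists (l, (i, j)); rewrite ?mem_enum.
have {gen} T_all x : T x.
  apply: (gen T T_sub) => z zg l; apply: Ss; rewrite mem_cat; apply/orP; left.
  by apply/allpairsP; exists (z, l); rewrite mem_enum.
have [c Cc yE] : exists2 c, C c & val y = pi c by exact/asboolP/residueP.
have -> : y = coord b i0 (pi c : AK); last exact: T_all.
have -> : pi c = y *: bvec b i0 :> AK by rewrite bi0 residue_scaleE mulr1.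
by rewrite (linZ (coord_linear b i0)) coord_bvec eqxx [RHS]mulr1.
Qed.

Lemma pi_central_scalar c : C c -> exists a : k, pi c = a *: 1.
Proof.
move=> Cc; have [s gen] := residue_finitely_generated.
have [a aE] := nullstellensatz gen (Residue (residue_pi Cfg m Cc)).
by exists a; rewrite -residue_scalarE -aE.
Qed.

Lemma finite_dim_hquot : finite_dim A.
Proof.
have [n [h hh]] := Cfg; exists n, (fun i => pi (h i)) => x.
have [c [Cc cE]] := hh (qrepr x).
have /choice [a aE] : forall i, exists a : k, pi (c i) = a *: 1.
  by move=> i; exact: pi_central_scalar.
exists a; rewrite -[LHS]qreprK cE (raddf_sum (qpi (mH Cfg m))); apply: eq_bigr => i _.
transitivity (pi (c i) * pi (h i)); first exact: (rmorphM (qpi (mH Cfg m))).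
by rewrite aE -scalerAl mul1r.
Qed.

End Finiteness.

Lemma tlift_tmap (k : fieldType) (V W V' W' U : lmodType k) (f : V -> V') (g : W -> W')
    (F : V' -> W' -> U) t : linear f -> linear g -> bilin F ->
  tlift F (tmap f g t) = tlift (fun v w => F (f v) (g w)) t.
Proof.
move=> lf lg bF; have l := tmap_linear lf lg; have lF := tlift_linear bF.
move: t; apply: tens_ext => [||v w].
- exact: lin_comp lF l.
- by lin.
by rewrite tmapE // !tliftE //; lin.
Qed.

(** * The quotient Hopf algebra and its Galois objects *)

Section QuotientHopf.
Variables (k : fieldType) (H : hopfAlgebra k) (C : centralHopfSub H).
Hypothesis Cfg : fin_gen_module C.

Notation eps := (aug C).
Notation Hb := (hquot Cfg eps).
Notation S := (@antipode k H).
Notation pi m := (qpi (mH Cfg m) : H -> hquot Cfg m).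

Let piM m x y : pi m (x * y) = pi m x * pi m y.
Proof. exact: (rmorphM (qpi (mH Cfg m))). Qed.

Let pi1 m : pi m 1 = 1. Proof. exact: (rmorph1 (qpi (mH Cfg m))). Qed.

Let lpi m : linear (pi m). Proof. exact: qpi_linear. Qed.

Lemma coact_pi (m : maxSpec C) (U : lmodType k) (F : Hb -> hquot Cfg m -> U) x :
  bilin F -> tlift F (qcoact (pi m x)) = \Delta_(p, q <- x) F (pi eps p) (pi m q).
Proof. by move=> bF; rewrite qcoactE (tlift_tmap _ (lpi eps) (lpi m) bF). Qed.

(** Compatibility with the quotient by the augmentation ideal of [C]: it is
    enough that [f] kills the products [c * x] with [c] of counit zero. *)
Lemma aug_ext_eq0 (U : lmodType k) (f : H -> U) : linear f ->
  (forall c x, C c -> counit c = 0 -> f (c * x) = 0) ->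
  forall x y, pi eps x = pi eps y -> f x = f y.
Proof.
move=> lf f0 x y /qpi_eq h; apply/eqP; rewrite -subr_eq0.
have -> : f x - f y = f (x - y) by rewrite addrC -scaleN1r -lf scaleN1r addrC.
apply/eqP; move: h; apply: (max_ext_ind (P := fun z => f z = 0)).
- exact: lin0.
- by move=> u v fu fv; rewrite (linD lf) fu fv addr0.
- by move=> c z [Cc ec]; exact: f0.
Qed.

Definition qantipode (x : Hb) : Hb := pi eps (S (qrepr x)).

Lemma qantipodeE x : qantipode (pi eps x) = pi eps (S x).
Proof.
apply: (@aug_ext_eq0 _ (fun x => pi eps (S x))); last exact: qreprK.
  by apply: lin_comp (lpi eps) _; lin.
move=> c z Cc ec; rewrite antipodeM piM [pi _ (S c)]pi_aug; last exact: csub_antipode.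
by rewrite counit_antipode ec scale0r mulr0.
Qed.

Lemma qantipode_linear : linear qantipode.
Proof.
move=> a x y; rewrite -[x]qreprK -[y]qreprK -lpi !qantipodeE -lpi.
by rewrite linearP.
Qed.

HB.instance Definition _ :=
  GRing.isLinear.Build k Hb Hb *:%R qantipode qantipode_linear.

Lemma qantipode_mul (x : quot_bialg Cfg) :
  tlift (fun y z => qantipode y * z) (comul x) = (counit x : k) *: 1.
Proof.
have lq := qantipode_linear.
have -> : comul x = qcoact (x : Hb) by [].
rewrite -[x : Hb in LHS]qreprK coact_pi; last first.
  by split=> z; [apply: lin_mull | apply: lin_mulr; exact: lin_id].
transitivity (\Delta_(p, q <- qrepr (x : Hb)) pi eps (S p * q)).
  by apply: eq_sw => p q; rewrite qantipodeE piM.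
by rewrite (sw_antil _ (lpi eps)) pi1.
Qed.

Lemma mul_qantipode (x : quot_bialg Cfg) :
  tlift (fun y z => y * qantipode z) (comul x) = (counit x : k) *: 1.
Proof.
have lq := qantipode_linear.
have -> : comul x = qcoact (x : Hb) by [].
rewrite -[x : Hb in LHS]qreprK coact_pi; last first.
  by split=> z; [apply: lin_mull; exact: lin_id | apply: lin_mulr].
transitivity (\Delta_(p, q <- qrepr (x : Hb)) pi eps (p * S q)).
  by apply: eq_sw => p q; rewrite qantipodeE piM.
by rewrite (sw_antir _ (lpi eps)) pi1.
Qed.

Definition quot_hopf : hopfAlgebra k :=
  @HopfAlgebra k (quot_bialg Cfg) qantipode qantipode_mul mul_qantipode.

Section QuotientTranslation.
Variable m : maxSpec C.
Hypothesis scalar : forall c, C c -> exists a : k, pi m c = a *: 1.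

Definition qtranslation (b : Hb) : tensor (hquot Cfg m) (hquot Cfg m) :=
  \Delta_(p, q <- qrepr b) pi m p ⊗ pi m (S q).

Let core_bilin : bilin (fun p q => pi m p ⊗ pi m (S q)).
Proof.
have h := lpi m; split=> z; first exact: tens_linl.
by apply: tens_linr; apply: lin_comp h _; lin.
Qed.

(** For [c] in [C] of counit zero, [c * z] is sent to the sum of
    [c_1 z_1 ⊗ S z_2 S c_2].  The coproduct of [c] lies in [C ⊗ C] and [c_1] acts
    on the quotient by a scalar, which can be moved to the right-hand factor,
    where [c_1 * S c_2] sums to zero. *)
Lemma qtranslationE x : qtranslation (pi eps x) = \Delta_(p, q <- x) pi m p ⊗ pi m (S q).
Proof.
have lm := lpi m.
apply: (@aug_ext_eq0 _ (fun x => \Delta_(p, q <- x) pi m p ⊗ pi m (S q))); last exact: qreprK.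
  by apply: sw_linear => //; exact: lin_id.
move=> c z Cc ec; rewrite swM //.
pose F (y : H) := \Delta_(p, q <- z) pi m p ⊗ pi m (S q * y).
have lF : linear F by apply: sw_param => p q; apply: tens_linr; apply: lin_comp lm _; lin.
transitivity (\Delta_(c1, c2 <- c) F (c1 * S c2)); last first.
  by rewrite (sw_antir c lF) ec scale0r.
have [s [hs ec']] := csub_comul Cc.
have b1 : bilin (fun c1 c2 => \Delta_(p, q <- z) pi m (c1 * p) ⊗ pi m (S (c2 * q))).
  split=> y; apply: sw_param => p q.
    by apply: tens_linl; apply: lin_comp lm _; lin.
  by apply: tens_linr; apply: lin_comp lm _; lin.
have b2 : bilin (fun c1 c2 => F (c1 * S c2)).
  by split=> y; apply: lin_comp lF _; lin.
rewrite {1}/sw [in RHS]/sw ec' (lin_sum (tlift_linear b1)) (lin_sum (tlift_linear b2)).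
apply: eq_big_seq => -[c1 c2] ps /=; have [/= C1 C2] := hs _ ps.
rewrite !tliftE //; apply: eq_sw => p q; have [a aE] := scalar C1.
rewrite antipodeM !piM aE -scalerAl mul1r tensZl -tensZr; congr (_ ⊗ _).
by rewrite -scalerAl mul1r scalerAr.
Qed.

Lemma qtranslation_linear : linear qtranslation.
Proof.
move=> a x y; rewrite -[x]qreprK -[y]qreprK -lpi !qtranslationE.
exact: (sw_linear core_bilin (@lin_id k H) a (qrepr x) (qrepr y)).
Qed.

Lemma tlift_qtranslation (U : lmodType k) (F : hquot Cfg m -> hquot Cfg m -> U) x :
  bilin F -> tlift F (qtranslation (pi eps x)) = \Delta_(p, q <- x) F (pi m p) (pi m (S q)).
Proof.
move=> bF; rewrite qtranslationE (tlift_comp _ _ (tlift_linear bF)).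
by apply: eq_tlift => p q; rewrite tliftE.
Qed.

Theorem qtranslationP :
  translation_map (A := quot_comod Cfg m) (qtranslation : quot_bialg Cfg -> _).
Proof.
have lm := lpi m.
split.
- exact: qtranslation_linear.
- by rewrite -(pi1 eps) qtranslationE sw1 // antipode1 !pi1.
- move=> a b U F bF; rewrite -[a]qreprK -[b]qreprK.
  have bG z : bilin (fun u w => F u (w * z)).
    by split=> y; [exact: (proj1 bF) | apply: lin_comp (proj2 bF y) _; lin].
  rewrite -[coact _]/(qcoact _) coact_pi; last first.
    split=> z; first by apply: lin_comp (tlift_linear (bG z)) _;
      apply: lin_comp qtranslation_linear _; lin.
    apply: tlift_param => u w; apply: lin_comp (proj2 bF u) _.
    by apply: lin_mulr; exact: lin_id.
  transitivity (\Delta_(p, q <- qrepr a) \Delta_(u, w <- p * qrepr b) F (pi m u) (pi m (S w * q))).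
    apply: eq_sw => p q; rewrite -piM tlift_qtranslation //.
    by apply: eq_sw => u w; rewrite piM.
  rewrite (@sw_translation _ _ _ (fun u w => F (pi m u) (pi m w))); last by lin.
  rewrite tlift_qtranslation; last first.
    by split=> y; [apply: lin_comp (proj1 bF y) _; lin | exact: (proj2 bF)].
  by apply: eq_sw => p q; rewrite piM.
- move=> b U F bF; rewrite -[b]qreprK.
  have bG z : bilin (fun p u => F p (u * z)).
    by split=> y; [exact: (proj1 bF) | apply: lin_comp (proj2 bF y) _; lin].
  have cl : linear (@qcoact _ _ _ Cfg m) by exact: qcoact_linear.
  rewrite tlift_qtranslation; last first.
    split=> y; first exact: lin_comp (tlift_linear (bG y)) cl.
    by apply: tlift_param => p u; apply: lin_comp (proj2 bF p) _; lin.
  transitivity (\Delta_(u, w <- qrepr b) \Delta_(p, q <- u) F (pi eps p) (pi m (q * S w))).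
    apply: eq_sw => u w; rewrite -[coact _]/(qcoact _) coact_pi //.
    by apply: eq_sw => p q; rewrite piM.
  have le := lpi eps.
  rewrite (swA (f := fun p q w => F (pi eps p) (pi m (q * S w)))); first last.
  + by move=> p q; apply: lin_comp (proj2 bF _) _; apply: lin_comp lm _; lin.
  + by move=> p w; apply: lin_comp (proj2 bF _) _; apply: lin_comp lm _; lin.
  + by move=> q w; apply: lin_comp (proj1 bF _) _.
  rewrite -(sw_counitr (qrepr b) (f := fun p => F (pi eps p) 1)); last first.
    by apply: lin_comp (proj1 bF _) _.
  apply: eq_sw => p q; rewrite (sw_antir q (f := fun z => F (pi eps p) (pi m z))) ?pi1 //.
  by apply: lin_comp (proj2 bF _) _.
Qed.

End QuotientTranslation.
End QuotientHopf.

Theorem proposition2p8 (k : closedFieldType) (H : hopfAlgebra k)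
    (H_affine : affine H) (C : centralHopfSub H)
    (H_fin_gen : fin_gen_module C) (m : maxSpec C) :
  let Rep_Hbar := fdmod_monCat (quot_bialg H_fin_gen) in
  let Rep_Hm := fdmod_modCat (quot_comod H_fin_gen m) in
  finite_tensor_cat Rep_Hbar /\
  [/\ finite_cat Rep_Hm, indecomposable Rep_Hm & exact_modCat Rep_Hm].
Proof.
have fHb := finite_dim_hquot H_affine H_fin_gen (aug C).
have fHm := finite_dim_hquot H_affine H_fin_gen m.
have tauP := qtranslationP (pi_central_scalar H_affine H_fin_gen m).
split; first exact: (@finite_hopf_tensor_cat k (quot_hopf H_fin_gen)).
split.
- exact: fdmod_finite_cat.
- exact: galois_indecomposable tauP fHb.
- exact: galois_exact tauP fHb fHm.
Qed.
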